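(* Let $k$ be an infinite field of characteristic $p>0$. Let $R$ be one of the following regular rings: (i) $k[Y_1,\ldots,Y_d]$; (ii) $k[[Y_1,\ldots,Y_d]]$; (iii) $A[X_1,\ldots,X_m]$ where $A=k[[Y_1,\ldots,Y_d]]$. Let $\mathcal{M}$ be an $F_R$-finite module. Fix $r$ with $1\le r\le d$ and put $\overline{R}=R/(Y_1,\ldots,Y_r)$. Then the Koszul homology modules $H_i(Y_1,\ldots,Y_r;\mathcal{M})$ are $F_{\overline{R}}$-finite modules for $i=0,\ldots,r$.
   Context: For a regular (commutative Noetherian) ring $R$ of characteristic $p>0$, let $R'$ be the $R$-bimodule which is $R$ as a left $R$-module and has right action $r'\cdot r=r^pr'$. For an $R$-module $M$ set $F(M)=F_R(M)=R'\otimes_R M$, an $R$-module via the left structure on $R'$. An $F_R$-module is a pair $(\mathcal{M},\theta)$ with $\mathcal{M}$ an $R$-module and $\theta\colon\mathcal{M}\to F(\mathcal{M})$ an $R$-module isomorphism. It is $F_R$-finite if there are a finitely generated $R$-module $M$ and an $R$-linear map $\beta\colon M\to F(M)$ such that $\mathcal{M}$ is the direct limit of $M\xrightarrow{\beta}F(M)\xrightarrow{F(\beta)}F^2(M)\to\cdots$, with $\theta$ induced by the vertical maps $F^j(\beta)\colon F^j(M)\to F^{j+1}(M)$ from this system to the system $F(M)\to F^2(M)\to F^3(M)\to\cdots$. An $R$-module is said to be $F_R$-finite if it carries such a structure; $\theta$ is usually suppressed from the notation. *)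

(* Defs.v *)
From HB Require Import structures.
From mathcomp Require Import all_boot all_order all_algebra.
From mathcomp Require Import ring_quotient freeg mpoly.
From mathcomp Require Import boolp ring.

Set Implicit Arguments.
Unset Strict Implicit.
Unset Printing Implicit Defensive.

Import GRing.Theory.
Local Open Scope ring_scope.
Local Open Scope quotient_scope.

(* Formal power series in n variables *)
Record mseries (n : nat) (R : Type) :=
  MSeries { mscoef : 'X_{1..n} -> R }.

Section MSeries.
Variables (n : nat) (R : comNzRingType).
Implicit Types f g h : mseries n R.

Lemma mseriesP f g : mscoef f =1 mscoef g -> f = g.
Proof. by case: f g => [f] [g] /= fg; congr MSeries; apply: funext. Qed.

HB.instance Definition _ := gen_eqMixin (mseries n R).
HB.instance Definition _ := gen_choiceMixin (mseries n R).

Definition msconst (c : R) : mseries n R :=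
  MSeries (fun m => if m == 0%MM then c else 0).
Definition msvar (i : 'I_n) : mseries n R :=
  MSeries (fun m => if m == U_(i)%MM then 1 else 0).
Definition msopp f : mseries n R := MSeries (fun m => - mscoef f m).
Definition msadd f g : mseries n R :=
  MSeries (fun m => mscoef f m + mscoef g m).

(* Cauchy product: the sum ranges over the finitely many pairs of monomials  *)
(* h with h.1 + h.2 = m, both of which have degree at most that of m.        *)
Definition msmul f g : mseries n R :=
  MSeries (fun m =>
    \sum_(h : 'X_{1..n < (mdeg m).+1, (mdeg m).+1} | m == (h.1 + h.2)%MM)
      mscoef f h.1 * mscoef g h.2).

Fact msaddA : associative msadd.
Proof. by move=> f g h; apply: mseriesP => m /=; rewrite addrA. Qed.
Fact msaddC : commutative msadd.
Proof. by move=> f g; apply: mseriesP => m /=; rewrite addrC. Qed.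
Fact msadd0 : left_id (msconst 0) msadd.
Proof. by move=> f; apply: mseriesP => m /=; rewrite if_same add0r. Qed.
Fact msaddN : left_inverse (msconst 0) msopp msadd.
Proof. by move=> f; apply: mseriesP => m /=; rewrite if_same addNr. Qed.

HB.instance Definition _ :=
  GRing.isZmodule.Build (mseries n R) msaddA msaddC msadd0 msaddN.

Definition mstrunc (N : nat) f : {mpoly R[n]} :=
  \sum_(m : 'X_{1..n < N}) mscoef f m *: 'X_[m].

Lemma mcoeff_mstrunc N f m : (mdeg m < N)%N -> (mstrunc N f)@_m = mscoef f m.
Proof.
move=> mN; rewrite /mstrunc raddf_sum /= (bigD1 (BMultinom mN)) //=.
rewrite mcoeffZ mcoeffX eqxx mulr1 big1 ?addr0 // => i /negPf im.
rewrite mcoeffZ mcoeffX; case: eqP => [e|_]; last by rewrite mulr0.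
by move: im; rewrite bmeqP /= e eqxx.
Qed.

Lemma mcoeffM_eq (p q p' q' : {mpoly R[n]}) m :
  (forall m', (mdeg m' <= mdeg m)%N -> p@_m' = p'@_m') ->
  (forall m', (mdeg m' <= mdeg m)%N -> q@_m' = q'@_m') ->
  (p * q)@_m = (p' * q')@_m.
Proof.
move=> pp qq; rewrite !mcoeffM; apply: eq_bigr => h _.
by rewrite pp ?qq // -ltnS; apply: bmdeg.
Qed.

Lemma mscoefM f g m N : (mdeg m < N)%N ->
  mscoef (msmul f g) m = (mstrunc N f * mstrunc N g)@_m.
Proof.
move=> mN; rewrite mcoeffM /=; apply: eq_bigr => h _.
by rewrite !mcoeff_mstrunc // (leq_trans (bmdeg _) mN).
Qed.

Lemma mstruncM f g N m : (mdeg m < N)%N ->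
  (mstrunc N (msmul f g))@_m = (mstrunc N f * mstrunc N g)@_m.
Proof. by move=> mN; rewrite mcoeff_mstrunc // -mscoefM. Qed.

Fact msmulA : associative msmul.
Proof.
move=> f g h; apply: mseriesP => m.
have mN := ltnSn (mdeg m).
rewrite (mscoefM _ _ mN) (mscoefM _ _ mN).
transitivity ((mstrunc (mdeg m).+1 f *
  (mstrunc (mdeg m).+1 g * mstrunc (mdeg m).+1 h))@_m).
  by apply: mcoeffM_eq => // m' m'm; rewrite mstruncM.
by rewrite mulrA; apply: mcoeffM_eq => // m' m'm; rewrite mstruncM.
Qed.

Fact msmulC : commutative msmul.
Proof.
move=> f g; apply: mseriesP => m.
by rewrite !(mscoefM _ _ (ltnSn (mdeg m))) mulrC.
Qed.

Fact msmul1 : left_id (msconst 1) msmul.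
Proof.
move=> f; apply: mseriesP => m; have mN := ltnSn (mdeg m).
rewrite (mscoefM _ _ mN) -(mcoeff_mstrunc f mN) -[in RHS](mul1r (mstrunc _ f)).
apply: mcoeffM_eq => // m' m'm; rewrite mcoeff_mstrunc //= mcoeff1.
by case: (m' == _).
Qed.

Fact msmulDl : left_distributive msmul msadd.
Proof.
move=> f g h; apply: mseriesP => m /=; rewrite -big_split /=.
by apply: eq_bigr => i _; rewrite mulrDl.
Qed.

Fact ms1_neq0 : msconst 1 != 0.
Proof.
apply/eqP => /(congr1 (fun f => mscoef f 0%MM)) /=.
by rewrite !eqxx => /eqP; rewrite oner_eq0.
Qed.

HB.instance Definition _ := GRing.Zmodule_isComNzRing.Build (mseries n R)
  msmulA msmulC msmul1 msmulDl ms1_neq0.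

Definition msconstterm f : R := mscoef f 0%MM.

Fact msconstterm_is_zmod_morphism : zmod_morphism msconstterm.
Proof. by []. Qed.

Fact msconstterm_is_monoid_morphism : monoid_morphism msconstterm.
Proof.
split=> [|f g]; first by rewrite /msconstterm /= eqxx.
have z : (mdeg (0%MM : 'X_{1..n}) < 1)%N by rewrite mdeg0.
by rewrite [LHS](mscoefM f g z) rmorphM /= !mcoeff_mstrunc.
Qed.

HB.instance Definition _ :=
  GRing.isZmodMorphism.Build (mseries n R) R msconstterm
    msconstterm_is_zmod_morphism.
HB.instance Definition _ :=
  GRing.isMonoidMorphism.Build (mseries n R) R msconstterm
    msconstterm_is_monoid_morphism.

End MSeries.

Section SeqIdeal.
Variables (R : comNzRingType) (r : nat) (y : 'I_r -> R).

Definition seq_span : {pred R} :=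
  [pred a | `[< exists c : 'I_r -> R, a = \sum_j c j * y j >]].

Definition proper_seq : Prop := 1 \notin seq_span.

(* idealr only covers proper ideals, hence the extra argument *)
Definition seq_ideal of proper_seq : R -> bool := seq_span.

Lemma seq_ideal_closed (yP : proper_seq) : idealr_closed (seq_ideal yP).
Proof.
split=> //; first by apply/asboolP; exists (fun=> 0); rewrite big1 // => j _;
  rewrite mul0r.
move=> a u v /asboolP[c ->] /asboolP[e ->]; apply/asboolP.
exists (fun j => a * c j + e j); rewrite mulr_sumr -big_split /=.
by apply: eq_bigr => j _; rewrite mulrDl mulrA.
Qed.

HB.instance Definition _ (yP : proper_seq) :=
  isIdealr.Build R (seq_ideal yP) (seq_ideal_closed yP).

Lemma proper_seq_morph (S : comNzRingType) (f : {rmorphism R -> S}) :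
  (forall j, f (y j) = 0) -> proper_seq.
Proof.
move=> fy; apply/asboolPn => -[c /(congr1 f)].
rewrite rmorph1 rmorph_sum big1 => [/eqP|j _]; first by rewrite oner_eq0.
by rewrite rmorphM /= fy mulr0.
Qed.

Definition quot_seq (yP : proper_seq) : comNzRingType :=
  {ideal_quot (seq_ideal yP : idealr R)}.

End SeqIdeal.

Section FreeMap.
Variables (K L : choiceType) (g : K -> L).

Definition free_map : {freeg K} -> {freeg L} := fglift (fun x => << g x >>).

Lemma free_map_is_zmod_morphism : zmod_morphism free_map.
Proof. exact: lift_is_additive. Qed.

HB.instance Definition _ :=
  GRing.isZmodMorphism.Build {freeg K} {freeg L} free_map
    free_map_is_zmod_morphism.

Lemma free_mapE x : free_map << x >> = << g x >>.
Proof. by rewrite /free_map liftU scale1r. Qed.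

End FreeMap.

Lemma free_ind (K : choiceType) (P : {freeg K} -> Prop) :
  (forall D E, P D -> P E -> P (D - E)) -> (forall x, P << x >>) -> P 0 ->
  forall D, P D.
Proof.
move=> PB P1 P0 D; rewrite -(freeg_sumE D).
have PN E : P E -> P (- E) by move=> PE; rewrite -sub0r; apply: PB.
have PD E G : P E -> P G -> P (E + G).
  by move=> PE PG; rewrite -[G]opprK; apply/PB/PN.
apply: big_ind => // x _; have Pn n : P (<< x >> *+ n).
  by elim: n => [|n IHn] //; rewrite mulrS; apply: PD.
by rewrite -[coeff x D]intz -freegU_mulz; case: (coeff x D) => n; last apply/PN;
  apply: Pn.
Qed.

(* frob is the functor F: frob M is the tensor product of the bimodule R'    *)
(* with M, that is, the free abelian group on the pairs (a, m) modulo the    *)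
(* usual relations for the right action a . r = r ^+ p * a; R acts through   *)
(* the left factor. It is only meaningful when R has characteristic p.       *)

Section Frobenius.
Variables (p : nat) (R : comNzRingType).

Inductive frob_rel (M : lmodType R) : {freeg (R * M)} -> Prop :=
| frob_rel0 : frob_rel 0
| frob_relB x z : frob_rel x -> frob_rel z -> frob_rel (x - z)
| frob_relDl a b m :
    frob_rel (<< (a + b, m) >> - (<< (a, m) >> + << (b, m) >>))
| frob_relDr a m m' :
    frob_rel (<< (a, m + m') >> - (<< (a, m) >> + << (a, m') >>))
| frob_relZ a r m :
    frob_rel (<< (r ^+ p * a, m) >> - << (a, r *: m) >>).

Definition frob_relb (M : lmodType R) : {pred {freeg (R * M)}} :=
  fun x => `[< frob_rel x >].

Lemma frob_relb_closed M : zmod_closed (@frob_relb M).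
Proof.
split; first exact/asboolP/frob_rel0.
by move=> x z /asboolP xr /asboolP zr; apply/asboolP/frob_relB.
Qed.

HB.instance Definition _ (M : lmodType R) :=
  GRing.isZmodClosed.Build {freeg (R * M)} (@frob_relb M) (frob_relb_closed M).

Definition frob (M : lmodType R) : Type :=
  Quotient.quot (@frob_relb M : zmodClosed {freeg (R * M)}).

Section FrobLmodule.
Variable M : lmodType R.

HB.instance Definition _ := GRing.Zmodule.on (frob M).

Definition frob_pi (x : {freeg (R * M)}) : frob M :=
  \pi_(Quotient.quot (@frob_relb M : zmodClosed {freeg (R * M)})) x.
Definition frob_repr (x : frob M) : {freeg (R * M)} :=
  repr (x : Quotient.quot (@frob_relb M : zmodClosed {freeg (R * M)})).
Definition frob_tensor (a : R) (m : M) : frob M := frob_pi << (a, m) >>.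

Lemma frob_reprK x : frob_pi (frob_repr x) = x.
Proof. exact: reprK. Qed.

Lemma frob_pi_is_zmod_morphism : zmod_morphism frob_pi.
Proof. by move=> x z; rewrite /frob_pi raddfB. Qed.

HB.instance Definition _ :=
  GRing.isZmodMorphism.Build {freeg (R * M)} (frob M) frob_pi
    frob_pi_is_zmod_morphism.

Lemma frob_pi_eq x z : frob_pi x = frob_pi z <-> frob_rel (x - z).
Proof.
split=> [/eqP|xz].
  by rewrite -Quotient.idealrBE => /asboolP.
by apply/eqP; rewrite -Quotient.idealrBE; apply/asboolP.
Qed.

Lemma frob_repr_pi x : frob_rel (frob_repr (frob_pi x) - x).
Proof. by apply/frob_pi_eq; rewrite frob_reprK. Qed.

Lemma frob_tensorDl a b m :
  frob_tensor (a + b) m = frob_tensor a m + frob_tensor b m.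
Proof. by rewrite -[RHS]raddfD; apply/frob_pi_eq/frob_relDl. Qed.

Lemma frob_tensorDr a m n :
  frob_tensor a (m + n) = frob_tensor a m + frob_tensor a n.
Proof. by rewrite -[RHS]raddfD; apply/frob_pi_eq/frob_relDr. Qed.

Lemma frob_tensorZ a r m : frob_tensor (r ^+ p * a) m = frob_tensor a (r *: m).
Proof. exact/frob_pi_eq/frob_relZ. Qed.

Lemma frob_ind (P : frob M -> Prop) :
  (forall x z, P x -> P z -> P (x - z)) ->
  (forall a m, P (frob_tensor a m)) -> P 0 -> forall x, P x.
Proof.
move=> PB P1 P0 x; rewrite -[x]frob_reprK; elim/free_ind: (frob_repr x).
- by move=> D E PD PE; rewrite raddfB; apply: PB.
- by case=> a m; apply: P1.
- by rewrite raddf0.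
Qed.

Definition frob_scale (a : R) (x : frob M) : frob M :=
  frob_pi (free_map (fun t => (a * t.1, t.2)) (frob_repr x)).

Lemma frob_scale_pi a x :
  frob_scale a (frob_pi x) = frob_pi (free_map (fun t => (a * t.1, t.2)) x).
Proof.
apply/frob_pi_eq; rewrite -raddfB.
elim: (frob_repr_pi x) => [|u v _ IHu _ IHv|b c m|b m n|b r m].
- by rewrite raddf0; apply: frob_rel0.
- by rewrite raddfB; apply: frob_relB.
- by rewrite raddfB raddfD /= !free_mapE /= mulrDr; apply: frob_relDl.
- by rewrite raddfB raddfD /= !free_mapE /=; apply: frob_relDr.
- by rewrite raddfB /= !free_mapE /= mulrCA; apply: frob_relZ.
Qed.

Lemma frob_scaleB a : zmod_morphism (frob_scale a).
Proof.
move=> x z; rewrite -[x]frob_reprK -[z]frob_reprK -raddfB !frob_scale_pi.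
by rewrite !raddfB.
Qed.

Lemma frob_scale0 a : frob_scale a 0 = 0.
Proof. by have := frob_scaleB a 0 0; rewrite !subrr. Qed.

Lemma frob_scale_tensor a b m :
  frob_scale a (frob_tensor b m) = frob_tensor (a * b) m.
Proof. by rewrite frob_scale_pi free_mapE. Qed.

Fact frob_scaleA a b v :
  frob_scale a (frob_scale b v) = frob_scale (a * b) v.
Proof.
elim/frob_ind: v => [x z|c m|]; last by rewrite !frob_scale0.
  by rewrite !frob_scaleB => -> ->.
by rewrite !frob_scale_tensor mulrA.
Qed.

Fact frob_scale1 : left_id 1 frob_scale.
Proof.
elim/frob_ind => [x z|c m|]; last by rewrite !frob_scale0.
  by rewrite !frob_scaleB => -> ->.
by rewrite !frob_scale_tensor mul1r.
Qed.

Fact frob_scaleDr : right_distributive frob_scale +%R.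
Proof.
by move=> a x z; rewrite -[z]opprK frob_scaleB -[- z]sub0r !frob_scaleB
  frob_scale0 !sub0r !opprK.
Qed.

Fact frob_scaleDl v : {morph frob_scale^~ v : a b / a + b}.
Proof.
move=> a b; elim/frob_ind: v => [x z|c m|]; last by rewrite !frob_scale0 addr0.
  by rewrite !frob_scaleB => -> ->; rewrite opprD addrACA.
by rewrite !frob_scale_tensor mulrDl frob_tensorDl.
Qed.

HB.instance Definition _ := GRing.Zmodule_isLmodule.Build R (frob M)
  frob_scaleA frob_scale1 frob_scaleDr frob_scaleDl.

End FrobLmodule.

Section FrobMap.
Variables (M N : lmodType R) (f : {linear M -> N}).

Definition frob_map (x : frob M) : frob N :=
  frob_pi (free_map (fun t => (t.1, f t.2)) (frob_repr x)).

Lemma frob_map_pi x :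
  frob_map (frob_pi x) = frob_pi (free_map (fun t => (t.1, f t.2)) x).
Proof.
apply/frob_pi_eq; rewrite -raddfB.
elim: (frob_repr_pi x) => [|u v _ IHu _ IHv|b c m|b m n|b r m].
- by rewrite raddf0; apply: frob_rel0.
- by rewrite raddfB; apply: frob_relB.
- by rewrite raddfB raddfD /= !free_mapE /=; apply: frob_relDl.
- by rewrite raddfB raddfD /= !free_mapE /= raddfD; apply: frob_relDr.
- by rewrite raddfB /= !free_mapE /= linearZ; apply: frob_relZ.
Qed.

Lemma frob_map_tensor a m : frob_map (frob_tensor a m) = frob_tensor a (f m).
Proof. by rewrite frob_map_pi free_mapE. Qed.

Fact frob_map_is_zmod_morphism : zmod_morphism frob_map.
Proof.
move=> x z; rewrite -[x]frob_reprK -[z]frob_reprK -raddfB !frob_map_pi.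
by rewrite !raddfB.
Qed.

HB.instance Definition _ :=
  GRing.isZmodMorphism.Build (frob M) (frob N) frob_map
    frob_map_is_zmod_morphism.

Fact frob_map_is_scalable : scalable frob_map.
Proof.
move=> a; elim/frob_ind => [x z|c m|].
- by rewrite scalerBr !raddfB /= => -> ->.
- rewrite -[a *: frob_tensor c m]/(frob_scale _ _) frob_scale_tensor.
  by rewrite !frob_map_tensor -[RHS]/(frob_scale _ _) frob_scale_tensor.
- by rewrite scaler0 raddf0 scaler0.
Qed.

HB.instance Definition _ :=
  GRing.isScalable.Build R (frob M) (frob N) *:%R frob_map
    frob_map_is_scalable.

End FrobMap.

Fixpoint frob_iter (M : lmodType R) (j : nat) : lmodType R :=
  if j is j'.+1 then frob (frob_iter M j') else M.

Fixpoint frob_iter_map (M : lmodType R) (b : {linear M -> frob M}) (j : nat) :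
    {linear frob_iter M j -> frob_iter M j.+1} :=
  if j is j'.+1 then frob_map (frob_iter_map b j') else b.

Definition fin_gen (M : lmodType R) : Prop :=
  exists (n : nat) (g : 'I_n -> M),
    forall x, exists c : 'I_n -> R, x = \sum_i c i *: g i.

Definition is_direct_limit (X : nat -> lmodType R)
    (t : forall j, {linear X j -> X j.+1})
    (L : lmodType R) (u : forall j, {linear X j -> L}) : Prop :=
  (forall j x, u j.+1 (t j x) = u j x) /\
  forall (N : lmodType R) (v : forall j, {linear X j -> N}),
    (forall j x, v j.+1 (t j x) = v j x) ->
    exists w : {linear L -> N}, (forall j x, w (u j x) = v j x) /\
      forall w' : {linear L -> N}, (forall j x, w' (u j x) = v j x) -> w' =1 w.

Record frob_module := FrobModule {
  frob_module_sort :> lmodType R;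
  frob_module_map : {linear frob_module_sort -> frob frob_module_sort};
  frob_module_iso : bijective frob_module_map
}.

(* The last condition says that the structure map is induced by the          *)
(* morphism of direct systems with components F^j(b).                        *)
Definition frob_module_finite (M : frob_module) : Prop :=
  exists (N : lmodType R) (b : {linear N -> frob N})
         (u : forall j, {linear frob_iter N j -> M}),
  [/\ fin_gen N, is_direct_limit (frob_iter_map b) u &
      forall j (x : frob_iter N j),
        frob_module_map M (u j x) = frob_map (u j) (frob_iter_map b j x)].

Definition frob_finite (M : lmodType R) : Prop :=
  exists (theta : {linear M -> frob M}) (thetaP : bijective theta),
    frob_module_finite (FrobModule thetaP).

End Frobenius.

(* The Koszul complex of y_0, ..., y_(r-1) on M. A function x on the subsets *)
(* of 'I_r stands for the element sum_S e_S (x) x S of the exterior algebra  *)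
(* of R^r tensored with M, the product e_S being taken in increasing order;  *)
(* e_S has degree #|S|, and the differential sends e_S (x) m to the sum over *)
(* j in S of (-1)^#{l in S | l < j} e_(S \ j) (x) y_j m.                     *)

Section Koszul.
Variables (R : comNzRingType) (r : nat) (y : 'I_r -> R) (M : lmodType R).

Definition koszul : lmodType R := {ffun {set 'I_r} -> M}.
Implicit Types (x z : koszul) (S T : {set 'I_r}).

Definition koszul_sign T (j : 'I_r) : R :=
  (-1) ^+ #|[set l in T | (l < j)%N]|.

Definition koszul_diff x : koszul :=
  [ffun T : {set 'I_r} =>
    \sum_(j | j \notin T) koszul_sign T j *: (y j *: x (j |: T))].

Definition koszul_deg (i : nat) x : bool :=
  [forall S : {set 'I_r}, (#|S| != i) ==> (x S == 0)].

Definition koszul_cycles i : {pred koszul} :=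
  [pred x | koszul_deg i x && (koszul_diff x == 0)].

Definition koszul_boundaries i : {pred koszul} :=
  [pred x | `[< exists z, koszul_deg i.+1 z /\ x = koszul_diff z >]].

Lemma koszul_diff_is_linear : linear koszul_diff.
Proof.
move=> a x z; apply/ffunP => T; rewrite !ffunE scaler_sumr -big_split /=.
apply: eq_bigr => j _; rewrite !ffunE !scalerDr.
by congr (_ + _); rewrite !scalerA; congr (_ *: _); rewrite mulrC mulrA.
Qed.

HB.instance Definition _ :=
  GRing.isLinear.Build R koszul koszul *:%R koszul_diff koszul_diff_is_linear.

Lemma koszul_degP i x :
  reflect (forall S, #|S| != i -> x S = 0) (koszul_deg i x).
Proof.
apply: (iffP forallP) => h S; first by move=> Si; apply/eqP/(implyP (h S)).
by apply/implyP => Si; rewrite h.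
Qed.

Lemma koszul_deg0 i : koszul_deg i 0.
Proof. by apply/koszul_degP => S _; rewrite ffunE. Qed.

Lemma koszul_degZD i a x z :
  koszul_deg i x -> koszul_deg i z -> koszul_deg i (a *: x + z).
Proof.
move=> /koszul_degP xi /koszul_degP zi; apply/koszul_degP => S Si.
by rewrite !ffunE xi // zi // scaler0 addr0.
Qed.

Fact koszul_cycles_closed i : subsemimod_closed (koszul_cycles i).
Proof.
apply: GRing.submod_closed_semi; split=> [|a x z].
  by rewrite inE koszul_deg0 raddf0 eqxx.
rewrite !inE => /andP[xi /eqP dx] /andP[zi /eqP dz].
by rewrite koszul_degZD //= linearP /= dx dz scaler0 addr0.
Qed.

HB.instance Definition _ i :=
  GRing.isSubmodClosed.Build R koszul (koszul_cycles i)
    (koszul_cycles_closed i).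

Record koszul_cycle (i : nat) := KoszulCycle {
  koszul_cycle_val : koszul;
  koszul_cycleP : koszul_cycle_val \in koszul_cycles i
}.

HB.instance Definition _ i := [isSub for @koszul_cycle_val i].
HB.instance Definition _ i := [Choice of koszul_cycle i by <:].
HB.instance Definition _ i := [SubChoice_isSubLmodule of koszul_cycle i by <:].

Definition koszul_bounding i : {pred koszul_cycle i} :=
  [pred c | koszul_cycle_val c \in koszul_boundaries i].

Lemma koszul_bounding_submod i : submod_closed (@koszul_bounding i).
Proof.
split=> [|a c e].
  apply/asboolP; exists 0; split; first exact: koszul_deg0.
  by rewrite !raddf0.
move=> /asboolP[z [zi cz]] /asboolP[w [wi ew]]; apply/asboolP.
exists (a *: z + w); split; first exact: koszul_degZD.
by rewrite !linearP /= cz ew.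
Qed.

Fact koszul_bounding_closed i : zmod_closed (@koszul_bounding i).
Proof. exact: (GRing.submod_closedB (koszul_bounding_submod i)). Qed.

HB.instance Definition _ i :=
  GRing.isZmodClosed.Build (koszul_cycle i) (@koszul_bounding i)
    (koszul_bounding_closed i).

Lemma koszul_sign2 T j : koszul_sign T j * koszul_sign T j = 1.
Proof. by rewrite /koszul_sign -expr2 -exprM mulnC exprM sqrrN expr1n expr1n. Qed.

Lemma koszul_signU1 T j l : j \notin T ->
  koszul_sign (j |: T) l = (-1) ^+ (j < l)%N * koszul_sign T l.
Proof.
move=> jT; rewrite /koszul_sign -exprD; congr (_ ^+ _).
case: (boolP (j < l)%N) => jl /=.
  rewrite (cardsD1 j) !inE eqxx jl /=; congr (_ + #|pred_of_set _|)%N.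
  apply/setP => t; rewrite !inE.
  by case: eqP => [->|_] //=; rewrite (negPf jT).
rewrite add0n; congr #|pred_of_set _|; apply/setP => t; rewrite !inE.
by case: eqP => [->|_] //=; rewrite (negPf jl) andbF.
Qed.

(* left multiplication by e_j *)
Definition koszul_wedge (j : 'I_r) x : koszul :=
  [ffun S : {set 'I_r} =>
    if j \in S then koszul_sign (S :\ j) j *: x (S :\ j) else 0].

Lemma koszul_wedge_deg i j x :
  koszul_deg i x -> koszul_deg i.+1 (koszul_wedge j x).
Proof.
move=> /koszul_degP xi; apply/koszul_degP => S; rewrite ffunE.
by case: ifP => // jS; rewrite (cardsD1 j) jS eqSS => /xi->; rewrite scaler0.
Qed.

Lemma koszul_homotopy j x :
  koszul_diff (koszul_wedge j x) + koszul_wedge j (koszul_diff x) = y j *: x.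
Proof.
apply/ffunP => T; rewrite !ffunE; case: (boolP (j \in T)) => jT; last first.
  rewrite addr0 (bigD1 j) //= [X in _ + X]big1 ?addr0 => [|l /andP[lT lj]].
    rewrite ffunE setU11 setU1K // !scalerA mulrAC koszul_sign2.
    by rewrite mul1r.
  by rewrite ffunE !inE (negPf jT) orbF eq_sym (negPf lj) !scaler0.
have [T' jT' eT] : exists2 T' : {set 'I_r}, j \notin T' & T = j |: T'.
  by exists (T :\ j); rewrite ?setD11 // setD1K.
rewrite {T jT}eT setU1K // scaler_sumr.
rewrite [X in _ + X](bigD1 j) //= addrCA !scalerA koszul_sign2
  mul1r [X in _ + X = _](_ : _ = 0) ?addr0 //.
rewrite (eq_bigl (fun l => (l \notin T') && (l != j))); last first.
  by move=> l; rewrite !inE negb_or andbC.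
rewrite -big_split /= big1 // => l /andP[lT lj].
have -> : (l |: (j |: T')) = j |: (l |: T') by rewrite setUCA.
have jlT : j \notin l |: T' by rewrite !inE negb_or eq_sym lj.
rewrite ffunE setU11 setU1K // !scalerA -scalerDl !koszul_signU1 //.
rewrite [X in X *: _](_ : _ = 0) ?scale0r //.
have [jl|lj'|/val_inj jl] := ltngtP j l; last by rewrite jl eqxx in lj.
  by rewrite expr0 expr1; ring.
by rewrite expr0 expr1; ring.
Qed.

Lemma koszul_bounding_scale i j (c : koszul_cycle i) :
  y j *: c \in @koszul_bounding i.
Proof.
have /andP[ci /eqP dc] := koszul_cycleP c; apply/asboolP.
exists (koszul_wedge j (koszul_cycle_val c)); split.
  exact: koszul_wedge_deg.
rewrite -[LHS]/(val (y j *: c)) linearZ /= -koszul_homotopy dc [X in _ + X](_ : _ = 0) ?addr0 //.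
by apply/ffunP => S; rewrite !ffunE scaler0 if_same.
Qed.

Lemma koszul_bounding_span i a (c : koszul_cycle i) :
  a \in seq_span y -> a *: c \in @koszul_bounding i.
Proof.
move=> /asboolP[e ->]; rewrite scaler_suml; 
  apply: (big_ind (fun u => u \in @koszul_bounding i)) => [|u v|j _].
- exact: (koszul_bounding_submod i).1.
- by move=> uB vB; rewrite -[u]scale1r (koszul_bounding_submod i).2.
- by rewrite -scalerA -[_ *: _]addr0 (koszul_bounding_submod i).2
    ?koszul_bounding_scale // (koszul_bounding_submod i).1.
Qed.

End Koszul.

(* H_i(y; M), the i-cycles modulo the i-boundaries. It is annihilated by the *)
(* y_j, and is considered as a module over R / (y_0, ..., y_(r-1)): the      *)
(* class of a in R acts as a.                                                *)

Definition koszul_homology (R : comNzRingType) (r : nat) (y : 'I_r -> R)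
    (yP : proper_seq y) (M : lmodType R) (i : nat) : Type :=
  Quotient.quot (@koszul_bounding R r y M i : zmodClosed (koszul_cycle y M i)).

Section KoszulHomology.
Variables (R : comNzRingType) (r : nat) (y : 'I_r -> R) (yP : proper_seq y).
Variables (M : lmodType R) (i : nat).

Local Notation cycle := (koszul_cycle y M i).
Local Notation B := (@koszul_bounding R r y M i : zmodClosed cycle).

Local Notation H := (koszul_homology yP M i).

HB.instance Definition _ := GRing.Zmodule.on H.

Definition koszul_class (c : cycle) : H := \pi_(Quotient.quot B) c.
Definition koszul_repr (h : H) : cycle := repr (h : Quotient.quot B).

Lemma koszul_reprK h : koszul_class (koszul_repr h) = h.
Proof. exact: reprK. Qed.

Lemma koszul_class_is_zmod_morphism : zmod_morphism koszul_class.
Proof. by move=> x z; rewrite /koszul_class raddfB. Qed.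

HB.instance Definition _ :=
  GRing.isZmodMorphism.Build cycle H koszul_class koszul_class_is_zmod_morphism.

Lemma koszul_class_eq c e :
  koszul_class c = koszul_class e <-> c - e \in @koszul_bounding R r y M i.
Proof.
split=> [/eqP|ce]; first by rewrite -Quotient.idealrBE.
by apply/eqP; rewrite -Quotient.idealrBE.
Qed.

Definition koszul_homology_scale (a : quot_seq yP) (h : H) : H :=
  koszul_class (repr a *: koszul_repr h).

Lemma koszul_homology_scaleE (a : R) (c : cycle) :
  koszul_homology_scale (\pi_(quot_seq yP) a) (koszul_class c) =
  koszul_class (a *: c).
Proof.
rewrite /koszul_homology_scale; set a' := repr _; set c' := koszul_repr _.
have aa : a' - a \in seq_span y.
  have : a' - a \in seq_ideal yP.
    by rewrite (Quotient.idealrBE (seq_ideal yP : idealr R)) reprK.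
  by [].
have cc : c' - c \in @koszul_bounding R r y M i.
  by apply/koszul_class_eq; rewrite koszul_reprK.
apply/koszul_class_eq.
have -> : a' *: c' - a *: c = a' *: (c' - c) + (a' - a) *: c.
  by rewrite scalerBr scalerBl addrA subrK.
by rewrite (koszul_bounding_submod y M i).2 // koszul_bounding_span.
Qed.

Fact koszul_homology_scaleA a b h :
  koszul_homology_scale a (koszul_homology_scale b h) =
  koszul_homology_scale (a * b) h.
Proof.
rewrite -[a]reprK -[b]reprK -[h]koszul_reprK -rmorphM.
rewrite [in RHS]koszul_homology_scaleE.
rewrite (koszul_homology_scaleE (repr b) (koszul_repr h)).
by rewrite koszul_homology_scaleE scalerA.
Qed.

Fact koszul_homology_scale1 : left_id 1 koszul_homology_scale.
Proof.
move=> h; rewrite -[h]koszul_reprK -(rmorph1 \pi_(quot_seq yP)).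
by rewrite koszul_homology_scaleE scale1r.
Qed.

Fact koszul_homology_scaleDr : right_distributive koszul_homology_scale +%R.
Proof.
move=> a g h; rewrite -[a]reprK -[g]koszul_reprK -[h]koszul_reprK -raddfD.
by rewrite !koszul_homology_scaleE scalerDr raddfD.
Qed.

Fact koszul_homology_scaleDl h :
  {morph koszul_homology_scale^~ h : a b / a + b}.
Proof.
move=> a b; rewrite -[a]reprK -[b]reprK -[h]koszul_reprK -raddfD.
by rewrite !koszul_homology_scaleE scalerDl raddfD.
Qed.

HB.instance Definition _ := GRing.Zmodule_isLmodule.Build (quot_seq yP) H
  koszul_homology_scaleA koszul_homology_scale1 koszul_homology_scaleDr
  koszul_homology_scaleDl.

End KoszulHomology.

Inductive base_kind := Polynomials | PowerSeries | Mixed of nat.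

Section BaseRing.
Variables (k : fieldType) (d : nat).

Definition base_ring (b : base_kind) : comNzRingType :=
  match b with
  | Polynomials => {mpoly k[d]}
  | PowerSeries => mseries d k
  | Mixed m => {mpoly (mseries d k)[m]}
  end.

Definition base_var (b : base_kind) : 'I_d -> base_ring b :=
  match b with
  | Polynomials => fun i => 'X_i
  | PowerSeries => fun i => msvar k i
  | Mixed m => fun i => (msvar k i)%:MP
  end.

Definition base_seq (b : base_kind) (r : nat) (rd : (r <= d)%N) :
    'I_r -> base_ring b :=
  fun j => base_var b (widen_ord rd j).

Lemma base_seq_proper b r (rd : (r <= d)%N) : proper_seq (base_seq b rd).
Proof.
have U0 (i : 'I_d) : (0%MM == U_(i)%MM :> 'X_{1..d}) = false.
  by apply/eqP => /(congr1 (@mdeg _)); rewrite mdeg0 mdeg1.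
rewrite /base_seq; case: b => [||m] /=.
- apply: (@proper_seq_morph _ _ _ _ (mcoeff 0%MM)) => j /=.
  by rewrite mcoeffX eq_sym U0.
- apply: (@proper_seq_morph _ _ _ _ (@msconstterm d k)) => j /=.
  by rewrite /msconstterm /= U0.
- apply: (@proper_seq_morph _ _ _ _ (@msconstterm d k \o mcoeff 0%MM)) => j /=.
  by rewrite mcoeffC eqxx mulr1 /msconstterm /= U0.
Qed.

End BaseRing.

(* Main.v *)
Require Import Defs.
From HB Require Import structures.
From mathcomp Require Import classical_sets cardinality.
From mathcomp Require Import all_boot all_order all_algebra.
From mathcomp Require Import ring_quotient freeg mpoly.
From mathcomp Require Import boolp ring.

Set Implicit Arguments.
Unset Strict Implicit.
Unset Printing Implicit Defensive.

Import Order.TTheory GRing.Theory.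
Local Open Scope ring_scope.
Local Open Scope quotient_scope.

(** Write F for the Frobenius functor, B for R / (y_1, ..., y_r), and H for one
of the functors H_i(y; -) from R-modules to B-modules. The theorem is formal
once three facts are known. First, R is Noetherian, so that H preserves finite
generation (koszul_homology_fin_gen). Second, H commutes with direct limits of
sequences (homology_limit_surj, homology_limit_zero). Third, there is a
natural isomorphism between F_B(H(M)) and H(F_R(M)) (frob_homology_bij,
frob_homology_natural). If M is the limit of N -> F(N) -> F^2(N) -> ..., then
H(M) is the limit of H(N) -> H(F(N)) -> ..., which the isomorphism identifies
with H(N) -> F_B(H(N)) -> F_B^2(H(N)) -> ...; this is koszul_frob_finite.

The isomorphism sends the tensor of b with the class of a cycle c to the class
of the cycle with components b y_T^(p-1) (x) c_T, where y_T is the product of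
the y_j for j in T. Its bijectivity rests on two properties of R.

The first one (frobenius_coordinates) says that multiplication by y_j behaves
as on a free module with basis 1, y_j, ..., y_j^(p-1) over a subring that
contains y_j^p and the p-th powers. A homotopy that divides by y_j contracts
K(y; F(M)) onto the elements with components y_T^(p-1) z_T, where z is a chain
of the complex K(y^p; F(M)) (koszul_retract).

The second one (cartier_trace) is a strong form of the flatness of Frobenius:
every x in R is a sum of terms r_s C_s(x)^p, where the C_s are additive maps
with C_s(a^p x) = a C_s(x). Such a map C induces a map C : F(M) -> M, and every
z in F(M) is the sum of the r_s (x) C_s(z) for suitable r_s and C_s. As C turns
the differential of K(y^p; F(M)) into that of K(y; M), it takes the cycles and
boundaries of the former complex to cycles and boundaries of the latter.

A field has Cartier maps that take a prescribed nonzero element to 1, by Zorn's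
lemma. The property passes to polynomial rings coefficientwise. For k[[Y]],
which need not be finite over its subring of p-th powers, let I be the ideal
of all C(x); the elements z such that all C(z) lie in I form an ideal that
contains x, and a comparison of lowest monomials shows that p-th powers of
finitely many elements of I form a standard basis of that ideal. Division with
respect to such a basis converges (division), and this also shows that k[[Y]]
is Noetherian, by Dickson's lemma for families of ideals
(dickson_noetherian). *)

(** * The Frobenius functor and Cartier maps *)

Section FrobLift.
Variables (p : nat) (R : comNzRingType) (M : lmodType R).

Lemma frob_scaleE (a b : R) (m : M) :
  a *: frob_tensor p b m = frob_tensor p (a * b) m.
Proof. exact: frob_scale_tensor. Qed.

(** The universal property of the tensor product. The target N is only a group,
so that it serves for maps with different kinds of semilinearity. *)
Lemma frob_lift (N : zmodType) (g : R -> M -> N) :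
  (forall a b m, g (a + b) m = g a m + g b m) ->
  (forall a m n, g a (m + n) = g a m + g a n) ->
  (forall a r m, g (r ^+ p * a) m = g a (r *: m)) ->
  {f : {additive frob p M -> N} | forall a m, f (frob_tensor p a m) = g a m}.
Proof.
move=> gDl gDr gZ.
pose h : {freeg (R * M)} -> zmodule N := fglift (fun t => g t.1 t.2 : zmodule N).
have hB x z : h (x - z) = h x - h z by apply: lift_is_additive.
have h1 t : h << t >> = g t.1 t.2 by rewrite /h liftU scale1r.
have h0 : h 0 = 0 by rewrite -(subrr (0 : {freeg (R * M)})) hB subrr.
have hD x z : h (x + z) = h x + h z.
  by rewrite -{1}[z]opprK hB -[- z]sub0r hB h0 sub0r opprK.
have hrel x : frob_rel p x -> h x = 0.
  elim=> [|u v _ hu _ hv|a b m|a m n|a r m] //.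
  - by rewrite hB hu hv subrr.
  - by rewrite hB hD !h1 gDl subrr.
  - by rewrite hB hD !h1 gDr subrr.
  - by rewrite hB !h1 gZ subrr.
pose f (x : frob p M) : N := h (frob_repr x).
have fpi x : f (frob_pi p x) = h x.
  by apply/eqP; rewrite -subr_eq0 -hB hrel //; apply: frob_repr_pi.
have fB : zmod_morphism f.
  by move=> x z; rewrite -[x]frob_reprK -[z]frob_reprK -raddfB !fpi hB.
pose fA := GRing.isZmodMorphism.Build (frob p M) N f fB.
pose F : {additive frob p M -> N} := HB.pack f fA.
by exists F => a m; rewrite [LHS]fpi h1.
Qed.

Lemma frob_ext (N : zmodType) (f g : {additive frob p M -> N}) :
  (forall a m, f (frob_tensor p a m) = g (frob_tensor p a m)) -> f =1 g.
Proof.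
move=> fg; elim/frob_ind => [x z fx fz|a m|]; last by rewrite !raddf0.
  by rewrite !raddfB fx fz.
exact: fg.
Qed.

Lemma frob_sum (x : frob p M) :
  exists s : seq (R * M), x = \sum_(t <- s) frob_tensor p t.1 t.2.
Proof.
elim/frob_ind: x => [x z [s ->] [s' ->]|a m|]; last by exists [::]; rewrite big_nil.
  exists (s ++ [seq (- t.1, t.2) | t <- s']); rewrite big_cat big_map /=.
  by rewrite -sumrN; congr (_ + _); apply: eq_bigr => t _;
    rewrite -[- t.1]mulN1r -frob_scaleE scaleN1r.
by exists [:: (a, m)]; rewrite big_seq1.
Qed.

Lemma frob_tensor0 a : frob_tensor p a (0 : M) = 0.
Proof. by apply: (addrI (frob_tensor p a 0)); rewrite -frob_tensorDr !addr0. Qed.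

Lemma frob_tensor0l (m : M) : frob_tensor p (0 : R) m = 0.
Proof. by rewrite -(mul0r 0) -frob_scaleE scale0r. Qed.

Lemma frob_tensor_sumr a (I : Type) (s : seq I) (m : I -> M) :
  frob_tensor p a (\sum_(t <- s) m t) = \sum_(t <- s) frob_tensor p a (m t).
Proof.
elim: s => [|t s IHs]; first by rewrite !big_nil frob_tensor0.
by rewrite !big_cons frob_tensorDr IHs.
Qed.

Lemma frob_tensor_suml (m : M) (I : Type) (s : seq I) (a : I -> R) :
  frob_tensor p (\sum_(t <- s) a t) m = \sum_(t <- s) frob_tensor p (a t) m.
Proof.
elim: s => [|t s IHs]; first by rewrite !big_nil frob_tensor0l.
by rewrite !big_cons frob_tensorDl IHs.
Qed.

End FrobLift.

Section FrobFunctor.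
Variables (p : nat) (R : comNzRingType) (M N L : lmodType R).

Lemma frob_map_eq (f g : {linear M -> N}) :
  f =1 g -> @frob_map p R M N f =1 @frob_map p R M N g.
Proof. by move=> fg; apply: frob_ext => a m; rewrite /= !frob_map_tensor fg. Qed.

Lemma frob_map_comp (f : {linear M -> N}) (g : {linear N -> L}) x :
  @frob_map p R M L (g \o f) x = frob_map g (frob_map f x).
Proof.
have -> : frob_map g (frob_map f x) =
  (@frob_map p R N L g \o @frob_map p R M N f) x by [].
by move: x; apply: frob_ext => a m; rewrite /= !frob_map_tensor.
Qed.

Lemma frob_map_id (f : {linear M -> M}) : f =1 id -> @frob_map p R M M f =1 id.
Proof.
move=> fid; apply: (@frob_ext _ _ _ _ (frob_map f) idfun) => a m /=.
by rewrite frob_map_tensor fid.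
Qed.

End FrobFunctor.

Lemma linear_bij_inv (R : comNzRingType) (M N : lmodType R) (f : {linear M -> N}) :
  bijective f -> {g : {linear N -> M} | cancel f g /\ cancel g f}.
Proof.
move=> fbij; have /cid[g [fK gK]] : exists g, cancel f g /\ cancel g f.
  by case: fbij => g fK gK; exists g.
have gL : linear g.
  by move=> a x y; apply: (can_inj fK); rewrite linearP !gK.
pose gA := GRing.isLinear.Build R N M *:%R g gL.
pose G : {linear N -> M} := HB.pack g gA.
by exists G.
Qed.

(** These maps are the R-linear maps to R from R with a acting as
multiplication by a^p. *)
Record cartier (p : nat) (R : comNzRingType) := Cartier {
  cartier_fun :> {additive R -> R};
  cartierP : forall a x, cartier_fun (a ^+ p * x) = a * cartier_fun x
}.

Section CartierFrob.
Variables (p : nat) (R : comNzRingType).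
Hypothesis p_gt0 : (0 < p)%N.
Implicit Type C : cartier p R.

Lemma cartier_of (f : R -> R) : zmod_morphism f ->
  (forall a x, f (a ^+ p * x) = a * f x) -> {C : cartier p R | C =1 f}.
Proof.
move=> fB fP; pose fA := GRing.isZmodMorphism.Build R R f fB.
pose F : {additive R -> R} := HB.pack f fA.
by exists (@Cartier p R F fP).
Qed.

Definition cartier_frob_sig C (M : lmodType R) :
  {f : {additive frob p M -> M} | forall a m, f (frob_tensor p a m) = C a *: m}.
Proof.
apply: frob_lift => [a b m|a m n|a r m]; first by rewrite raddfD scalerDl.
  by rewrite scalerDr.
by rewrite cartierP mulrC scalerA.
Qed.

Definition cartier_frob C (M : lmodType R) := sval (cartier_frob_sig C M).

(** This is the map induced by C on tensor products: it goes from F(M) to the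
tensor product of R and M over R, which is M. *)
Lemma cartier_frob_tensor C (M : lmodType R) a m :
  @cartier_frob C M (frob_tensor p a m) = C a *: m.
Proof. exact: (svalP (cartier_frob_sig C M)). Qed.

Lemma cartier_frobZ C (M : lmodType R) a x :
  @cartier_frob C M (a ^+ p *: x) = a *: cartier_frob C M x.
Proof.
elim/frob_ind: x => [x z hx hz|b m|].
- by rewrite scalerBr !raddfB /= hx hz.
- by rewrite frob_scaleE !cartier_frob_tensor cartierP scalerA.
- by rewrite scaler0 raddf0 scaler0.
Qed.

Definition cartier_trace_sum (s : seq (R * cartier p R)) (x : R) : R :=
  \sum_(t <- s) t.1 * t.2 x ^+ p.

(** When R is free over its p-th powers with a finite basis r_s, the coordinates
are p-th powers of values of Cartier maps C_s. In general the pairs (r_s, C_s)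
have to depend on x; R, viewed as a module through Frobenius, is then a trace
module in the sense of Ohm and Rush. *)
Definition cartier_trace : Prop :=
  forall x : R, exists s, x = cartier_trace_sum s x.

Hypothesis trR : cartier_trace.

(** If s works for xs, take pairs (r, C) that work for x - cartier_trace_sum s x
and replace each C by z |-> C (z - cartier_trace_sum s z). Although the trace
sum is not additive in z, this is again a Cartier map, as C takes r_s C_s(z)^p
to C(r_s) C_s(z). It vanishes on xs, so adding the new pairs to s spoils
nothing there. *)
Lemma cartier_trace_seq (xs : seq R) :
  exists s, forall x, x \in xs -> x = cartier_trace_sum s x.
Proof.
elim: xs => [|x xs [s sP]]; first by exists [::].
have [s' s'P] := trR (x - cartier_trace_sum s x).
have corr (C : cartier p R) : {D : cartier p R |
    forall z, D z = C (z - cartier_trace_sum s z)}.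
  pose f z := C z - \sum_(t <- s) C t.1 * t.2 z.
  have [|a z|D Df] := @cartier_of f.
  - move=> a b; rewrite /f.
    have -> : \sum_(t <- s) C t.1 * t.2 (a - b) =
        \sum_(t <- s) C t.1 * t.2 a - \sum_(t <- s) C t.1 * t.2 b.
      by rewrite -sumrB; apply: eq_bigr => t _; rewrite raddfB mulrBr.
    by rewrite raddfB; ring.
  - rewrite /f cartierP mulrBr mulr_sumr; congr (_ - _); apply: eq_bigr => t _.
    by rewrite cartierP mulrCA.
  exists D => z; rewrite Df /f [RHS]raddfB; congr (_ - _).
  rewrite [RHS]raddf_sum; by apply: eq_bigr => t _; rewrite /= [t.1 * _]mulrC
    cartierP mulrC.
exists (s ++ [seq (t.1, sval (corr t.2)) | t <- s']) => z.
move=> zxs; rewrite /cartier_trace_sum big_cat big_map /= -/(cartier_trace_sum s z).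
under [X in _ = _ + X]eq_bigr => t _ do rewrite (svalP (corr t.2)).
rewrite -/(cartier_trace_sum s' _); move: zxs; rewrite inE.
case/orP=> [/eqP->|/sP e]; first by rewrite -s'P addrC subrK.
rewrite -e subrr /cartier_trace_sum [X in _ + X]big1 ?addr0 // => t _.
by rewrite raddf0 expr0n gtn_eqF // mulr0.
Qed.

(** This replaces the flatness of Frobenius. An element of F(M) that satisfies a
linear equation with coefficients a^p has all its images under Cartier maps
satisfy the equation with coefficients a, by cartier_frobZ, and here it is
recovered from these images. *)
Lemma cartier_trace_frob (M : lmodType R) (I : finType) (z : I -> frob p M) :
  exists s : seq (R * cartier p R), forall i,
    z i = \sum_(t <- s) frob_tensor p t.1 (cartier_frob t.2 M (z i)).
Proof.
have [w wP] : exists w : I -> seq (R * M),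
    forall i, z i = \sum_(t <- w i) frob_tensor p t.1 t.2.
  by exists (fun i => sval (cid (frob_sum (z i)))) => i; exact: (svalP (cid (frob_sum
    (z i)))).
have [s sP] := cartier_trace_seq (flatten [seq [seq t.1 | t <- w i] | i : I]).
exists s => i; rewrite {1}(wP i).
under [RHS]eq_bigr => t _.
  rewrite (wP i) raddf_sum frob_tensor_sumr.
  under eq_bigr => u _ do rewrite /= cartier_frob_tensor -frob_tensorZ.
  over.
rewrite exchange_big /=; apply: eq_big_seq => t tw.
rewrite -frob_tensor_suml {1}[t.1]sP.
  by congr frob_tensor; apply: eq_bigr => u _; rewrite mulrC.
apply/flatten_mapP; exists i; first by rewrite mem_enum.
exact: map_f.
Qed.
End CartierFrob.

Section FrobOp.
Variables (p : nat) (R : comNzRingType).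
Variable k : {additive R -> R}.
Hypothesis kP : forall a x, k (a ^+ p * x) = a ^+ p * k x.

Lemma frob_op_sig (M : lmodType R) :
  {f : {additive frob p M -> frob p M} |
    forall a m, f (frob_tensor p a m) = frob_tensor p (k a) m}.
Proof.
apply: frob_lift => [a b m|a m n|a r m]; first by rewrite raddfD frob_tensorDl.
  by rewrite frob_tensorDr.
by rewrite kP frob_tensorZ.
Qed.
End FrobOp.

(** * A homotopy on the Koszul complex *)

Section KoszulMap.
Variables (R : comNzRingType) (r : nat) (V W : lmodType R).
Implicit Types (y : 'I_r -> R) (T : {set 'I_r}).

Lemma raddf_koszul_sign (f : {additive V -> W}) T (j : 'I_r) v :
  f (koszul_sign R T j *: v) = koszul_sign R T j *: f v.
Proof. by rewrite /koszul_sign -signr_odd !scaler_sign; case: odd; rewrite ?raddfN. Qed.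

Lemma koszul_signK T (j : 'I_r) (v : V) :
  koszul_sign R T j *: (koszul_sign R T j *: v) = v.
Proof. by rewrite scalerA koszul_sign2 scale1r. Qed.

Definition koszul_map (f : V -> W) (x : koszul r V) : koszul r W :=
  [ffun T => f (x T)].

(** The sequences y and y' differ when f is semilinear: a Cartier map goes from
y^p to y, and v |-> b (x) v goes from y to y^p. *)
Lemma koszul_diff_map y y' (f : {additive V -> W}) x :
  (forall j v, f (y j *: v) = y' j *: f v) ->
  koszul_diff y' (koszul_map f x) = koszul_map f (koszul_diff y x).
Proof.
move=> fy; apply/ffunP => T; rewrite !ffunE raddf_sum; apply: eq_bigr => j _.
by rewrite ffunE /= raddf_koszul_sign fy.
Qed.

Lemma koszul_diff_linear y (f : {linear V -> W}) x :
  koszul_diff y (koszul_map f x) = koszul_map f (koszul_diff y x).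
Proof. by apply: koszul_diff_map => j v; rewrite /= linearZ. Qed.

Lemma koszul_map_deg (f : {additive V -> W}) i x :
  koszul_deg i x -> koszul_deg i (koszul_map f x).
Proof.
by move=> /koszul_degP xi; apply/koszul_degP => S Si; rewrite ffunE xi ?raddf0.
Qed.

End KoszulMap.

Section KoszulDiff2.
Variables (R : comNzRingType) (r : nat) (y : 'I_r -> R) (V : lmodType R).

Lemma koszul_diff_diff (x : koszul r V) : koszul_diff y (koszul_diff y x) = 0.
Proof.
apply/ffunP => T; rewrite !ffunE.
pose F j l := (koszul_sign R T j * y j * (koszul_sign R (j |: T) l * y l)) *:
  x (l |: (j |: T)).
transitivity (\sum_(j | j \notin T) \sum_(l | (l \notin T) && (l != j)) F j l).
  apply: eq_bigr => j jT; rewrite ffunE scalerA scaler_sumr; apply: eq_big => [l|l _].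
    by rewrite !inE negb_or andbC.
  by rewrite /F !scalerA !mulrA.
(* (j, l) and (l, j) contribute opposite terms; collect both where l < j *)
pose G (j l : 'I_r) := if (l < j)%N then F j l + F l j else 0.
transitivity (\sum_(j | j \notin T) \sum_(l | (l \notin T) && (l != j)) G j l).
  rewrite /G.
  transitivity (\sum_(j | j \notin T) \sum_(l | (l \notin T) && (l != j))
     (if (l < j)%N then F j l else 0) +
   \sum_(j | j \notin T) \sum_(l | (l \notin T) && (l != j))
     (if (l < j)%N then F l j else 0)); last first.
    rewrite -big_split; apply: eq_bigr => j _ /=; rewrite -big_split.
    by apply: eq_bigr => l _ /=; case: ifP; rewrite ?addr0.
  rewrite [X in _ + X](exchange_big_dep (fun l => l \notin T)) /=; last first.
    by move=> j l _ /andP[].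
  rewrite -big_split; apply: eq_bigr => j jT /=.
  rewrite [X in _ + X](eq_bigl (fun l => (l \notin T) && (l != j))); last first.
    by move=> l; rewrite jT eq_sym.
  rewrite -big_split; apply: eq_bigr => l /andP[lT lj] /=.
  case: (ltngtP l j) => [||/val_inj e]; rewrite ?addr0 ?add0r //.
  by rewrite e eqxx in lj.
rewrite big1 // => j jT; rewrite big1 // => l /andP[lT lj]; rewrite /G.
case: ifP => // lj'; rewrite /F setUCA -scalerDl !koszul_signU1 //.
rewrite lj' ltnNge ltnW //= expr0 expr1.
by rewrite [X in X *: _](_ : _ = 0) ?scale0r //; ring.
Qed.

End KoszulDiff2.

Section KoszulRetract.
Variables (p : nat) (R : comNzRingType) (r : nat) (y : 'I_r -> R) (V : lmodType R).
Variable kap : 'I_r -> {additive V -> V}.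
Hypothesis p_gt0 : (0 < p)%N.
Hypothesis kapC : forall (j l : 'I_r) v, l != j -> kap j (y l *: v) = y l *: kap j v.
Hypothesis kapP : forall j a v, kap j (a ^+ p *: v) = a ^+ p *: kap j v.
Hypothesis kapE : forall j v,
  \sum_(e < p) y j ^+ e *: kap j (y j ^+ (p.-1 - e) *: v) = v.
Implicit Types (T : {set 'I_r}) (s : seq 'I_r).

(** Division by y_j: by kapE, v is the sum of the y_j^e v_e for 0 <= e < p, where
v_e = kap j (y_j^(p-1-e) v), and this is the sum of the y_j^(e-1) v_e for
0 < e < p. *)
Let delta j v := \sum_(e < p.-1) y j ^+ e *: kap j (y j ^+ (p.-1 - e.+1) *: v).

Lemma delta_mull j v : y j *: delta j v + kap j (y j ^+ p.-1 *: v) = v.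
Proof.
rewrite -[RHS](kapE j) /delta; case: (p) p_gt0 => //= q _.
rewrite big_ord_recl /= expr0 scale1r subn0 addrC scaler_sumr; congr (_ + _).
by apply: eq_bigr => e _; rewrite scalerA -exprS.
Qed.

Lemma delta_mulr j v : delta j (y j *: v) + y j ^+ p.-1 *: kap j v = v.
Proof.
rewrite -[RHS](kapE j) /delta; case: (p) p_gt0 => //= q _.
rewrite big_ord_recr /= subnn expr0 scale1r; congr (_ + _).
apply: eq_bigr => e _; rewrite scalerA -exprSr subnS prednK // subn_gt0.
exact: ltn_ord.
Qed.

Lemma deltaC j l v : l != j -> delta j (y l *: v) = y l *: delta j v.
Proof.
move=> lj; rewrite /delta scaler_sumr; apply: eq_bigr => e _.
by rewrite scalerA mulrC -scalerA kapC // !scalerA mulrC.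
Qed.

Lemma delta_zmod j : zmod_morphism (delta j).
Proof.
move=> u v; rewrite /delta -sumrB; apply: eq_bigr => e _.
by rewrite scalerBr raddfB scalerBr.
Qed.

HB.instance Definition _ j := GRing.isZmodMorphism.Build V V (delta j) (delta_zmod j).

(** Multiplication by y_j followed by delta j leaves all terms y_j^e v_e with
e < p - 1 alone, and delta j followed by multiplication by y_j those with
e > 0. The term for which this fails is kept: e = p - 1 in the components with
j in T, and e = 0 in the others. *)
Definition koszul_step j (x : koszul r V) : koszul r V :=
  [ffun T : {set 'I_r} => if j \in T then y j ^+ p.-1 *: kap j (x T)
             else kap j (y j ^+ p.-1 *: x T)].

(** Apply koszul_homotopy to the quotient of x by y_j. The operator delta j
commutes with the y_l for l <> j, so that in the components with j in T the
commutator of delta j with the differential is that of delta j with y_j. *)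
Lemma koszul_step_homotopy j (x : koszul r V) :
  koszul_diff y (koszul_wedge j (koszul_map (delta j) x)) +
    koszul_wedge j (koszul_map (delta j) (koszul_diff y x)) =
  x - koszul_step j x.
Proof.
have /eqP := koszul_homotopy y j (koszul_map (delta j) x).
rewrite eq_sym -subr_eq => /eqP <-; apply/ffunP => T; rewrite !ffunE.
case: (boolP (j \in T)) => jT; last first.
  by rewrite subr0 addr0 -{2}[x T](delta_mull j) addrK.
have jT' : j \notin T :\ j by rewrite setD11.
rewrite [delta j (\sum_(_ | _) _)]raddf_sum (bigD1 j) //= [X in _ + _ *: X](bigD1 j)
  //=.
rewrite [delta j (koszul_sign _ _ _ *: _)]raddf_koszul_sign /= setD1K // !ffunE
  !scalerDr.
have addE (a b c e : V) : a - (a + b) + (c + e) = c + (e - b).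
  by rewrite opprD (addrA a) subrr sub0r addrCA [e - b]addrC.
rewrite !koszul_signK addE -[RHS]addr0; congr (_ + _).
  by rewrite -{2}[x T](delta_mulr j) addrK.
rewrite -scalerBr -sumrB big1 ?scaler0 // => l /andP[_ lj].
by rewrite raddf_koszul_sign /= deltaC // ffunE subrr.
Qed.

Fixpoint kaps s : {additive V -> V} :=
  if s is j :: s' then kap j \o kaps s' else idfun.

Lemma kapX j l n v : l != j -> kap j (y l ^+ n *: v) = y l ^+ n *: kap j v.
Proof.
move=> lj; elim: n => [|n IHn]; first by rewrite !scale1r.
by rewrite exprS -scalerA kapC // IHn scalerA.
Qed.

Lemma kapsC s l n v : l \notin s -> kaps s (y l ^+ n *: v) = y l ^+ n *: kaps s v.
Proof.
elim: s v => //= j s IHs v; rewrite inE negb_or => /andP[lj ls].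
by rewrite IHs // kapX.
Qed.

Lemma kapsP s a v : kaps s (a ^+ p *: v) = a ^+ p *: kaps s v.
Proof. by elim: s v => //= j s IHs v; rewrite IHs kapP. Qed.

Let Y s T := \prod_(j <- s | j \in T) y j ^+ p.-1.

(** The operator kap j commutes with the powers of y_l for l <> j, so the steps
for the different j can be collected. *)
Lemma koszul_steps s (x : koszul r V) T : uniq s ->
  foldr koszul_step x s T = Y s T *: kaps s (Y s (~: T) *: x T).
Proof.
rewrite /Y; elim: s => [|j s IHs] /=; first by rewrite !big_nil !scale1r.
move=> /andP[js us]; rewrite ffunE IHs // !big_cons inE.
have kapY (A : {set 'I_r}) v :
    kap j ((\prod_(l <- s | l \in A) y l ^+ p.-1) *: v) =
    (\prod_(l <- s | l \in A) y l ^+ p.-1) *: kap j v.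
  clear IHs us; elim: s js v => [|l s' IHs'] js v; first by rewrite big_nil !scale1r.
  move: js; rewrite inE negb_or big_cons => /andP[jl js].
  case: ifP => _; last exact: IHs'.
  by rewrite -!scalerA -IHs' // kapX // eq_sym.
case: (boolP (j \in T)) => jT /=; first by rewrite kapY scalerA.
by rewrite -kapY -[in RHS]scalerA kapsC // !scalerA mulrC.
Qed.

Lemma koszul_steps_homotopy s i (x : koszul r V) :
  koszul_deg i x -> koszul_diff y x = 0 ->
  exists w, koszul_deg i.+1 w /\ x = foldr koszul_step x s + koszul_diff y w.
Proof.
move=> xi dx.
suff [? _ //] : (exists w, koszul_deg i.+1 w /\
    x = foldr koszul_step x s + koszul_diff y w) /\
  (koszul_deg i (foldr koszul_step x s) /\ koszul_diff y (foldr koszul_step x s) = 0).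
elim: s => [|j s [[w [wi xw]] [xsi dxs]]] /=.
  split=> //; exists 0; split; first exact: koszul_deg0.
  by rewrite raddf0 addr0.
set xs := foldr _ _ _ in xw xsi dxs *.
pose u : koszul r V := koszul_wedge j (koszul_map (delta j) xs).
have ui : koszul_deg i.+1 u by apply/koszul_wedge_deg/koszul_map_deg.
have e : koszul_step j xs = xs - koszul_diff y u.
  have := koszul_step_homotopy j xs; rewrite dxs.
  have -> : koszul_wedge j (koszul_map (delta j) 0) = 0 :> koszul r V.
    by apply/ffunP => T; rewrite !ffunE; case: ifP; rewrite // raddf0 scaler0.
  by rewrite addr0 -/u => ->; rewrite subKr.
split; [exists (u + w); split|split].
- by rewrite -[u]scale1r koszul_degZD.
- by rewrite raddfD e addrA subrK.
- apply/koszul_degP => S Si; rewrite ffunE (koszul_degP _ _ xsi) // !scaler0 raddf0.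
  by rewrite scaler0 if_same.
- by rewrite e raddfB /= dxs koszul_diff_diff subr0.
Qed.

Definition koszul_pow T := \prod_(j in T) y j ^+ p.-1.
(** koszul_twist embeds K(y^p; V) in K(y; V), and koszul_untwist is a
morphism of complexes in the other direction; all that is needed is that
their composite on K(y; V) is homotopic to the identity, and that, for V = F(M),
the composite on K(y^p; V) takes b (x) m to b' (x) m with b' congruent to b
modulo the y_j. *)
Definition koszul_twist (z : koszul r V) : koszul r V := [ffun T : {set 'I_r} =>
  koszul_pow T *: z T].
Definition kap_all := kaps (index_enum 'I_r).
Definition koszul_untwist (x : koszul r V) : koszul r V :=
  [ffun T : {set 'I_r} => kap_all (koszul_pow (~: T) *: x T)].

(** The composite of all koszul_step is the composite of koszul_untwist and
koszul_twist, and each of them changes a cycle by a boundary. *)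
Lemma koszul_retract i (x : koszul r V) :
  koszul_deg i x -> koszul_diff y x = 0 ->
  exists w, koszul_deg i.+1 w /\
    x = koszul_twist (koszul_untwist x) + koszul_diff y w.
Proof.
move=> xi dx; have [w [wi xw]] := koszul_steps_homotopy (index_enum 'I_r) xi dx.
exists w; split=> //; rewrite {1}xw; congr (_ + _); apply/ffunP => T.
by rewrite koszul_steps ?index_enum_uniq // !ffunE.
Qed.

Lemma koszul_powU1 j T : j \notin T -> koszul_pow (j |: T) = y j ^+ p.-1 * koszul_pow T.
Proof.
by move=> jT; rewrite /koszul_pow (bigD1 j) ?setU11 //=; congr (_ * _);
  apply: eq_bigl => l; rewrite !inE; case: eqP => [->|_] /=; rewrite ?andbT // (negPf
    jT).
Qed.

Lemma koszul_diff_twist z :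
  koszul_diff y (koszul_twist z) = koszul_twist (koszul_diff (fun j => y j ^+ p) z).
Proof.
apply/ffunP => T; rewrite !ffunE scaler_sumr; apply: eq_bigr => j jT.
rewrite ffunE koszul_powU1 // !scalerA; congr (_ *: _).
by rewrite -[in RHS](prednK p_gt0) exprS; ring.
Qed.

Lemma koszul_diff_untwist x :
  koszul_diff (fun j => y j ^+ p) (koszul_untwist x) = koszul_untwist (koszul_diff y x).
Proof.
apply/ffunP => T; rewrite !ffunE scaler_sumr raddf_sum; apply: eq_bigr => j jT.
rewrite ffunE -kapsP /= -raddf_koszul_sign; congr (kap_all _); rewrite !scalerA.
congr (_ *: _); have -> : ~: T = j |: ~: (j |: T).
  by apply/setP => l; rewrite !inE; case: eqP => [->|].
rewrite koszul_powU1 ?inE ?eqxx // -[in LHS](prednK p_gt0) exprS.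
by ring.
Qed.

End KoszulRetract.

(** * The comparison map from F(H(M)) to H(F(M)) *)

Section HomologyBasics.
Variables (R : comNzRingType) (r : nat) (y : 'I_r -> R) (yP : proper_seq y).
Variables (M : lmodType R) (i : nat).

Lemma koszul_class_eq0 (c : koszul_cycle y M i) :
  koszul_class yP c = 0 <-> c \in @koszul_bounding R r y M i.
Proof. by rewrite -[X in _ = X](raddf0 (@koszul_class R r y yP M i)) koszul_class_eq
  subr0. Qed.

Lemma koszul_classZ (a : R) (c : koszul_cycle y M i) :
  (\pi_(quot_seq yP) a : quot_seq yP) *: koszul_class yP c = koszul_class yP (a *: c).
Proof. exact: koszul_homology_scaleE. Qed.

Lemma koszul_boundingP (c : koszul_cycle y M i) :
  c \in @koszul_bounding R r y M i <->
  exists z, koszul_deg i.+1 z /\ koszul_cycle_val c = koszul_diff y z.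
Proof. by split=> [/asboolP|h]; [|apply/asboolP]. Qed.

Lemma koszul_cycle_mem (x : koszul r M) :
  koszul_deg i x -> koszul_diff y x = 0 -> x \in koszul_cycles y i.
Proof. by move=> xi dx; rewrite inE xi dx eqxx. Qed.

Lemma koszul_cycle_deg (c : koszul_cycle y M i) : koszul_deg i (koszul_cycle_val c).
Proof. by have /andP[] := koszul_cycleP c. Qed.

Lemma koszul_cycle_diff (c : koszul_cycle y M i) : koszul_diff y (koszul_cycle_val c)
  = 0.
Proof. by have /andP[_ /eqP] := koszul_cycleP c. Qed.

Lemma koszul_cycle_valB (c e : koszul_cycle y M i) :
  koszul_cycle_val (c - e) = koszul_cycle_val c - koszul_cycle_val e.
Proof. by []. Qed.

Lemma koszul_cycle_val_sum (I : Type) (s : seq I) (c : I -> koszul_cycle y M i) :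
  koszul_cycle_val (\sum_(t <- s) c t) = \sum_(t <- s) koszul_cycle_val (c t).
Proof. exact: (big_morph (@koszul_cycle_val R r y M i) (fun _ _ => erefl) erefl). Qed.

End HomologyBasics.

Section HomologyMap.
Variables (R : comNzRingType) (r : nat) (y : 'I_r -> R) (yP : proper_seq y).
Variables (M N : lmodType R) (i : nat).
Variable f : {linear M -> N}.

Lemma koszul_map_cycle (c : koszul_cycle y M i) :
  koszul_map f (koszul_cycle_val c) \in koszul_cycles y i.
Proof.
apply: koszul_cycle_mem; first exact/koszul_map_deg/koszul_cycle_deg.
by rewrite koszul_diff_linear koszul_cycle_diff; apply/ffunP => T; rewrite !ffunE
  raddf0.
Qed.

Definition cycle_map (c : koszul_cycle y M i) : koszul_cycle y N i :=
  KoszulCycle (koszul_map_cycle c).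

Definition homology_map (h : koszul_homology yP M i) : koszul_homology yP N i :=
  koszul_class yP (cycle_map (koszul_repr h)).

Lemma cycle_mapB c e : cycle_map (c - e) = cycle_map c - cycle_map e.
Proof. by apply/val_inj/ffunP => T /=; rewrite !ffunE raddfB. Qed.

Lemma homology_mapE c : homology_map (koszul_class yP c) = koszul_class yP (cycle_map
  c).
Proof.
rewrite /homology_map; set c' := koszul_repr _.
have /koszul_class_eq/koszul_boundingP[z [zi cz]] :
  koszul_class yP c' = koszul_class yP c by rewrite koszul_reprK.
apply/koszul_class_eq; rewrite -cycle_mapB; apply/koszul_boundingP.
exists (koszul_map f z); split; first exact: koszul_map_deg.
by rewrite koszul_diff_linear -cz.
Qed.

Fact homology_map_linear : linear homology_map.
Proof.
move=> a g h; rewrite -[a]reprK -[g]koszul_reprK -[h]koszul_reprK.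
rewrite koszul_classZ -raddfD !homology_mapE koszul_classZ -raddfD.
congr (koszul_class _ _).
by apply/val_inj/ffunP => T /=; rewrite !ffunE linearP.
Qed.

HB.instance Definition _ := GRing.isLinear.Build (quot_seq yP)
  (koszul_homology yP M i) (koszul_homology yP N i) *:%R homology_map
    homology_map_linear.

End HomologyMap.

Arguments homology_map {R r y} yP {M N} i f h.

Section Psi.
Variables (p : nat) (R : comNzRingType) (r : nat) (y : 'I_r -> R) (yP : proper_seq y).
Variable kap : 'I_r -> {additive R -> R}.
Hypothesis p_gt0 : (0 < p)%N.
Hypothesis kapC : forall (j l : 'I_r) x, l != j -> kap j (y l * x) = y l * kap j x.
Hypothesis kapP : forall j a x, kap j (a ^+ p * x) = a ^+ p * kap j x.
Hypothesis kapE : forall j x,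
  \sum_(e < p) y j ^+ e * kap j (y j ^+ (p.-1 - e) * x) = x.
Variable i : nat.

Section PsiM.
Variable M : lmodType R.
Local Notation FM := (frob p M).
Local Notation yp := (fun j => y j ^+ p).

Definition frob_kap j : {additive FM -> FM} := sval (frob_op_sig (kapP j) M).

Lemma frob_kap_tensor j a m : frob_kap j (frob_tensor p a m) = frob_tensor p (kap j
  a) m.
Proof. exact: (svalP (frob_op_sig (kapP j) M)). Qed.

Lemma frob_kapC (j l : 'I_r) v : l != j -> frob_kap j (y l *: v) = y l *: frob_kap j v.
Proof.
move=> lj; elim/frob_ind: v => [x z hx hz|b m|].
- by rewrite scalerBr !raddfB /= hx hz.
- by rewrite frob_scaleE !frob_kap_tensor kapC // frob_scaleE.
- by rewrite scaler0 raddf0 scaler0.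
Qed.

Lemma frob_kapP j a v : frob_kap j (a ^+ p *: v) = a ^+ p *: frob_kap j v.
Proof.
elim/frob_ind: v => [x z hx hz|b m|].
- by rewrite scalerBr !raddfB /= hx hz.
- by rewrite frob_scaleE !frob_kap_tensor kapP // frob_scaleE.
- by rewrite scaler0 raddf0 scaler0.
Qed.

Lemma frob_kapE j v :
  \sum_(e < p) y j ^+ e *: frob_kap j (y j ^+ (p.-1 - e) *: v) = v.
Proof.
elim/frob_ind: v => [x z hx hz|b m|].
- rewrite -{2}hx -{2}hz -sumrB; apply: eq_bigr => e _.
  by rewrite scalerBr !raddfB.
- under eq_bigr => e _ do rewrite frob_scaleE frob_kap_tensor frob_scaleE.
  by rewrite -frob_tensor_suml kapE.
- by rewrite big1 // => e _; rewrite scaler0 raddf0 scaler0.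
Qed.

Lemma frob_tensorBl (a b : R) (m : M) :
  frob_tensor p (a - b) m = frob_tensor p a m - frob_tensor p b m.
Proof. by rewrite -[a in RHS](subrK b) [X in _ = X - _]frob_tensorDl addrK. Qed.

Fact frob_tensor_zmod (b : R) : zmod_morphism (@frob_tensor p R M b).
Proof. by move=> m n; rewrite -[m in RHS](subrK n) [X in _ = X - _]frob_tensorDr
  addrK. Qed.

HB.instance Definition _ b :=
  GRing.isZmodMorphism.Build M FM (@frob_tensor p R M b) (frob_tensor_zmod b).

Definition twist_tensor (b : R) (x : koszul r M) : koszul r FM :=
  koszul_twist p y (koszul_map (@frob_tensor p R M b) x).

Lemma koszul_diff_tensor b (x : koszul r M) :
  koszul_diff yp (koszul_map (@frob_tensor p R M b) x) =
  koszul_map (@frob_tensor p R M b) (koszul_diff y x).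
Proof.
by apply: koszul_diff_map => j v; rewrite /= -frob_tensorZ frob_scaleE.
Qed.

Lemma koszul_diff_twist_tensor b x :
  koszul_diff y (twist_tensor b x) = twist_tensor b (koszul_diff y x).
Proof. by rewrite /twist_tensor koszul_diff_twist // koszul_diff_tensor. Qed.

Lemma twist_tensor_deg b k x : koszul_deg k x -> koszul_deg k (twist_tensor b x).
Proof.
move=> /koszul_degP xi; apply/koszul_degP => S Si.
by rewrite !ffunE xi // raddf0 scaler0.
Qed.

Lemma frob_homology_cycle_subproof b (c : koszul_cycle y M i) :
  twist_tensor b (koszul_cycle_val c) \in koszul_cycles y i.
Proof.
apply: koszul_cycle_mem; first exact/twist_tensor_deg/koszul_cycle_deg.
rewrite koszul_diff_twist_tensor koszul_cycle_diff.
by apply/ffunP => T; rewrite !ffunE raddf0 scaler0.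
Qed.

Definition frob_homology_cycle b c := KoszulCycle (frob_homology_cycle_subproof b c).

Lemma frob_homology_cycleDl a b c : frob_homology_cycle (a + b) c =
  frob_homology_cycle a c + frob_homology_cycle b c.
Proof. by apply/val_inj/ffunP => T /=; rewrite !ffunE frob_tensorDl scalerDr. Qed.

Lemma frob_homology_cycleDr a b c : frob_homology_cycle a (b + c) =
  frob_homology_cycle a b + frob_homology_cycle a c.
Proof. by apply/val_inj/ffunP => T /=; rewrite !ffunE frob_tensorDr scalerDr. Qed.

Lemma frob_homology_cycleZ a b c : frob_homology_cycle (a * b) c = a *:
  frob_homology_cycle b c.
Proof.
by apply/val_inj/ffunP => T /=; rewrite !ffunE -frob_scaleE !scalerA mulrC.
Qed.

Lemma frob_homology_cycleF a b c : frob_homology_cycle (b ^+ p * a) c =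
  frob_homology_cycle a (b *: c).
Proof. by apply/val_inj/ffunP => T /=; rewrite !ffunE frob_tensorZ. Qed.

Lemma frob_homology_cycle_bounding b c :
  c \in @koszul_bounding R r y M i -> frob_homology_cycle b c \in @koszul_bounding R
    r y FM i.
Proof.
move=> /koszul_boundingP[z [zi cz]]; apply/koszul_boundingP.
exists (twist_tensor b z); split; first exact: twist_tensor_deg.
by rewrite koszul_diff_twist_tensor /= cz.
Qed.

Local Notation H := (koszul_homology yP M i).
Local Notation HF := (koszul_homology yP FM i).

(** The representatives are harmless: y_j annihilates the homology of F(M), and
twist_tensor b commutes with the differentials. *)
Definition frob_homology_tensor (b : quot_seq yP) (h : H) : HF :=
  koszul_class yP (frob_homology_cycle (repr b) (koszul_repr h)).

Lemma frob_homology_tensorE (b : R) c :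
  frob_homology_tensor (\pi_(quot_seq yP) b) (koszul_class yP c) = koszul_class yP
    (frob_homology_cycle b c).
Proof.
rewrite /frob_homology_tensor; set b' := repr _; set c' := koszul_repr _.
have bb : b' - b \in seq_span y.
  have : b' - b \in seq_ideal yP.
    by rewrite (Quotient.idealrBE (seq_ideal yP : idealr R)) reprK.
  by [].
have /koszul_class_eq cc :
  koszul_class yP c' = koszul_class yP c by rewrite koszul_reprK.
apply/eqP; rewrite -subr_eq0 -raddfB; apply/eqP/koszul_class_eq0.
have -> : frob_homology_cycle b' c' - frob_homology_cycle b c =
    frob_homology_cycle b' (c' - c) + (b' - b) *: frob_homology_cycle 1 c.
  rewrite -frob_homology_cycleZ mulr1; apply/val_inj/ffunP => T /=; rewrite !ffunE.
  rewrite -scalerBr -scalerDr; congr (_ *: _); rewrite raddfB /=.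
  by rewrite frob_tensorBl addrA subrK.
rewrite -[frob_homology_cycle b' _]scale1r (koszul_bounding_submod y FM i).2 //.
  exact: frob_homology_cycle_bounding.
exact: koszul_bounding_span.
Qed.

Lemma frob_homology_sig : {f : {additive frob p H -> HF} |
  forall b h, f (frob_tensor p b h) = frob_homology_tensor b h}.
Proof.
apply: frob_lift => [a b h|a g h|a b h].
- by rewrite -[a]reprK -[b]reprK -[h]koszul_reprK -raddfD !frob_homology_tensorE
  frob_homology_cycleDl raddfD.
- by rewrite -[a]reprK -[g]koszul_reprK -[h]koszul_reprK -raddfD
  !frob_homology_tensorE frob_homology_cycleDr raddfD.
- rewrite -[a]reprK -[b]reprK -[h]koszul_reprK -rmorphXn -rmorphM koszul_classZ
  !frob_homology_tensorE.
  by rewrite frob_homology_cycleF.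
Qed.

Definition frob_homology (x : frob p H) : HF := sval frob_homology_sig x.

Fact frob_homology_zmod : zmod_morphism frob_homology.
Proof. by move=> x z; apply: raddfB. Qed.

HB.instance Definition _ := GRing.isZmodMorphism.Build (frob p H) HF frob_homology
  frob_homology_zmod.

Lemma frob_homologyE (b : R) c :
  frob_homology (frob_tensor p (\pi_(quot_seq yP) b : quot_seq yP) (koszul_class yP
    c)) =
  koszul_class yP (frob_homology_cycle b c).
Proof. by rewrite -frob_homology_tensorE; apply: (svalP frob_homology_sig). Qed.

Fact frob_homology_scalable : scalable frob_homology.
Proof.
move=> a; elim/frob_ind => [x z hx hz|b h|].
- by rewrite scalerBr !raddfB /= hx hz.
- rewrite frob_scaleE -[a]reprK -[b]reprK -[h]koszul_reprK -rmorphM !frob_homologyE.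
  by rewrite koszul_classZ frob_homology_cycleZ.
- by rewrite scaler0 raddf0 scaler0.
Qed.

HB.instance Definition _ := GRing.isScalable.Build (quot_seq yP)
  (frob p H) HF *:%R frob_homology frob_homology_scalable.
End PsiM.
End Psi.

Arguments frob_homology {p R r y} yP p_gt0 i M x.

(** * Bijectivity of the comparison map *)

Section PsiBij.
Variables (p : nat) (R : comNzRingType) (r : nat) (y : 'I_r -> R) (yP : proper_seq y).
Variable kap : 'I_r -> {additive R -> R}.
Hypothesis p_gt0 : (0 < p)%N.
Hypothesis kapC : forall (j l : 'I_r) x, l != j -> kap j (y l * x) = y l * kap j x.
Hypothesis kapP : forall j a x, kap j (a ^+ p * x) = a ^+ p * kap j x.
Hypothesis kapE : forall j x,
  \sum_(e < p) y j ^+ e * kap j (y j ^+ (p.-1 - e) * x) = x.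
Hypothesis trR : cartier_trace p R.
Variables (i : nat) (M : lmodType R).
Local Notation FM := (frob p M).
Local Notation yp := (fun j => y j ^+ p).
Local Notation H := (koszul_homology yP M i).
Local Notation HF := (koszul_homology yP FM i).
Local Notation untwist := (koszul_untwist p y (frob_kap kapP M)).

Lemma pi_quot_seq_eq0 (a : R) : a \in seq_span y -> \pi_(quot_seq yP) a = 0.
Proof.
move=> ay; rewrite -(raddf0 \pi_(quot_seq yP)); apply/eqP.
by rewrite -(Quotient.idealrBE (seq_ideal yP : idealr R)) subr0.
Qed.

Lemma seq_span_gen j : y j \in seq_span y.
Proof.
apply/asboolP; exists (fun l => (l == j)%:R); rewrite (bigD1 j) //= eqxx mul1r.
by rewrite big1 ?addr0 // => l /negPf->; rewrite mul0r.
Qed.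

(** Only the term with e = 0 of the expansion of x is not a multiple of y_j. *)
Lemma pi_kap j x : \pi_(quot_seq yP) (kap j (y j ^+ p.-1 * x)) = \pi_(quot_seq yP) x.
Proof.
rewrite -[x in RHS](kapE j); case: (p) p_gt0 => //= q _.
rewrite big_ord_recl /= expr0 mul1r subn0 rmorphD /= rmorph_sum big1 ?addr0 // => e _.
rewrite exprS -mulrA rmorphM /= pi_quot_seq_eq0 ?mul0r //; exact: seq_span_gen.
Qed.

Lemma kapX_ring (j l : 'I_r) n x : l != j -> kap j (y l ^+ n * x) = y l ^+ n * kap j x.
Proof.
move=> lj; elim: n => [|n IHn]; first by rewrite !mul1r.
by rewrite exprS -mulrA kapC // IHn mulrA.
Qed.

Let kap_fold s x := foldr (fun j => kap j) x s.

Lemma kap_foldX s j n x : j \notin s -> kap_fold s (y j ^+ n * x) = y j ^+ n *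
  kap_fold s x.
Proof.
elim: s => //= l s IHs; rewrite inE negb_or => /andP[jl js].
by rewrite IHs // kapX_ring.
Qed.

Lemma pi_kap_fold s x : uniq s ->
  \pi_(quot_seq yP) (kap_fold s ((\prod_(j <- s) y j ^+ p.-1) * x)) = \pi_(quot_seq
    yP) x.
Proof.
elim: s => [|j s IHs] /=; first by rewrite big_nil mul1r.
by move=> /andP[js us]; rewrite big_cons -mulrA kap_foldX // pi_kap IHs.
Qed.

Lemma kaps_tensor s a (m : M) :
  kaps (frob_kap kapP M) s (frob_tensor p a m) = frob_tensor p (kap_fold s a) m.
Proof. by elim: s => //= j s ->; rewrite frob_kap_tensor. Qed.

(** A cycle is homologous to the twist of a cycle z of K(y^p; F(M)), and the
Cartier maps C_s write z as a sum of r_s (x) C_s(z), with C_s(z) a cycle of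
K(y; M). *)
Lemma frob_homology_surj (h : HF) : exists g, frob_homology yP p_gt0 i M g = h.
Proof.
pose c := koszul_repr h; pose x := koszul_cycle_val c; pose z := untwist x.
have FC := frob_kapC kapC kapP (M := M).
have [w [wi xw]] := koszul_retract p_gt0 FC
  (frob_kapE kapP kapE (M := M)) (koszul_cycle_deg c) (koszul_cycle_diff c).
have zi : koszul_deg i z.
  apply/koszul_degP => S Si; rewrite ffunE (koszul_degP _ _ (koszul_cycle_deg c)) //.
  by rewrite scaler0 raddf0.
have dz : koszul_diff yp z = 0.
  rewrite (koszul_diff_untwist y p_gt0 (frob_kapP kapP (M := M))) koszul_cycle_diff.
  by apply/ffunP => T; rewrite !ffunE scaler0 raddf0.
have [s sP] := cartier_trace_frob p_gt0 trR z.
have cyc (C : cartier p R) :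
    koszul_map (cartier_frob C M) z \in koszul_cycles y i.
  apply: koszul_cycle_mem; first exact: koszul_map_deg.
  rewrite (@koszul_diff_map R r FM M yp y) => [|j v]; last exact: cartier_frobZ.
  by rewrite dz; apply/ffunP => T; rewrite !ffunE raddf0.
pose e C := KoszulCycle (cyc C).
exists (\sum_(t <- s) frob_tensor p (\pi_(quot_seq yP) t.1 : quot_seq yP)
   (koszul_class yP (e t.2))).
rewrite raddf_sum /=; under eq_bigr => t _ do rewrite frob_homologyE.
rewrite -raddf_sum -[h]koszul_reprK -/c; apply/esym/koszul_class_eq/koszul_boundingP.
exists w; split; first exact: wi.
rewrite koszul_cycle_valB koszul_cycle_val_sum; apply/eqP; rewrite subr_eq; apply/eqP.
rewrite -/x {1}/x xw addrC; congr (_ + _); apply/ffunP => T.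
rewrite ffunE -/z sP sum_ffunE scaler_sumr; apply: eq_bigr => t _.
by rewrite !ffunE.
Qed.

(** Suppose that the twist of z, the sum of the a_t (x) c_t, is a boundary.
Untwisting shows that the sum of the k(a_t) (x) c_t is a boundary in
K(y^p; F(M)), where k(a_t) and a_t are congruent modulo the y_j. A Cartier map
C takes it to a boundary of K(y; M), the sum of the C(k(a_t)) c_t; expanding
the k(a_t) in terms of Cartier maps leaves a sum of tensors of zero classes. *)
Lemma frob_homology_inj : injective (frob_homology yP p_gt0 i M).
Proof.
apply: raddf_inj => h; have [s ->] := frob_sum h => {h}.
have [s' ->] : exists s' : seq (R * koszul_cycle y M i),
    \sum_(t <- s) frob_tensor p t.1 t.2 =
    \sum_(t <- s') frob_tensor p (\pi_(quot_seq yP) t.1 : quot_seq yP)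
       (koszul_class yP t.2).
  exists [seq (repr t.1, koszul_repr t.2) | t <- s]; rewrite big_map.
  by apply: eq_bigr => t _; rewrite reprK koszul_reprK.
rewrite raddf_sum /=; under eq_bigr => t _ do rewrite frob_homologyE.
rewrite -raddf_sum => /koszul_class_eq0/koszul_boundingP[w [wi]].
pose z : koszul r FM := \sum_(t <- s') koszul_map (@frob_tensor p R M t.1) (val t.2).
have -> : koszul_cycle_val (\sum_(t <- s') frob_homology_cycle p_gt0 t.1 t.2) =
  koszul_twist p y z.
  rewrite koszul_cycle_val_sum; apply/ffunP => T.
  rewrite ffunE !sum_ffunE scaler_sumr; apply: eq_bigr => t _.
  by rewrite !ffunE.
move=> /(congr1 untwist); rewrite -(koszul_diff_untwist y p_gt0 (frob_kapP kapP (M :=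
  M))).
set v := untwist w => zv.
pose k a := kap_fold (index_enum 'I_r) ((\prod_j y j ^+ p.-1) * a).
have zE T : \sum_(t <- s') frob_tensor p (k t.1) (val t.2 T) = koszul_diff yp v T.
  rewrite -zv !ffunE scalerA.
  have -> : koszul_pow p y (~: T) * koszul_pow p y T = \prod_j y j ^+ p.-1.
    rewrite mulrC [RHS](bigID (fun j => j \in T)) /=; congr (_ * _).
    by apply: eq_bigl => j; rewrite inE.
  rewrite sum_ffunE scaler_sumr raddf_sum; apply: eq_bigr => t _.
  by rewrite ffunE frob_scaleE /kap_all kaps_tensor.
have vi : koszul_deg i.+1 v.
  by apply/koszul_degP => S Si; rewrite ffunE (koszul_degP _ _ wi) // scaler0 raddf0.
have [u uP] := cartier_trace_seq p_gt0 trR [seq k t.1 | t <- s'].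
transitivity (\sum_(t <- s') \sum_(q <- u)
   frob_tensor p (\pi_(quot_seq yP) q.1 : quot_seq yP)
     (koszul_class yP (q.2 (k t.1) *: t.2))).
  apply: eq_big_seq => t ts.
  rewrite -(pi_kap_fold t.1 (index_enum_uniq 'I_r)) -/(k t.1) {1}[k t.1]uP; last by
    apply/mapP; exists t.
  rewrite rmorph_sum frob_tensor_suml; apply: eq_bigr => q _.
  by rewrite mulrC rmorphM rmorphXn frob_tensorZ koszul_classZ.
rewrite exchange_big big1 // => q _ /=.
rewrite -frob_tensor_sumr -raddf_sum.
suff /(koszul_class_eq0 yP) e0 :
    \sum_(t <- s') q.2 (k t.1) *: t.2 \in @koszul_bounding R r y M i.
  by rewrite [X in frob_tensor _ _ X]e0 frob_tensor0.
apply/koszul_boundingP.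
exists (koszul_map (cartier_frob q.2 M) v); split; first exact: koszul_map_deg.
rewrite (@koszul_diff_map R r FM M yp y) => [|j x]; last exact: cartier_frobZ.
rewrite koszul_cycle_val_sum; apply/ffunP => T; rewrite ffunE -zE sum_ffunE raddf_sum.
by apply: eq_bigr => t _; rewrite /= cartier_frob_tensor ffunE.
Qed.

Lemma frob_homology_bij : bijective (frob_homology yP p_gt0 i M).
Proof.
have /cid[g gP] : exists g : HF -> frob p H, cancel g (frob_homology yP p_gt0 i M).
  have [g gP] := choice frob_homology_surj; by exists g.
by exists g => // x; apply: frob_homology_inj; rewrite gP.
Qed.

End PsiBij.

Lemma frob_homology_natural (p : nat) (R : comNzRingType) (r : nat) (y : 'I_r -> R)
    (yP : proper_seq y) (p_gt0 : (0 < p)%N) i (M N : lmodType R) (f : {linear M ->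
      N}) h :
  frob_homology yP p_gt0 i N (frob_map (homology_map yP i f) h) =
  homology_map yP i (frob_map f) (frob_homology yP p_gt0 i M h).
Proof.
elim/frob_ind: h => [x z hx hz|b h|]; last by rewrite !raddf0.
  by rewrite !raddfB /= hx hz.
rewrite frob_map_tensor /= -[b]reprK -[h]koszul_reprK homology_mapE !frob_homologyE
  homology_mapE.
congr (koszul_class _ _); apply/val_inj/ffunP => T /=.
by rewrite !ffunE linearZ /= frob_map_tensor.
Qed.

(** * Direct limits of sequences of modules *)

Section ModQuot.
Variables (R : comNzRingType) (M : lmodType R) (P : {pred M}).

Definition quot_mod_pred of submod_closed P : {pred M} := P.

Variable Pc : submod_closed P.

Fact quot_mod_pred_zmod : zmod_closed (quot_mod_pred Pc).
Proof. exact: GRing.submod_closedB Pc. Qed.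

HB.instance Definition _ := GRing.isZmodClosed.Build M (quot_mod_pred Pc)
  quot_mod_pred_zmod.

Definition quot_mod : Type := Quotient.quot (quot_mod_pred Pc : zmodClosed M).

HB.instance Definition _ := GRing.Zmodule.on quot_mod.

Definition quot_mod_pi (x : M) : quot_mod := \pi_(Quotient.quot (quot_mod_pred Pc :
  zmodClosed M)) x.
Definition quot_mod_repr (x : quot_mod) : M :=
  repr (x : Quotient.quot (quot_mod_pred Pc : zmodClosed M)).

Lemma quot_mod_reprK x : quot_mod_pi (quot_mod_repr x) = x.
Proof. exact: reprK. Qed.

Fact quot_mod_pi_zmod : zmod_morphism quot_mod_pi.
Proof. by move=> x z; rewrite /quot_mod_pi raddfB. Qed.

HB.instance Definition _ := GRing.isZmodMorphism.Build M quot_mod quot_mod_pi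
  quot_mod_pi_zmod.

Lemma quot_mod_pi_eq x z : quot_mod_pi x = quot_mod_pi z <-> x - z \in P.
Proof.
split=> [/eqP|xz]; first by rewrite -Quotient.idealrBE.
by apply/eqP; rewrite -Quotient.idealrBE.
Qed.

Definition quot_mod_scale (a : R) (x : quot_mod) : quot_mod := quot_mod_pi (a *:
  quot_mod_repr x).

Lemma quot_mod_scaleE a x : quot_mod_scale a (quot_mod_pi x) = quot_mod_pi (a *: x).
Proof.
apply/quot_mod_pi_eq; rewrite -scalerBr -[_ *: _]addr0 Pc.2 ?Pc.1 //.
by apply/quot_mod_pi_eq; rewrite quot_mod_reprK.
Qed.

Fact quot_mod_scaleA a b v : quot_mod_scale a (quot_mod_scale b v) = quot_mod_scale
  (a * b) v.
Proof. by rewrite -[v]quot_mod_reprK !quot_mod_scaleE scalerA. Qed.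

Fact quot_mod_scale1 : left_id 1 quot_mod_scale.
Proof. by move=> v; rewrite -[v]quot_mod_reprK !quot_mod_scaleE scale1r. Qed.

Fact quot_mod_scaleDr : right_distributive quot_mod_scale +%R.
Proof.
move=> a u v; rewrite -[u]quot_mod_reprK -[v]quot_mod_reprK -raddfD !quot_mod_scaleE
  scalerDr.
by rewrite raddfD.
Qed.

Fact quot_mod_scaleDl v : {morph quot_mod_scale^~ v : a b / a + b}.
Proof.
by move=> a b; rewrite -[v]quot_mod_reprK !quot_mod_scaleE scalerDl raddfD.
Qed.

HB.instance Definition _ := GRing.Zmodule_isLmodule.Build R quot_mod
  quot_mod_scaleA quot_mod_scale1 quot_mod_scaleDr quot_mod_scaleDl.

Fact quot_mod_pi_scalable : scalable quot_mod_pi.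
Proof. by move=> a x; rewrite -[RHS]/(quot_mod_scale _ _) quot_mod_scaleE. Qed.

HB.instance Definition _ := GRing.isScalable.Build R M quot_mod *:%R quot_mod_pi
  quot_mod_pi_scalable.

Lemma quot_mod_pi_eq0 x : quot_mod_pi x = 0 <-> x \in P.
Proof. by rewrite -[X in _ = X](raddf0 quot_mod_pi) quot_mod_pi_eq subr0. Qed.
End ModQuot.

Section DProd.
Variables (R : comNzRingType) (X : nat -> lmodType R).

(** The direct limit of the X j embeds in the quotient of this product by the
eventually zero sequences. *)
Definition seq_mod : Type := forall j, X j.

HB.instance Definition _ := gen_eqMixin seq_mod.
HB.instance Definition _ := gen_choiceMixin seq_mod.

Implicit Types f g h : seq_mod.

Fact seq_modA : associative (fun f g => (fun j => f j + g j) : seq_mod).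
Proof. by move=> f g h; apply: functional_extensionality_dep => j; rewrite addrA. Qed.
Fact seq_modC : commutative (fun f g => (fun j => f j + g j) : seq_mod).
Proof. by move=> f g; apply: functional_extensionality_dep => j; rewrite addrC. Qed.
Fact seq_mod0 : left_id ((fun j => 0) : seq_mod) (fun f g => (fun j => f j + g j) :
  seq_mod).
Proof. by move=> f; apply: functional_extensionality_dep => j; rewrite add0r. Qed.
Fact seq_modN : left_inverse ((fun j => 0) : seq_mod) (fun f => (fun j => - f j) :
  seq_mod)
  (fun f g => (fun j => f j + g j) : seq_mod).
Proof. by move=> f; apply: functional_extensionality_dep => j; rewrite addNr. Qed.

HB.instance Definition _ := GRing.isZmodule.Build seq_mod seq_modA seq_modC seq_mod0
  seq_modN.

Definition seq_mod_scale (a : R) f : seq_mod := fun j => a *: f j.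

Fact seq_mod_scaleA a b f : seq_mod_scale a (seq_mod_scale b f) = seq_mod_scale (a *
  b) f.
Proof. by apply: functional_extensionality_dep => j; rewrite /seq_mod_scale scalerA.
  Qed.
Fact seq_mod_scale1 : left_id 1 seq_mod_scale.
Proof. by move=> f; apply: functional_extensionality_dep => j; rewrite /seq_mod_scale
  scale1r. Qed.
Fact seq_mod_scaleDr : right_distributive seq_mod_scale +%R.
Proof. by move=> a f g; apply: functional_extensionality_dep => j; rewrite
  /seq_mod_scale scalerDr. Qed.
Fact seq_mod_scaleDl f : {morph seq_mod_scale^~ f : a b / a + b}.
Proof. by move=> a b; apply: functional_extensionality_dep => j; rewrite
  /seq_mod_scale scalerDl. Qed.

HB.instance Definition _ := GRing.Zmodule_isLmodule.Build R seq_mod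
  seq_mod_scaleA seq_mod_scale1 seq_mod_scaleDr seq_mod_scaleDl.

End DProd.

Section System.
Variables (R : comNzRingType) (X : nat -> lmodType R).
Variable t : forall j, {linear X j -> X j.+1}.

(** That x vanishes at a later stage. The stage is not named, so that no
identification of X (m + n) with X (n + m) is ever needed. *)
Inductive eventually_zero : forall j, X j -> Prop :=
| eventually_zero0 j : @eventually_zero j 0
| eventually_zeroS j (x : X j) : eventually_zero (t j x) -> eventually_zero x.

Inductive reach j (x : X j) : forall k, X k -> Prop :=
| reach0 : reach x x
| reachS k (z : X k) : reach x z -> reach x (t k z).

Lemma reach_ex j k (x : X j) : (j <= k)%N -> exists z : X k, reach x z.
Proof.
elim: k => [|k IHk]; first by rewrite leqn0 => /eqP e; subst j; exists x; apply: reach0.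
rewrite leq_eqVlt => /orP[/eqP e|/IHk[z xz]]; first by subst j; exists x; apply: reach0.
by exists (t k z); apply: reachS.
Qed.

Lemma eventually_zero_reach j k (x : X j) (z : X k) : reach x z -> eventually_zero z
  -> eventually_zero x.
Proof. by elim=> // l v _ IH dz; apply/IH/eventually_zeroS. Qed.

Lemma eventually_zero_t j (x : X j) : eventually_zero x -> eventually_zero (t j x).
Proof. by case=> // k; rewrite raddf0; apply: eventually_zero0. Qed.

Lemma eventually_zero_add j (x z : X j) : eventually_zero x -> eventually_zero z ->
  eventually_zero (x + z).
Proof.
move=> dx; elim: dx z => [k z|k v _ IH z dz]; first by rewrite add0r.
by apply: eventually_zeroS; rewrite raddfD; apply/IH/eventually_zero_t.
Qed.

Lemma eventually_zero_sum j (I : finType) (x : I -> X j) :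
  (forall i, eventually_zero (x i)) -> eventually_zero (\sum_i x i).
Proof. by move=> dx; apply: big_ind => //; [apply: eventually_zero0|apply:
  eventually_zero_add]. Qed.

Section Cocone.
Variables (L : lmodType R) (u : forall j, {linear X j -> L}).
Hypothesis uP : forall j x, u j.+1 (t j x) = u j x.

Lemma cocone_reach j k (x : X j) (z : X k) : reach x z -> u k z = u j x.
Proof. by elim=> // l v _; rewrite uP. Qed.

Lemma cocone_eventually_zero j (x : X j) : eventually_zero x -> u j x = 0.
Proof. by elim=> [k|k v _ <-]; rewrite ?raddf0 ?uP. Qed.
End Cocone.

(** Surjectivity onto L and vanishing only of elements that vanish at a later
stage characterize direct limits; unlike the universal property, these two
conditions can be checked through the Koszul complex. *)
Lemma direct_limit_intro (L : lmodType R) (u : forall j, {linear X j -> L}) :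
  (forall j x, u j.+1 (t j x) = u j x) ->
  (forall l, exists j x, u j x = l) ->
  (forall j x, u j x = 0 -> eventually_zero x) ->
  is_direct_limit t u.
Proof.
move=> uP uS u0; split=> // N v vP.
have uv j (x : X j) k (z : X k) : u j x = u k z -> v j x = v k z.
  have [x' xx'] := reach_ex x (leq_maxl j k).
  have [z' zz'] := reach_ex z (leq_maxr j k).
  rewrite -(cocone_reach uP xx') -(cocone_reach uP zz') => /eqP.
  rewrite -subr_eq0 -raddfB => /eqP/u0/(cocone_eventually_zero vP)/eqP.
  by rewrite raddfB subr_eq0 /= (cocone_reach vP xx') (cocone_reach vP zz') => /eqP.
have /choice[w wP] : forall l, exists y, exists j x, u j x = l /\ v j x = y.
  by move=> l; have [j [x <-]] := uS l; exists (v j x), j, x.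
have wu j (x : X j) : w (u j x) = v j x.
  by have [k [z [e <-]]] := wP (u j x); apply: uv.
have wL : linear w.
  move=> a l m; have [j [x <-]] := uS l; have [k [z <-]] := uS m.
  have [x' xx'] := reach_ex x (leq_maxl j k).
  have [z' zz'] := reach_ex z (leq_maxr j k).
  rewrite -(cocone_reach uP xx') -(cocone_reach uP zz') -linearP.
  by rewrite !wu linearP.
pose wA := GRing.isLinear.Build R L N *:%R w wL.
pose W : {linear L -> N} := HB.pack w wA.
exists W; split=> // w' w'P l; have [j [x <-]] := uS l.
by rewrite w'P [RHS]wu.
Qed.

Section Elements.
Variables (L : lmodType R) (u : forall j, {linear X j -> L}).
Hypothesis uL : is_direct_limit t u.

(** The projection from L to its quotient by the union of the images and the zero
map both extend the zero cocone, hence are equal. *)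
Lemma direct_limit_surj l : exists j x, u j x = l.
Proof.
pose P : {pred L} := [pred m | `[< exists j x, u j x = m >]].
have Pc : submod_closed P.
  split; first by apply/asboolP; exists 0, 0; rewrite raddf0.
  move=> a m n /asboolP[j [x <-]] /asboolP[k [z <-]]; apply/asboolP.
  have [x' xx'] := reach_ex x (leq_maxl j k).
  have [z' zz'] := reach_ex z (leq_maxr j k).
  exists (maxn j k), (a *: x' + z'); rewrite linearP.
  by rewrite (cocone_reach uL.1 xx') (cocone_reach uL.1 zz').
have [//|w [_ wU]] := uL.2 (quot_mod Pc) (fun j => \0).
have : quot_mod_pi Pc l = 0.
  have -> : 0 = (\0 : {linear L -> quot_mod Pc}) l by [].
  rewrite (wU \0) // (wU (quot_mod_pi Pc)) // => j x.
  by apply/quot_mod_pi_eq0/asboolP; exists j, x.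
by move/quot_mod_pi_eq0/asboolP.
Qed.

(** The sequence that is 0 before stage j and consists of the successive images of
x from there on is built by recursion on the stage, with seq_at placing x. *)
Definition seq_at j n (x : X j) : X n :=
  if j =P n is ReflectT e then eq_rect j X x n e else 0.

Lemma seq_at_id j (x : X j) : seq_at j x = x.
Proof. by rewrite /seq_at; case: eqP => // e; rewrite (eq_irrelevance e erefl). Qed.

Lemma seq_at_linear j n : linear (@seq_at j n).
Proof.
move=> a x z; rewrite /seq_at; case: eqP => [e|_]; first by case: n / e.
by rewrite scaler0 addr0.
Qed.

Fixpoint seq_from j (x : X j) n : X n :=
  if n is n'.+1 then
    if j == n'.+1 then seq_at n'.+1 x else t n' (seq_from x n')
  else seq_at 0 x.

Lemma seq_from_linear j : linear (@seq_from j : X j -> seq_mod X).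
Proof.
move=> a x z; apply: functional_extensionality_dep => n.
rewrite -[RHS]/(a *: seq_from x n + seq_from z n); elim: n => [|n IHn] /=.
  by rewrite seq_at_linear.
by case: eqP => _; [rewrite seq_at_linear|rewrite IHn linearP].
Qed.

Lemma seq_from_id j (x : X j) : seq_from x j = x.
Proof. by case: j x => [|j] x /=; rewrite ?eqxx seq_at_id. Qed.

Lemma seq_fromS j (x : X j) n : (j <= n)%N -> seq_from x n.+1 = t n (seq_from x n).
Proof. by move=> jn /=; rewrite ltn_eqF. Qed.

Lemma reach_seq_from j (x : X j) n : (j <= n)%N -> reach x (seq_from x n).
Proof.
move=> jn; have [k ->] : exists k, n = (k + j)%N by exists (n - j)%N; rewrite subnK.
elim: k => [|k IHk].
  by rewrite seq_from_id; apply: reach0.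
by rewrite addSn seq_fromS ?leq_addl //; apply: reachS.
Qed.

(** The classes of the sequences of successive images modulo the eventually zero
sequences form a cocone, which factors through L. *)
Lemma direct_limit_zero j (x : X j) : u j x = 0 -> eventually_zero x.
Proof.
pose P : {pred seq_mod X} := [pred f | `[< exists n0, forall n, (n0 <= n)%N -> f n =
  0 >]].
have Pc : submod_closed P.
  split; first by apply/asboolP; exists 0.
  move=> a f g /asboolP[m fm] /asboolP[n gn]; apply/asboolP; exists (maxn m n) => k.
  rewrite geq_max => /andP[mk nk]; rewrite -[LHS]/(a *: f k + g k).
  by rewrite fm // gn // scaler0 addr0.
pose F k : {linear X k -> seq_mod X} :=
  HB.pack (@seq_from k : X k -> seq_mod X)
    (GRing.isLinear.Build R (X k) (seq_mod X) *:%R _ (@seq_from_linear k)).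
pose v k : {linear X k -> quot_mod Pc} := quot_mod_pi Pc \o F k.
have vP k (z : X k) : v k.+1 (t k z) = v k z.
  apply/quot_mod_pi_eq/asboolP; exists k.+1 => n kn.
  rewrite -[LHS]/(seq_from (t k z) n - seq_from z n); apply/eqP; rewrite subr_eq0;
    apply/eqP.
  have [m ->] : exists m, n = (m + k.+1)%N by exists (n - k.+1)%N; rewrite subnK.
  elim: m => [|m IHm].
    by rewrite seq_from_id seq_fromS // seq_from_id.
  by rewrite addSn !seq_fromS ?leq_addl ?IHm // -addSnnS leq_addl.
have [w [wP _]] := uL.2 _ v vP.
move=> ux; have : v j x = 0 by rewrite -wP ux raddf0.
move=> /quot_mod_pi_eq0/asboolP[n0 xn0].
have := reach_seq_from x (leq_maxl j n0); move/eventually_zero_reach; apply.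
have := xn0 _ (leq_maxr j n0); rewrite -[LHS]/(seq_from x _) => ->; exact:
  eventually_zero0.
Qed.
End Elements.
End System.

(** * Noetherian rings and finite generation of Koszul homology *)

Section Noetherian.
Variable R : comNzRingType.

Definition is_submod (M : lmodType R) (P : M -> Prop) : Prop :=
  P 0 /\ forall a x z, P x -> P z -> P (a *: x + z).

(** The span is encoded as the intersection of all submodules that contain s, so
that each use of it amounts to the choice of a submodule P. *)
Definition span_of (M : lmodType R) (s : seq M) (x : M) : Prop :=
  forall P : M -> Prop, is_submod P -> (forall g, g \in s -> P g) -> P x.

Definition noetherian_mod (M : lmodType R) : Prop :=
  forall P : M -> Prop, is_submod P ->
    exists s : seq M, (forall g, g \in s -> P g) /\ forall x, P x -> span_of s x.

Section Span.
Variable M : lmodType R.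
Implicit Types (s : seq M) (x z : M) (P : M -> Prop).

Lemma is_submodD P : is_submod P -> forall x z, P x -> P z -> P (x + z).
Proof. by move=> [_ PZ] x z Px Pz; rewrite -[x]scale1r; apply: PZ. Qed.

Lemma is_submodZ P : is_submod P -> forall a x, P x -> P (a *: x).
Proof. by move=> [P0 PZ] a x Px; rewrite -[_ *: _]addr0; apply: PZ. Qed.

Lemma is_submodB P : is_submod P -> forall x z, P x -> P z -> P (x - z).
Proof.
move=> sP x z Px Pz; apply: is_submodD => //; rewrite -scaleN1r; exact: is_submodZ.
Qed.

Lemma is_submod_sum P : is_submod P -> forall (I : Type) (r : seq I) (F : I -> M),
  (forall i, P (F i)) -> P (\sum_(i <- r) F i).
Proof.
by move=> sP I r F PF; apply: big_ind => //; [exact: sP.1|exact: is_submodD].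
Qed.

Lemma span_submod s : is_submod (span_of s).
Proof.
split=> [P sP _|a x z hx hz P sP Ps]; first exact: sP.1.
by apply: sP.2; [apply: hx|apply: hz].
Qed.

Lemma span_gen s g : g \in s -> span_of s g.
Proof. by move=> gs P _; apply. Qed.

Lemma span_sub s s' x : {subset s <= s'} -> span_of s x -> span_of s' x.
Proof. by move=> ss; apply; [apply: span_submod|move=> g /ss; apply: span_gen]. Qed.

Lemma span_cons g s x :
  span_of (g :: s) x -> exists c z, x = c *: g + z /\ span_of s z.
Proof.
move=> sx; pattern x; apply: sx; first split.
- by exists 0, 0; rewrite scale0r addr0; split=> //; apply: (span_submod s).1.
- move=> a _ _ [c [z [-> zs]]] [c' [z' [-> zs']]].
  exists (a * c + c'), (a *: z + z'); split; last exact: (span_submod s).2.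
  by rewrite scalerDr scalerDl scalerA addrACA.
- move=> h; rewrite inE => /orP[/eqP->|hs].
    exists 1, 0; rewrite scale1r addr0; split=> //; exact: (span_submod s).1.
  by exists 0, h; rewrite scale0r add0r; split=> //; apply: span_gen.
Qed.

Lemma span_coef s x :
  span_of s x -> exists c : 'I_(size s) -> R, x = \sum_i c i *: s`_i.
Proof.
move=> sx; pattern x; apply: sx; first split.
- by exists (fun=> 0); rewrite big1 // => i _; rewrite scale0r.
- move=> a _ _ [c ->] [c' ->]; exists (fun i => a * c i + c' i).
  by rewrite scaler_sumr -big_split; apply: eq_bigr => i _; rewrite scalerDl scalerA.
- move=> g gs; have gi : (index g s < size s)%N by rewrite index_mem.
  exists (fun i => (i == Ordinal gi)%:R); rewrite (bigD1 (Ordinal gi)) //= eqxx scale1r.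
  by rewrite nth_index // big1 ?addr0 // => i /negPf->; rewrite scale0r.
Qed.

Lemma span_fin_gen s : (forall x, span_of s x) -> fin_gen M.
Proof.
by move=> sM; exists (size s), (fun i => s`_i) => x; apply: span_coef.
Qed.

Lemma fin_gen_span : fin_gen M -> exists s, forall x, span_of s x.
Proof.
move=> [n [g gP]]; exists [seq g i | i : 'I_n] => x; have [c ->] := gP x.
apply: (is_submod_sum (span_submod _)) => i; apply: (is_submodZ (span_submod _)).
by apply: span_gen; apply/mapP; exists i; rewrite ?mem_enum.
Qed.

End Span.

(** Induction on a generating sequence g :: s': the coefficients of g in the
elements of P form an ideal J, and what lies in P and in the span of s' is
finitely generated by induction. *)
Lemma noetherian_fin_gen (M : lmodType R) :
  noetherian_mod (R^o : lmodType R) -> fin_gen M -> noetherian_mod M.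
Proof.
move=> nR /fin_gen_span[s sM].
suff K (s' : seq M) : forall P : M -> Prop, is_submod P -> (forall x, P x -> span_of
  s' x) ->
    exists t : seq M, (forall g, g \in t -> P g) /\ forall x, P x -> span_of t x.
  by move=> P sP; apply: (K s).
elim: s' => [|g s' IHs] P sP Ps.
  by exists [::].
pose J (a : R^o) := exists x, span_of s' x /\ P (a *: g + x).
have sJ : is_submod J.
  split; first by exists 0; rewrite scale0r addr0; split; [apply: (span_submod
    s').1|apply: sP.1].
  move=> a b c [x [xs Px]] [z [zs Pz]]; exists (a *: x + z); split.
    exact: (span_submod s').2.
  rewrite scalerDl -scalerA addrACA -scalerDr; exact: sP.2.
have [as_ [asJ Jas]] := nR J sJ.
have /choice[f fP] : forall a, exists x, J a -> span_of s' x /\ P (a *: g + x).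
  move=> a; case: (pselect (J a)) => [[x xP]|nJ]; first by exists x.
  by exists 0.
have [||t [tP Pt]] := IHs (fun x => P x /\ span_of s' x).
- split; first by split; [apply: sP.1|apply: (span_submod s').1].
  move=> a x z [Px xs] [Pz zs]; split; [exact: sP.2|exact: (span_submod s').2].
- by move=> x [].
pose G := [seq a *: g + f a | a : R <- as_].
have GP x : x \in G -> P x by move=> /mapP[a /asJ/fP[_ Pa] ->].
exists (G ++ t); split=> [x|x Px]; first by rewrite mem_cat => /orP[/GP|/tP[]].
have [c [x0 [ex x0s]]] := span_cons (Ps x Px).
have : span_of (M := R^o) as_ c by apply: Jas; exists x0; rewrite -ex.
move=> /(_ (fun c => exists x1, span_of s' x1 /\ span_of G (c *: g + x1))) [].
- split; first by exists 0; rewrite scale0r addr0;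
    split; [apply: (span_submod s').1|apply: (span_submod G).1].
  move=> a b b' [x1 [x1s x1G]] [z1 [z1s z1G]]; exists (a *: x1 + z1); split.
    exact: (span_submod s').2.
  rewrite scalerDl -scalerA addrACA -scalerDr; exact: (span_submod G).2.
- move=> a /[dup] aas /asJ/fP[fs _]; exists (f a); split=> //.
  by apply: span_gen; apply/mapP; exists a.
move=> x1 [x1s x1G].
have Px1 : P (c *: g + x1) by apply: x1G.
have : span_of t (x - (c *: g + x1)).
  apply: Pt; split; first exact: is_submodB.
  rewrite ex opprD addrACA subrr add0r; exact: (is_submodB (span_submod _)).
move=> xt; rewrite -[x](subrK (c *: g + x1)); apply: (is_submodD (span_submod _)).
- by apply: span_sub xt => z zt; rewrite mem_cat zt orbT.
- by apply: span_sub x1G => z zt; rewrite mem_cat zt.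
Qed.

End Noetherian.

Section KoszulDelta.
Variables (R : comNzRingType) (r : nat) (M : lmodType R).

Definition koszul_delta (T : {set 'I_r}) (v : M) : koszul r M :=
  [ffun S => if S == T then v else 0].

Fact koszul_delta_linear T : linear (koszul_delta T).
Proof.
by move=> a x z; apply/ffunP => S; rewrite !ffunE; case: ifP; rewrite // scaler0 addr0.
Qed.

HB.instance Definition _ T :=
  GRing.isLinear.Build R M (koszul r M) *:%R (koszul_delta T) (koszul_delta_linear T).

Lemma koszul_deltaE (x : koszul r M) : x = \sum_T koszul_delta T (x T).
Proof.
apply/ffunP => S; rewrite sum_ffunE (bigD1 S) //= ffunE eqxx big1 ?addr0 // => T.
by rewrite eq_sym ffunE => /negPf->.
Qed.

Lemma koszul_fin_gen : fin_gen M -> fin_gen (koszul r M).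
Proof.
move=> /fin_gen_span[s sM].
apply: (@span_fin_gen _ _ (flatten [seq [seq koszul_delta T g | g <- s] | T : {set
  'I_r}])).
move=> x; rewrite [x]koszul_deltaE; apply: (is_submod_sum (span_submod _)) => T.
pattern (x T); apply: (sM (x T)) => [|g gs].
  split; first by rewrite raddf0; apply: (span_submod _).1.
  by move=> a u v hu hv; rewrite linearP; apply: (span_submod _).2.
apply: span_gen; apply/flatten_mapP; exists T; first by rewrite mem_enum.
exact: map_f.
Qed.

(** The cycles are a submodule of a finitely generated R-module, and R acts on
their classes through its quotient by the y_j. *)
Lemma koszul_homology_fin_gen (y : 'I_r -> R) (yP : proper_seq y) i :
  noetherian_mod (R^o : lmodType R) -> fin_gen M -> fin_gen (koszul_homology yP M i).
Proof.
move=> nR /koszul_fin_gen/(noetherian_fin_gen nR)nK.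
have [|s [sP Ps]] := nK (fun x => x \in koszul_cycles y i).
  split=> [|a x z]; first exact: rpred0.
  by move=> hx hz; apply: rpredD => //; apply: rpredZ.
pose hs : seq (koszul_homology yP M i) :=
  [seq koszul_class yP (insubd (0 : koszul_cycle y M i) x) | x <- s].
apply: (@span_fin_gen _ _ hs) => h; rewrite -[h]koszul_reprK.
set c := koszul_repr h; have := Ps _ (koszul_cycleP c).
move=> /(_ (fun x => x \in koszul_cycles y i /\
   forall c : koszul_cycle y M i, koszul_cycle_val c = x ->
     span_of hs (koszul_class yP c))) [] //.
- split; first split; first exact: rpred0.
    move=> c0 e; rewrite (_ : c0 = 0) ?raddf0; last exact: val_inj.
    exact: (span_submod hs).1.
  move=> a u v [uc hu] [vc hv]; split; first by apply: rpredD => //; apply: rpredZ.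
  move=> c0 e; have -> : c0 = a *: KoszulCycle uc + KoszulCycle vc by apply: val_inj.
  rewrite raddfD /= -koszul_classZ; apply: (span_submod hs).2; first exact: hu.
  exact: hv.
- move=> g gs; split; first exact: sP.
  move=> c0 e; apply: span_gen; apply/mapP; exists g => //; congr koszul_class.
  by rewrite -e valKd.
- by move=> _; apply.
Qed.

End KoszulDelta.

(** * Koszul homology of Frobenius-finite modules *)

Section HomologyLimit.
Variables (R : comNzRingType) (r : nat) (y : 'I_r -> R) (yP : proper_seq y).
Variable i : nat.

Section KoszulMapLinear.
Variables (M N : lmodType R) (f : {linear M -> N}).

Fact koszul_map_linear : linear (koszul_map (r := r) f).
Proof. by move=> a x z; apply/ffunP => T; rewrite !ffunE linearP. Qed.

HB.instance Definition _ := GRing.isLinear.Build R (koszul r M) (koszul r N)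
  *:%R (koszul_map (r := r) f) koszul_map_linear.
End KoszulMapLinear.

Variable X : nat -> lmodType R.
Variable t : forall j, {linear X j -> X j.+1}.

Let KX j : lmodType R := koszul r (X j).
Let Kt j : {linear KX j -> KX j.+1} := koszul_map (r := r) (t j).
Let HX j : lmodType (quot_seq yP) := koszul_homology yP (X j) i.
Let Ht j : {linear HX j -> HX j.+1} := homology_map yP i (t j).

Lemma koszul_eventually_zero j (x : KX j) : (forall T, eventually_zero t (x T)) ->
  eventually_zero Kt x.
Proof.
move=> dx; rewrite [x]koszul_deltaE; apply: eventually_zero_sum => T.
move: (dx T); elim=> [k|k v _ IH]; first by rewrite raddf0; apply: eventually_zero0.
apply: eventually_zeroS; rewrite (_ : Kt _ _ = koszul_delta T (t k v)) //.
by apply/ffunP => S; rewrite !ffunE; case: ifP; rewrite ?raddf0.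
Qed.

Lemma homology_eventually_zero j (x : KX j) : eventually_zero Kt x ->
  forall (c : koszul_cycle y (X j) i) z,
  koszul_deg i.+1 z -> koszul_cycle_val c = koszul_diff y z + x ->
  eventually_zero Ht (koszul_class yP c : HX j).
Proof.
elim=> [k|k v _ IH] c z zi cz.
  rewrite (_ : koszul_class yP c = 0); first exact: eventually_zero0.
  by apply/koszul_class_eq0/koszul_boundingP; exists z; rewrite cz addr0.
apply: eventually_zeroS; rewrite [Ht k _]homology_mapE; apply: (IH _ (koszul_map (t
  k) z)).
  exact: koszul_map_deg.
by rewrite koszul_diff_linear /= cz linearD.
Qed.

Variables (L : lmodType R) (u : forall j, {linear X j -> L}).
Hypothesis uL : is_direct_limit t u.

Let uP := uL.1.

(** A chain has finitely many components, so they all come from a common stage.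
Zero components are lifted to zero, which preserves degrees. *)
Lemma koszul_lift (z : koszul r L) : exists J, forall j, (J <= j)%N ->
  exists x : KX j, koszul_map (u j) x = z /\ forall T, z T = 0 -> x T = 0.
Proof.
have /choice[J JP] : forall T, exists J, forall j, (J <= j)%N -> exists x : X j, u j
  x = z T.
  move=> T; have [J [x <-]] := direct_limit_surj uL (z T); exists J => j Jj.
  by have [x' xx'] := reach_ex t x Jj; exists x'; apply: (cocone_reach uP xx').
exists (\max_T J T) => j Jj.
have /choice[x xP] : forall T, exists x : X j, u j x = z T /\ (z T = 0 -> x = 0).
  move=> T; case: (eqVneq (z T) 0) => [e|nz]; first by exists 0; rewrite raddf0.
  have [|x xz] := JP T j; first exact: leq_trans (leq_bigmax T) Jj.
  by exists x; split=> // e; rewrite e eqxx in nz.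
exists [ffun T => x T]; split=> [|T zT]; last by rewrite ffunE (xP T).2.
by apply/ffunP => T; rewrite !ffunE (xP T).1.
Qed.

Lemma koszul_lift_deg k (z : koszul r L) : koszul_deg k z ->
  exists J, forall j, (J <= j)%N ->
  exists x : KX j, koszul_map (u j) x = z /\ koszul_deg k x.
Proof.
move=> /koszul_degP zk; have [J JP] := koszul_lift z; exists J => j /JP[x [xz x0]].
by exists x; split=> //; apply/koszul_degP => S /zk/x0.
Qed.

(** A chain whose differential vanishes at a later stage is a cycle there. *)
Lemma koszul_cycle_later j (w : KX j) : eventually_zero Kt w ->
  forall x : KX j, w = koszul_diff y x -> koszul_deg i x ->
  exists k (c : koszul_cycle y (X k) i),
    koszul_map (u k) (koszul_cycle_val c) = koszul_map (u j) x.
Proof.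
elim=> [k|k v _ IH] x vx xi.
  by exists k, (KoszulCycle (koszul_cycle_mem xi (esym vx))).
have [||l [c cx]] := IH (koszul_map (t k) x).
- by rewrite koszul_diff_linear /= vx.
- exact: koszul_map_deg.
by exists l, c; rewrite cx; apply/ffunP => T; rewrite !ffunE uP.
Qed.

Lemma koszul_map_eventually_zero j (x : KX j) : koszul_map (u j) x = 0 ->
  eventually_zero Kt x.
Proof.
move=> ux; apply: koszul_eventually_zero => T; apply: (direct_limit_zero uL).
by have := congr1 (fun f : koszul r L => f T) ux; rewrite !ffunE.
Qed.

Lemma homology_limit_surj (h : koszul_homology yP L i) :
  exists j (g : HX j), homology_map yP i (u j) g = h.
Proof.
pose c := koszul_repr h.
have [j /(_ j (leqnn j))[x [xc xi]]] := koszul_lift_deg (koszul_cycle_deg c).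
have dx : eventually_zero Kt (koszul_diff y x).
  apply: koszul_map_eventually_zero; rewrite -koszul_diff_linear xc; exact:
    koszul_cycle_diff.
have [k [e ex]] := koszul_cycle_later dx erefl xi.
exists k, (koszul_class yP e); rewrite homology_mapE -[h]koszul_reprK -/c.
by congr (koszul_class yP _); apply: val_inj; rewrite /= ex.
Qed.

Lemma homology_limit_zero j (h : HX j) : homology_map yP i (u j) h = 0 ->
  eventually_zero Ht h.
Proof.
rewrite -[h]koszul_reprK homology_mapE; move: (koszul_repr h) => c {h}.
move=> /koszul_class_eq0/koszul_boundingP[z [zi cz]].
have [J JP] := koszul_lift_deg zi.
(* z lifts to stage n + j; induction on n moves c up to the stage of the lift *)
have {J JP} [n nP] : exists n, exists x : KX (n + j)%N,
    koszul_map (u (n + j)%N) x = z /\ koszul_deg i.+1 x.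
  by exists J; apply: JP; rewrite leq_addr.
elim: n j c cz nP => [|n IHn] j c cz [x [xz xi]].
  apply: (@homology_eventually_zero _ (koszul_cycle_val c - koszul_diff y x) _ _ x)
    => //.
    apply: koszul_map_eventually_zero; rewrite raddfB /= -koszul_diff_linear xz -cz
      subrr.
    by [].
  by rewrite addrC subrK.
apply: eventually_zeroS; rewrite [Ht j _]homology_mapE; apply: IHn; last first.
  by rewrite addnS; exists x.
by rewrite -cz; apply/ffunP => T; rewrite /= !ffunE uP.
Qed.

End HomologyLimit.

Section Main.
Variables (p : nat) (R : comNzRingType) (r : nat) (y : 'I_r -> R) (yP : proper_seq y).
Variable kap : 'I_r -> {additive R -> R}.
Hypothesis p_gt0 : (0 < p)%N.
Hypothesis kapC : forall (j l : 'I_r) x, l != j -> kap j (y l * x) = y l * kap j x.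
Hypothesis kapP : forall j a x, kap j (a ^+ p * x) = a ^+ p * kap j x.
Hypothesis kapE : forall j x,
  \sum_(e < p) y j ^+ e * kap j (y j ^+ (p.-1 - e) * x) = x.
Hypothesis trR : cartier_trace p R.
Variable i : nat.
Local Notation B := (quot_seq yP).
Local Notation H M := (koszul_homology yP M i : lmodType B).

Lemma frob_map_bij (A : comNzRingType) (M N : lmodType A) (f : {linear M -> N}) :
  bijective f -> bijective (@frob_map p A M N f).
Proof.
move=> /linear_bij_inv[g [fK gK]]; exists (frob_map g) => x.
  by rewrite -frob_map_comp frob_map_id.
by rewrite -frob_map_comp frob_map_id.
Qed.

Lemma homology_map_comp (M N L : lmodType R) (f : {linear M -> N}) (g : {linear N ->
  L}) h :
  homology_map yP i (g \o f) h = homology_map yP i g (homology_map yP i f h).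
Proof.
rewrite -[h]koszul_reprK !homology_mapE; congr (koszul_class yP _).
by apply/val_inj/ffunP => T; rewrite /= !ffunE.
Qed.

Lemma homology_map_eq (M N : lmodType R) (f g : {linear M -> N}) h : f =1 g ->
  homology_map yP i f h = homology_map yP i g h.
Proof.
move=> fg; rewrite -[h]koszul_reprK !homology_mapE; congr (koszul_class yP _).
by apply/val_inj/ffunP => T; rewrite /= !ffunE.
Qed.

Lemma homology_map_id (M : lmodType R) (f : {linear M -> M}) h :
  f =1 id -> homology_map yP i f h = h.
Proof.
move=> fg; rewrite -[h]koszul_reprK !homology_mapE; congr (koszul_class yP _).
by apply/val_inj/ffunP => T; rewrite /= !ffunE.
Qed.

Lemma homology_map_bij (M N : lmodType R) (f : {linear M -> N}) :
  bijective f -> bijective (homology_map yP i f).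
Proof.
move=> /linear_bij_inv[g [fK gK]]; exists (homology_map yP i g) => x.
  by rewrite -homology_map_comp homology_map_id.
by rewrite -homology_map_comp homology_map_id.
Qed.

Let frob_homology_inv (M : lmodType R) := @linear_bij_inv _ (frob p (H M)) (H (frob p
  M))
  (frob_homology yP p_gt0 i M) (frob_homology_bij yP p_gt0 kapC kapP kapE trR i M).

Variables (N : lmodType R) (b : {linear N -> frob p N}).

(** These maps identify the direct system F_B^j(H(N)) with the system
H(F_R^j(N)). *)
Fixpoint frob_iter_homology j : {linear frob_iter p (H N) j -> H (frob_iter p N j)} :=
  if j is j'.+1 then frob_homology yP p_gt0 i (frob_iter p N j') \o frob_map
    (frob_iter_homology j')
  else idfun.

Definition homology_structure (M : lmodType R) (f : {linear M -> frob p M}) :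
  {linear H M -> frob p (H M)} := sval (frob_homology_inv M) \o homology_map yP i f.

Lemma frob_homology_structure (M : lmodType R) (f : {linear M -> frob p M}) h :
  frob_homology yP p_gt0 i M (homology_structure f h) = homology_map yP i f h.
Proof. exact: (svalP (frob_homology_inv M)).2. Qed.

Lemma frob_iter_homology_bij j : bijective (frob_iter_homology j).
Proof.
elim: j => [|j IHj] /=; first by exists id.
apply: bij_comp; last exact: frob_map_bij.
exact: (frob_homology_bij yP p_gt0 kapC kapP kapE trR).
Qed.

Lemma frob_iter_homology_map j x :
  frob_iter_homology j.+1 (frob_iter_map (homology_structure b) j x) =
  homology_map yP i (frob_iter_map b j) (frob_iter_homology j x).
Proof.
elim: j x => [|j IHj] x.
  rewrite /= frob_map_id //; exact: frob_homology_structure.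
rewrite -[LHS]/(frob_homology yP p_gt0 i _ (frob_map (frob_iter_homology j.+1)
  (frob_map (frob_iter_map (homology_structure b) j) x))).
rewrite -frob_map_comp.
rewrite (@frob_map_eq _ _ _ _ _ (homology_map yP i (frob_iter_map b j) \o
  frob_iter_homology j)) //.
by rewrite frob_map_comp frob_homology_natural.
Qed.

End Main.

Theorem koszul_frob_finite (p : nat) (R : comNzRingType) (r : nat) (y : 'I_r -> R)
    (yP : proper_seq y) (kap : 'I_r -> {additive R -> R}) :
  (0 < p)%N ->
  (forall (j l : 'I_r) x, l != j -> kap j (y l * x) = y l * kap j x) ->
  (forall j a x, kap j (a ^+ p * x) = a ^+ p * kap j x) ->
  (forall j x, \sum_(e < p) y j ^+ e * kap j (y j ^+ (p.-1 - e) * x) = x) ->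
  cartier_trace p R -> noetherian_mod (R^o : lmodType R) ->
  forall (i : nat) (M : lmodType R),
  frob_finite p M -> frob_finite p (koszul_homology yP M i).
Proof.
move=> p_gt0 kapC kapP kapE trR nR i M [th [thP [N [b [u [fgN uL uth]]]]]].
pose hf M := @homology_structure p R r y yP kap p_gt0 kapC kapP kapE trR i M.
pose psis := @frob_iter_homology p R r y yP p_gt0 i N.
have hfE (M' : lmodType R) (f : {linear M' -> frob p M'}) h :
    frob_homology yP p_gt0 i M' (hf M' f h) = homology_map yP i f h.
  exact: frob_homology_structure.
have psisB j : bijective (psis j) by exact: (@frob_iter_homology_bij p R r y yP kap
  p_gt0 kapC kapP kapE trR i N j).
have psisE j x : psis j.+1 (frob_iter_map (hf N b) j x) =
    homology_map yP i (frob_iter_map b j) (psis j x) by exact: frob_iter_homology_map.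
have hthP : bijective (hf M th).
  have [g' gK' g'K] := frob_homology_bij yP p_gt0 kapC kapP kapE trR i M.
  have [g gK gK2] := homology_map_bij yP i thP.
  exists (g \o frob_homology yP p_gt0 i M) => x; rewrite /= ?hfE ?gK //.
  by apply: (can_inj gK'); rewrite hfE gK2.
exists (hf M th), hthP, (koszul_homology yP N i), (hf N b).
exists (fun j => homology_map yP i (u j) \o psis j).
split; first exact: koszul_homology_fin_gen.
- apply: direct_limit_intro => [j x|h|j x].
  + rewrite -[LHS]/(homology_map yP i (u j.+1) (psis j.+1 _)) psisE.
    by rewrite -homology_map_comp; apply: homology_map_eq => z /=; apply: uL.1.
  + have [j [g <-]] := homology_limit_surj uL h.
    by have [f _ fK] := psisB j; exists j, (f g); rewrite /= fK.
  + move=> /= /(homology_limit_zero uL).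
    move e: (psis j x) => h dh; elim: dh x e => [k|k v _ IH] x.
      rewrite -(raddf0 (psis k)) => /(bij_inj (psisB k)) ->; exact: eventually_zero0.
    by move=> e; apply/eventually_zeroS/IH; rewrite psisE e.
- move=> j x; apply: (bij_inj (frob_homology_bij yP p_gt0 kapC kapP kapE trR i M)).
  rewrite hfE frob_map_comp frob_homology_natural -[frob_homology _ _ _ _ _]/(psis
    j.+1 _) psisE.
  rewrite -!homology_map_comp; apply: homology_map_eq => z /=; exact: uth.
Qed.

(** * Coefficients of products and p-th powers *)

Section FrobeniusSum.
Variables (p : nat) (A : comNzRingType).
Hypothesis pA : p \in [pchar A].

Lemma frobenius_sum (I : Type) (s : seq I) (P : pred I) (F : I -> A) :
  (\sum_(i <- s | P i) F i) ^+ p = \sum_(i <- s | P i) F i ^+ p.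
Proof.
rewrite -(pFrobenius_autE pA) rmorph_sum; apply: eq_bigr => i _.
by rewrite /= pFrobenius_autE.
Qed.

Lemma pchar_gt0 : (0 < p)%N.
Proof. by move: pA; rewrite inE => /andP[/prime_gt0]. Qed.

End FrobeniusSum.

Section CoefConv.
Variables (n : nat) (A : comNzRingType).
Implicit Types (f g : 'X_{1..n} -> A) (m : 'X_{1..n}).

(** The functions shift_coef, conv and frob_conv give the coefficients of X^c f,
f g and f^p g in terms of those of f and g. The sums in conv and frob_conv
stop at degree N, as f may be a power series. *)
Definition shift_coef c f m : A := if (c <= m)%MM then f (m - c)%MM else 0.

Definition conv N f g m : A := \sum_(b : 'X_{1..n < N}) f b * shift_coef b g m.

Definition frob_conv p N f g m : A :=
  \sum_(b : 'X_{1..n < N}) f b ^+ p * shift_coef (b *+ p)%MM g m.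

Lemma mcoeffXM c (f : {mpoly A[n]}) m :
  ('X_[c] * f)@_m = shift_coef c (fun m' => f@_m') m.
Proof.
rewrite /shift_coef; case: ifPn => cm; first by rewrite mulrC -[m in LHS](submK cm)
  addmC mcoeffMX.
rewrite mulrC; apply: memN_msupp_eq0; apply/negP.
rewrite (perm_mem (msuppMX _ _)) => /mapP[m' _ e].
by move/negP: cm; apply; rewrite e lem_addr.
Qed.

Lemma mcoeff_conv N (a f : {mpoly A[n]}) m : (msize a <= N)%N ->
  (a * f)@_m = conv N (fun m' => a@_m') (fun m' => f@_m') m.
Proof.
move=> aN; rewrite {1}(mpolywE aN) mulr_suml raddf_sum; apply: eq_bigr => b _ /=.
by rewrite -scalerAl mcoeffZ mcoeffXM.
Qed.

Lemma mcoeff_frob_conv p N (a f : {mpoly A[n]}) m :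
  p \in [pchar A] -> (msize a <= N)%N ->
  (a ^+ p * f)@_m = frob_conv p N (fun m' => a@_m') (fun m' => f@_m') m.
Proof.
move=> pA aN.
have pAn : p \in [pchar {mpoly A[n]}].
  exact: (rmorph_pchar (@mpolyC n A)).
rewrite {1}(mpolywE aN) (frobenius_sum pAn) mulr_suml raddf_sum.
apply: eq_bigr => b _ /=.
by rewrite exprZn mpolyXn -scalerAl mcoeffZ mcoeffXM.
Qed.

Lemma msize_mstrunc N (f : mseries n A) : (msize (mstrunc N f) <= N)%N.
Proof.
apply: (leq_trans (mmeasure_sum _ _ _ _)); apply/bigmax_leqP => b _.
by rewrite (leq_trans (mmeasureZ_le _ _ _)) // mmeasureX bmdeg.
Qed.

Lemma mscoef_conv N (a f : mseries n A) m : (mdeg m < N)%N ->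
  mscoef (a * f) m = conv N (mscoef a) (mscoef f) m.
Proof.
move=> mN; rewrite [LHS](mscoefM _ _ mN) (mcoeff_conv _ _ (msize_mstrunc N a)).
apply: eq_bigr => b _; rewrite mcoeff_mstrunc ?bmdeg // /shift_coef; case: ifP => // _.
by rewrite mcoeff_mstrunc // (leq_ltn_trans (mdegB _ _) mN).
Qed.

(** Coefficients up to degree N only depend on truncations, so that identities
between coefficients of series follow from those for polynomials. *)
Lemma mscoefX N (a : mseries n A) k m : (mdeg m < N)%N ->
  mscoef (a ^+ k) m = (mstrunc N a ^+ k)@_m.
Proof.
elim: k m => [|k IHk] m mN.
  by rewrite !expr0 mcoeff1 [LHS]/=; case: (_ == _).
rewrite !exprS [LHS](mscoefM _ _ mN); apply: mcoeffM_eq => // m' m'm.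
by rewrite mcoeff_mstrunc ?IHk // (leq_ltn_trans m'm mN).
Qed.

Lemma mscoef_frob_conv p N (a f : mseries n A) m :
  p \in [pchar A] -> (mdeg m < N)%N ->
  mscoef (a ^+ p * f) m = frob_conv p N (mscoef a) (mscoef f) m.
Proof.
move=> pA mN; rewrite [LHS](mscoefM _ _ mN).
transitivity ((mstrunc N a ^+ p * mstrunc N f)@_m).
  apply: mcoeffM_eq => // m' m'm; have m'N := leq_ltn_trans m'm mN.
  by rewrite mcoeff_mstrunc // (mscoefX _ _ m'N).
rewrite (mcoeff_frob_conv _ _ pA (msize_mstrunc N a)).
apply: eq_bigr => b _; rewrite mcoeff_mstrunc ?bmdeg // /shift_coef; case: ifP => // _.
by rewrite mcoeff_mstrunc // (leq_ltn_trans (mdegB _ _) mN).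
Qed.

Definition msmono c : mseries n A := MSeries (fun m => (m == c)%:R).

Lemma mscoefXM c (f : mseries n A) m :
  mscoef (msmono c * f) m = shift_coef c (mscoef f) m.
Proof.
pose N := (maxn (mdeg m) (mdeg c)).+1.
have mN : (mdeg m < N)%N by rewrite ltnS leq_maxl.
have cN : (mdeg c < N)%N by rewrite ltnS leq_maxr.
rewrite (mscoef_conv _ _ mN) /conv (bigD1 (BMultinom cN)) //= eqxx mul1r big1 ?addr0
  // => b.
by rewrite bmeqP /= => /negPf->; rewrite mul0r.
Qed.

Lemma msmonoD c c' : msmono (c + c')%MM = msmono c * msmono c'.
Proof.
apply: mseriesP => m; rewrite mscoefXM /shift_coef /=; case: ifPn => cm.
  congr (_%:R); rewrite -[m in LHS](submK cm) addmC eqm_add2l.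
  by case: (_ == _).
case: eqP => // e; by rewrite e lem_addr in cm.
Qed.

Lemma msmonoMn c k : msmono (c *+ k)%MM = msmono c ^+ k.
Proof.
elim: k => [|k IHk]; last by rewrite mulmS msmonoD IHk exprS.
by apply: mseriesP => m /=; case: (m == _).
Qed.

Lemma msvar_mono (i : 'I_n) : msvar A i = msmono U_(i)%MM.
Proof. by apply: mseriesP => m /=; case: (_ == _). Qed.

Section Kap.
Variable p : nat.
Hypothesis p_gt0 : (0 < p)%N.
Variable j : 'I_n.

(** If f is the sum of the X_j^e f_e for 0 <= e < p, where the exponent of X_j in
the terms of f_e is divisible by p, then these are the coefficients of
f_(p-1). *)
Definition kap_coef f m : A := if (p %| m j)%N then f (m + U_(j) *+ p.-1)%MM else 0.

Lemma kap_coef_frob_conv N f g m : kap_coef (frob_conv p N f g) m = frob_conv p N f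
  (kap_coef g) m.
Proof.
rewrite /kap_coef /frob_conv /shift_coef; case: (boolP (p %| m j)%N) => pm; last first.
  rewrite big1 // => b _; case: ifP => bm; last by rewrite mulr0.
  rewrite mnmBE mulmnE dvdn_subl ?(negPf pm) ?mulr0 ?dvdn_mull //.
  by have := mnm_lepP bm j; rewrite mulmnE.
apply: eq_bigr => b _; congr (_ * _).
have -> : (b *+ p <= m + U_(j) *+ p.-1)%MM = (b *+ p <= m)%MM.
  apply/mnm_lepP/mnm_lepP => h i; move: (h i); rewrite mnmDE !mulmnE mnm1E.
    case: eqP => [<-|_]; last by rewrite addn0.
    rewrite mul1n => hj; rewrite leqNgt; apply/negP => ltj.
    move: pm => /dvdnP[q qE]; rewrite qE in hj ltj.
    rewrite ltn_pmul2r // in ltj.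
    have : (q.+1 * p <= q * p + p.-1)%N by apply: leq_trans hj; rewrite leq_mul2r ltj
      orbT.
    by rewrite mulSn addnC leq_add2l leqNgt prednK // leqnn.
  by move=> /leq_trans; apply; rewrite leq_addr.
case: ifP => bm //.
rewrite mnmBE mulmnE dvdn_subl ?pm ?dvdn_mull //; last first.
  by have := mnm_lepP bm j; rewrite mulmnE.
congr g; apply/mnmP => i; rewrite !(mnmDE, mnmBE, mulmnE).
by rewrite addnBAC //; have := mnm_lepP bm i; rewrite mulmnE.
Qed.

Lemma kap_coef_shift (l : 'I_n) f m : l != j ->
  kap_coef (shift_coef U_(l)%MM f) m = shift_coef U_(l)%MM (kap_coef f) m.
Proof.
move=> lj; rewrite /kap_coef /shift_coef.
have -> : (U_(l) <= m + U_(j) *+ p.-1)%MM = (U_(l) <= m)%MM.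
  by rewrite !lep1mP mnmDE mulmnE mnm1E [j == l]eq_sym (negPf lj) addn0.
have -> : (m - U_(l))%MM j = m j by rewrite mnmBE mnm1E (negPf lj) subn0.
case: ifP; case: ifP => // lm _; congr f; apply/mnmP => i.
rewrite !(mnmDE, mnmBE, mulmnE) addnBAC //; exact: (mnm_lepP lm).
Qed.

(** Multiplication by X_j^(p-1-e) moves f_e to the position p - 1; at the monomial
m only e = m_j mod p contributes. *)
Lemma kap_coef_sum f m :
  \sum_(e < p) shift_coef (U_(j) *+ e)%MM (kap_coef (shift_coef (U_(j) *+ (p.-1 -
    e))%MM f)) m = f m.
Proof.
have em : (m j %% p < p)%N by rewrite ltn_mod.
rewrite (bigD1 (Ordinal em)) //= big1 ?addr0 => [|e].
  rewrite /shift_coef /kap_coef.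
  have le1 : (U_(j) *+ (m j %% p) <= m)%MM.
    apply/mnm_lepP => i; rewrite mulmnE mnm1E; case: eqP => [<-|_] //.
    by rewrite mul1n leq_mod.
  rewrite le1 mnmBE mulmnE mnm1E eqxx mul1n -{1}(modn_mod (m j) p).
  have -> : (p %| m j - m j %% p %% p)%N.
    by rewrite modn_mod {1}(divn_eq (m j) p) addnK dvdn_mull.
  have -> : (U_(j) *+ (p.-1 - m j %% p) <= m - U_(j) *+ (m j %% p) + U_(j) *+ p.-1)%MM.
    apply/mnm_lepP => i; rewrite !(mnmDE, mulmnE) mnm1E; case: eqP => // _.
    by rewrite !mul1n (leq_trans (leq_subr _ _)) // leq_addl.
  congr f; apply/mnmP => i; rewrite !(mnmBE, mnmDE, mulmnE) mnm1E.
  case: eqP => [<-|_]; last by rewrite !mul0n subn0 addn0 subn0.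
  have qP : (m j %% p <= p.-1)%N by rewrite -ltnS prednK.
  rewrite !mul1n; move: (m j) (m j %% p)%N (leq_mod (m j) p) qP => a q qa qP.
  by rewrite (subnBA _ qP) addnAC subnK // addnK.
rewrite -val_eqE /= => ne; rewrite /shift_coef /kap_coef; case: ifP => // le1.
case: ifP => // pd; case/negP: ne; move: pd.
have ej : (e <= m j)%N by have := mnm_lepP le1 j; rewrite mulmnE mnm1E eqxx mul1n.
rewrite mnmBE mulmnE mnm1E eqxx mul1n -eqn_mod_dvd // => /eqP->.
by rewrite modn_small.
Qed.

End Kap.
End CoefConv.

(** * Frobenius coordinates, and Cartier maps of polynomial rings *)

(** The model is an R with basis 1, y_j, ..., y_j^(p-1) over a subring that
contains all p-th powers, y_j^p among them, and the other y_l; kap j takes the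
coordinate at y_j^(p-1). The last condition is then the expansion of x in this
basis, since kap j (y_j^(p-1-e) x) is the coordinate of x at y_j^e. *)
Definition frobenius_coordinates (p : nat) (R : comNzRingType) (r : nat) (y : 'I_r ->
  R) : Prop :=
  exists kap : 'I_r -> {additive R -> R},
  [/\ forall (j l : 'I_r) x, l != j -> kap j (y l * x) = y l * kap j x,
      forall j a x, kap j (a ^+ p * x) = a ^+ p * kap j x &
      forall j x, \sum_(e < p) y j ^+ e * kap j (y j ^+ (p.-1 - e) * x) = x].

Lemma frobenius_coordinates_widen p (R : comNzRingType) (d r : nat) (y : 'I_d -> R)
  (w : 'I_r -> 'I_d) :
  injective w -> frobenius_coordinates p y -> frobenius_coordinates p (fun j => y (w
    j)).
Proof.
move=> wi [kap [kC kP kE]]; exists (fun j => kap (w j)); split=> // j l x lj.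
by apply: kC; rewrite (inj_eq wi).
Qed.

Section CoefOp.
Variables (n : nat) (A : comNzRingType).

Lemma mcoeff_mstrunc_ge N (f : mseries n A) m : (N <= mdeg m)%N -> (mstrunc N f)@_m = 0.
Proof.
move=> Nm; apply/memN_msupp_eq0/msize_mdeg_ge; exact: leq_trans (msize_mstrunc _ _) Nm.
Qed.

Variable G : ('X_{1..n} -> A) -> 'X_{1..n} -> A.
Hypothesis GB : forall f g m, G (fun m' => f m' - g m') m = G f m - G g m.

(** The degree bound makes G take finitely supported functions to such. *)
Lemma mpoly_additive :
  (forall (f : {mpoly A[n]}) m, (msize f <= mdeg m)%N -> G (fun m' => f@_m') m = 0) ->
  {F : {additive {mpoly A[n]} -> {mpoly A[n]}} |
    forall f m, (F f)@_m = G (fun m' => f@_m') m}.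
Proof.
move=> G0; pose F (f : {mpoly A[n]}) := mstrunc (msize f) (MSeries (G (fun m' =>
  f@_m'))).
have FE f m : (F f)@_m = G (fun m' => f@_m') m.
  case: (ltnP (mdeg m) (msize f)) => fm; first exact: mcoeff_mstrunc.
  by rewrite mcoeff_mstrunc_ge // G0.
have FB : zmod_morphism F.
  move=> f g; apply/mpolyP => m; rewrite mcoeffB !FE -GB.
  by congr (G _ m); apply: funext => m'; rewrite mcoeffB.
pose FA := GRing.isZmodMorphism.Build _ _ F FB.
pose F' : {additive {mpoly A[n]} -> {mpoly A[n]}} := HB.pack F FA.
by exists F'.
Qed.

Lemma mseries_additive :
  {F : {additive mseries n A -> mseries n A} | forall f m, mscoef (F f) m = G (mscoef
    f) m}.
Proof.
pose F (f : mseries n A) := MSeries (G (mscoef f)).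
have FB : zmod_morphism F.
  by move=> f g; apply: mseriesP => m; rewrite [RHS]/= -GB.
pose FA := GRing.isZmodMorphism.Build _ _ F FB.
pose F' : {additive mseries n A -> mseries n A} := HB.pack F FA.
by exists F'.
Qed.

End CoefOp.

Lemma mcoeff_msize n (A : comNzRingType) (f : {mpoly A[n]}) m :
  (msize f <= mdeg m)%N -> f@_m = 0.
Proof. by move=> fm; apply/memN_msupp_eq0/msize_mdeg_ge. Qed.

Section Splittings.
Variables (p n : nat) (A : comNzRingType).
Hypothesis pA : p \in [pchar A].
Let p_gt0 : (0 < p)%N := pchar_gt0 pA.

Lemma kap_coef_sub j (f g : 'X_{1..n} -> A) m :
  kap_coef p j (fun m' => f m' - g m') m = kap_coef p j f m - kap_coef p j g m.
Proof. by rewrite /kap_coef; case: ifP => // _; rewrite subrr. Qed.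

Lemma frobenius_coordinates_mpoly : frobenius_coordinates p (fun j : 'I_n => 'X_j :
  {mpoly A[n]}).
Proof.
have k0 j (f : {mpoly A[n]}) m : (msize f <= mdeg m)%N -> kap_coef p j (fun m' =>
  f@_m') m = 0.
  move=> fm; rewrite /kap_coef; case: ifP => // _; apply: mcoeff_msize.
  by rewrite (leq_trans fm) // mdegD leq_addr.
pose kap j := sval (mpoly_additive (kap_coef_sub j) (k0 j)).
have kE j f m : (kap j f)@_m = kap_coef p j (fun m' => f@_m') m.
  exact: (svalP (mpoly_additive (kap_coef_sub j) (k0 j))).
have kX j c f m : kap_coef p j (fun m' => ('X_[c] * f)@_m') m =
    kap_coef p j (shift_coef c (fun m' => f@_m')) m.
  by rewrite /kap_coef; case: ifP => // _; rewrite mcoeffXM.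
exists kap; split=> [j l x lj|j a x|j x]; apply/mpolyP => m.
- rewrite kE kX (kap_coef_shift p _ _ lj) mcoeffXM.
  by rewrite /shift_coef kE.
- rewrite kE (mcoeff_frob_conv _ _ pA (leqnn _)).
  have -> : (fun m' => (kap j x)@_m') = kap_coef p j (fun m' => x@_m') by apply: funext.
  rewrite -(kap_coef_frob_conv p_gt0) /kap_coef; case: ifP => // _.
  by rewrite (mcoeff_frob_conv _ _ pA (leqnn _)).
- rewrite raddf_sum; apply: etrans (kap_coef_sum p_gt0 j (fun m' => x@_m') m).
  apply: eq_bigr => e _ /=; rewrite !mpolyXn mcoeffXM /shift_coef; case: ifP => // _.
  by rewrite kE kX.
Qed.

Lemma frobenius_coordinates_mseries : frobenius_coordinates p (@msvar n A).
Proof.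
pose kap j := sval (mseries_additive (kap_coef_sub j)).
have kE j f m : mscoef (kap j f) m = kap_coef p j (mscoef f) m.
  exact: (svalP (mseries_additive (kap_coef_sub j))).
have kX j c f m : kap_coef p j (mscoef (msmono A c * f)) m = kap_coef p j (shift_coef
  c (mscoef f)) m.
  by rewrite /kap_coef; case: ifP => // _; rewrite mscoefXM.
exists kap; split=> [j l x lj|j a x|j x]; apply: mseriesP => m.
- rewrite kE msvar_mono kX (kap_coef_shift p _ _ lj) mscoefXM.
  by rewrite /shift_coef kE.
- pose N := (mdeg (m + U_(j) *+ p.-1)%MM).+1.
  have mN : (mdeg m < N)%N by rewrite ltnS mdegD leq_addr.
  rewrite kE (mscoef_frob_conv _ _ pA mN).
  have -> : mscoef (kap j x) = kap_coef p j (mscoef x) by apply: funext.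
  rewrite -(kap_coef_frob_conv p_gt0) /kap_coef; case: ifP => // _.
  by rewrite (mscoef_frob_conv _ _ pA (ltnSn _)).
- rewrite -[mscoef _ m]/(@mscoef n A _ m).
  have cS (F : 'I_p -> mseries n A) : mscoef (\sum_e F e) m = \sum_e mscoef (F e) m.
    by apply: (big_morph (fun f => mscoef f m)) => //=; rewrite if_same.
  rewrite cS; apply: etrans (kap_coef_sum p_gt0 j (mscoef x) m); apply: eq_bigr => e _.
  rewrite msvar_mono -!msmonoMn mscoefXM /shift_coef; case: ifP => // _.
  by rewrite kE kX.
Qed.

Lemma frobenius_coordinates_mpolyC r (y : 'I_r -> A) :
  frobenius_coordinates p y -> frobenius_coordinates p (fun j => (y j)%:MP_[n] :
    {mpoly A[n]}).
Proof.
move=> [kap [kC kP kE]].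
pose G j (f : 'X_{1..n} -> A) m := kap j (f m).
have GB j f g m : G j (fun m' => f m' - g m') m = G j f m - G j g m by apply: raddfB.
have G0 j (f : {mpoly A[n]}) m : (msize f <= mdeg m)%N -> G j (fun m' => f@_m') m = 0.
  by move=> fm; rewrite /G mcoeff_msize ?raddf0.
pose K j := sval (mpoly_additive (GB j) (G0 j)).
have KE j f m : (K j f)@_m = kap j f@_m by exact: (svalP (mpoly_additive (GB j) (G0
  j))).
exists K; split=> [j l x lj|j a x|j x]; apply/mpolyP => m.
- by rewrite KE !mcoeffCM KE kC.
- rewrite KE !(mcoeff_frob_conv _ _ pA (leqnn _)) raddf_sum; apply: eq_bigr => b _ /=.
  by rewrite kP /shift_coef; case: ifP => _; rewrite ?KE ?raddf0.
- rewrite raddf_sum -[RHS](kE j); apply: eq_bigr => e _ /=.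
  by rewrite -!rmorphXn /= mcoeffCM KE mcoeffCM.
Qed.

(** Applying C to the coefficients at the monomials p m + e, for fixed e with
entries less than p, is a Cartier map: multiplication by a p-th power does not
mix the residues e. *)
Lemma residue_frob_conv (C : cartier p A) (e : 'X_{1..n}) N (a g : 'X_{1..n} -> A) m :
  (forall i, e i < p)%N ->
  C (frob_conv p N a g (m *+ p + e)%MM) = conv N a (fun m' => C (g (m' *+ p + e)%MM)) m.
Proof.
move=> ep; rewrite raddf_sum; apply: eq_bigr => b _ /=; rewrite cartierP; congr (_ * _).
rewrite /shift_coef; have -> : (b *+ p <= m *+ p + e)%MM = (b <= m)%MM.
  apply/mnm_lepP/mnm_lepP => h i; move: (h i); rewrite ?mnmDE !mulmnE ?mnmE.
    move=> h'; rewrite leqNgt; apply/negP => lt.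
    have : ((m i).+1 * p <= m i * p + e i)%N.
      by apply: leq_trans h'; rewrite leq_mul2r lt orbT.
    by rewrite mulSn addnC leq_add2l leqNgt ep.
  by move=> bm; rewrite (leq_trans _ (leq_addr _ _)) // leq_mul2r bm orbT.
case: ifP => bm; last by rewrite raddf0.
congr (C (g _)); apply/mnmP => i.
rewrite !(mnmDE, mnmBE, mulmnE) mulnBl addnBAC // leq_mul2r.
by rewrite (mnm_lepP bm) orbT.
Qed.

(** Choose pairs (r_s, C_s) for the finitely many coefficients of f at once. The
Cartier map C_(s,e) applies C_s to the coefficients of residue e modulo p, and
f is the sum of the r_s X^e C_(s,e)(f)^p. *)
Lemma cartier_trace_mpoly : cartier_trace p A -> cartier_trace p {mpoly A[n]}.
Proof.
move=> trA f.
have [s sP] := cartier_trace_seq p_gt0 trA [seq f@_m | m <- msupp f].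
have {}sP m : f@_m = cartier_trace_sum s f@_m.
  case: (boolP (m \in msupp f)) => mf; first by apply/sP/map_f.
  rewrite (memN_msupp_eq0 mf) /cartier_trace_sum big1 // => t _.
  by rewrite raddf0 expr0n gtn_eqF // mulr0.
pose ofe (e : {ffun 'I_n -> 'I_p}) : 'X_{1..n} := [multinom (e i : nat) | i < n].
pose G (C : cartier p A) (e : {ffun 'I_n -> 'I_p}) (g : 'X_{1..n} -> A) m :=
  C (g (m *+ p + ofe e)%MM).
have GB C e g h m : G C e (fun m' => g m' - h m') m = G C e g m - G C e h m.
  exact: raddfB.
have G0 C e (g : {mpoly A[n]}) m : (msize g <= mdeg m)%N -> G C e (fun m' => g@_m') m
  = 0.
  move=> gm; rewrite /G mcoeff_msize ?raddf0 // (leq_trans gm) // mdegD mdegMn.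
  by rewrite -[X in (X <= _)%N]addn0 leq_add // leq_pmulr.
pose K C e := sval (mpoly_additive (GB C e) (G0 C e)).
have KE C e g m : (K C e g)@_m = C g@_(m *+ p + ofe e).
  exact: (svalP (mpoly_additive (GB C e) (G0 C e))).
have KP C e (a g : {mpoly A[n]}) : K C e (a ^+ p * g) = a * K C e g.
  apply/mpolyP => m; rewrite KE (mcoeff_frob_conv _ _ pA (leqnn _)) (mcoeff_conv _ _
    (leqnn _)).
  rewrite residue_frob_conv => [|i]; last by rewrite mnmE.
  by congr (conv _ _ _ m); apply: funext => m'; rewrite KE.
exists [seq (t.1 *: 'X_[ofe e], Cartier (KP t.2 e)) | t <- s, e <- enum {ffun 'I_n ->
  'I_p}].
rewrite /cartier_trace_sum big_allpairs_dep /=; apply/mpolyP => m.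
rewrite sP raddf_sum; apply: eq_bigr => t _ /=.
rewrite big_enum raddf_sum /=.
have modp i : (m i %% p < p)%N by rewrite ltn_mod.
pose e0 : {ffun 'I_n -> 'I_p} := [ffun i => Ordinal (modp i)].
pose q : 'X_{1..n} := [multinom (m i %/ p)%N | i < n].
have mE : m = (q *+ p + ofe e0)%MM.
  by apply/mnmP => i; rewrite mnmDE mulmnE !mnmE ffunE /= -divn_eq.
have XE e : ('X_[ofe e] * K t.2 e f ^+ p)@_m = if e == e0 then t.2 f@_m ^+ p else 0.
  rewrite mulrC (mcoeff_frob_conv _ _ pA (leqnn _)) /frob_conv.
  have E b : (b *+ p + ofe e)%MM = m -> b = q /\ e = e0.
    move=> bm; split; [apply/mnmP => i|apply/ffunP => i]; last apply: val_inj.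
      rewrite mnmE -bm mnmDE mulmnE mnmE divnMDl // divn_small ?addn0 //.
    by rewrite ffunE /= -bm mnmDE mulmnE mnmE modnMDl modn_small.
  have sE b : shift_coef (b *+ p)%MM (fun m' => 'X_[ofe e]@_m') m =
      ((b == q) && (e == e0))%:R :> A.
    rewrite /shift_coef mcoeffX; case: ifPn => bm; last first.
      case: eqP => [eb|] //=; case/negP: bm; rewrite eb mE; exact: lem_addr.
    congr (_%:R); congr (nat_of_bool _); apply/eqP/andP => [eb|[/eqP qb /eqP->]];
      last subst b.
      have /E[-> ->] : (b *+ p + ofe e)%MM = m by rewrite addmC eb submK.
      by rewrite !eqxx.
    by apply: (@addIm _ (q *+ p)%MM); rewrite /= submK // addmC -mE.
  under eq_bigr => b _ do rewrite sE.
  case: (eqVneq e e0) => [->|_]; last first.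
    by apply: big1 => b _; rewrite andbF mulr0.
  case: (ltnP (mdeg q) (msize (K t.2 e0 f))) => qs; last first.
    rewrite big1 => [|b _]; last first.
      case: eqP => /= [bq|_]; last by rewrite mulr0.
      by have := bmdeg b; rewrite bq ltnNge qs.
    have := mcoeff_msize qs; rewrite KE -mE => ->.
    by rewrite expr0n gtn_eqF.
  rewrite (bigD1 (BMultinom qs)) //= !eqxx mulr1 KE -mE big1 ?addr0 // => b.
  by rewrite bmeqP /= => /negPf->; rewrite mulr0.
rewrite [RHS](bigD1 e0 isT) [X in _ = _ + X]big1 => [|e /andP[_ /negPf ee]].
  by rewrite addr0 -scalerAl mcoeffZ XE eqxx.
by rewrite -scalerAl mcoeffZ XE ee mulr0.
Qed.

End Splittings.

(** * Dickson's lemma and Hilbert's basis theorem *)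

Section Dickson.
Variable A : comNzRingType.
Hypothesis nA : noetherian_mod (A^o : lmodType A).

Local Notation ideal P := (@is_submod A (A^o : lmodType A) P).

Definition le_upto n (f g : nat -> nat) := forall i, (i < n)%N -> (f i <= g i)%N.

Definition update (f : nat -> nat) n c i : nat := if i == n then c else f i.

Lemma le_update n f g c c' :
  le_upto n f g -> (c <= c')%N -> le_upto n.+1 (update f n c) (update g n c').
Proof.
move=> fg cc i; rewrite ltnS leq_eqVlt /update => /orP[/eqP->|ilt].
  by rewrite eqxx.
by rewrite ltn_eqF //; apply: fg.
Qed.

Lemma update_id n f : le_upto n.+1 f (update f n (f n)) /\ le_upto n.+1 (update f n
  (f n)) f.
Proof. by split=> i _; rewrite /update; case: eqP => [->|]. Qed.

Lemma le_upto_trans n f g h : le_upto n f g -> le_upto n g h -> le_upto n f h.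
Proof. by move=> fg gh i ilt; apply: leq_trans (gh i ilt); apply: fg. Qed.

(** A monotone family of ideals indexed by n-tuples is generated by finitely many
of its elements; for a family of zero and unit ideals this is Dickson's lemma.
For the induction, the union over the last coordinate is a family over one
coordinate less; its generators occur at values of the last coordinate that are
at most some N, and the values c < N are dealt with one by one. Tuples are
represented by functions on nat of which the first n values count, so that
the induction changes no types. *)
Lemma dickson_noetherian n (L : (nat -> nat) -> A -> Prop) :
  (forall f, ideal (L f)) ->
  (forall f g a, le_upto n f g -> L f a -> L g a) ->
  exists (I : finType) (e : I -> (nat -> nat) * A),
    (forall i, L (e i).1 (e i).2) /\
    forall f a, L f a -> forall P : A -> Prop, ideal P ->
      (forall i, le_upto n (e i).1 f -> P (e i).2) -> P a.
Proof.
elim: n L => [|n IHn] L Lid Lmono.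
  have [s [sL Ls]] := nA (Lid (fun=> 0%N)).
  exists 'I_(size s), (fun i : 'I_(size s) => (fun=> 0%N, s`_i)); split=> [i|f a Lf P
    Pid Pi].
    by apply/sL/mem_nth.
  have /Ls : L (fun=> 0%N) a by apply: Lmono Lf.
  move=> /(_ P Pid); apply=> g gs; rewrite -(nth_index 0 gs).
  have gi : (index g s < size s)%N by rewrite index_mem.
  exact: (Pi (Ordinal gi)).
pose Q f a := exists c, L (update f n c) a.
have Lupd f c c' a : (c <= c')%N -> L (update f n c) a -> L (update f n c') a.
  by move=> cc; apply: Lmono; apply: le_update.
have [||I [e [eQ Qe]]] := IHn Q.
- move=> f; split; first by exists 0%N; apply: (Lid _).1.
  move=> a x z [c Lx] [c' Lz]; exists (maxn c c'); apply: (Lid _).2.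
    by apply: Lupd Lx; apply: leq_maxl.
  by apply: Lupd Lz; apply: leq_maxr.
- move=> f g a fg [c Lc]; exists c; apply: Lmono Lc; exact: le_update.
have /choice[c cP] := eQ.
pose N := \max_i c i.
have /choice[J JP] : forall b : nat, exists Je : {I : finType & I -> (nat -> nat) * A},
    (forall i, L (update (projT2 Je i).1 n b) (projT2 Je i).2) /\
    forall f a, L (update f n b) a -> forall P : A -> Prop, ideal P ->
      (forall i, le_upto n (projT2 Je i).1 f -> P (projT2 Je i).2) -> P a.
  move=> b; have [||J [eJ [eJL LeJ]]] := IHn (fun f => L (update f n b)).
  - by move=> f; apply: Lid.
  - by move=> f g a fg; apply: Lmono; apply: le_update.
  by exists (existT _ J eJ).
pose K : finType := (I + {b : 'I_N & projT1 (J b)})%type.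
pose eK (x : K) : (nat -> nat) * A := match x with
  | inl i => (update (e i).1 n (c i), (e i).2)
  | inr (existT b i) => (update (projT2 (J b) i).1 n b, (projT2 (J b) i).2) end.
exists K, eK; split=> [[i|[b i]]|f a Lf P Pid Pi].
- exact: cP.
- exact: (JP b).1.
have Lf' : L (update f n (f n)) a by apply: Lmono Lf; apply: (update_id n f).1.
case: (ltnP (f n) N) => fN.
  apply: ((JP (f n)).2 _ _ Lf' P Pid) => i ile.
  apply: (Pi (inr (existT _ (Ordinal fN) i))) => /=.
  exact: le_upto_trans (le_update ile (leqnn _)) (update_id n f).2.
apply: (Qe f a (ex_intro _ _ Lf') P Pid) => i ile; apply: (Pi (inl i)) => /=.
apply: le_upto_trans (le_update ile _) (update_id n f).2.
by apply: leq_trans fN; apply: leq_bigmax.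
Qed.

Lemma dickson_multinom n (L : 'X_{1..n} -> A -> Prop) :
  (forall m, ideal (L m)) ->
  (forall m m' a, (m <= m')%MM -> L m a -> L m' a) ->
  exists (I : finType) (e : I -> 'X_{1..n} * A),
    (forall i, L (e i).1 (e i).2) /\
    forall m a, L m a -> forall P : A -> Prop, ideal P ->
      (forall i, ((e i).1 <= m)%MM -> P (e i).2) -> P a.
Proof.
move=> Lid Lmono.
pose mn (f : nat -> nat) : 'X_{1..n} := [multinom f i | i < n].
have [||I [e [eL Le]]] := @dickson_noetherian n (fun f => L (mn f)).
- by move=> f; apply: Lid.
- move=> f g a fg; apply: Lmono; apply/mnm_lepP => i; rewrite !mnmE; exact: fg.
exists I, (fun i => (mn (e i).1, (e i).2)); split=> // m a Lm P Pid Pi.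
pose f i := nth 0%N m i.
have mnf : mn f = m by apply/mnmP => i; rewrite mnmE /f (mnm_nth 0%N).
apply: (Le f a _ P Pid) => [|i ile]; first by rewrite mnf.
by apply: Pi; rewrite -mnf /=; apply/mnm_lepP => j; rewrite !mnmE; apply: ile.
Qed.

(** Apply dickson_noetherian to the ideals L m of coefficients at m of
the elements of P that have no larger monomials, and divide by elements with
the resulting leading coefficients. *)
Lemma noetherian_mpoly n : noetherian_mod ({mpoly A[n]}^o : lmodType {mpoly A[n]}).
Proof.
move=> P Pid.
pose L (m : 'X_{1..n}) a := exists f : {mpoly A[n]},
  [/\ P f, f@_m = a & forall m', (m < m')%O -> f@_m' = 0].
have Pmul (h f : {mpoly A[n]}) : P f -> P (h * f) by apply: (is_submodZ Pid).
have CM (a : A) (f : {mpoly A[n]}) m : (a%:MP * f)@_m = a * f@_m by rewrite mcoeffCM.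
have [||I [e [eL Le]]] := @dickson_multinom n L.
- move=> m; split; first by exists 0; split=> [||m' _]; rewrite ?mcoeff0 //; exact:
  Pid.1.
  move=> a x z [f [Pf <- f0]] [g [Pg <- g0]]; exists (a%:MP * f + g).
  split=> [||m' mm]; [exact: Pid.2|by rewrite mcoeffD CM|].
  by rewrite mcoeffD CM f0 // g0 // mulr0 addr0.
- move=> m m' a mm [f [Pf <- f0]]; exists ('X_[m' - m] * f).
  split=> [||q mq]; first exact: Pmul.
    rewrite mcoeffXM /shift_coef lem_subr; congr (_@__); apply/mnmP => i.
    by rewrite !mnmBE subKn // (mnm_lepP mm).
  rewrite mcoeffXM /shift_coef; case: ifP => // cq; apply: f0.
  rewrite -(ltmc_add2l _ _ (m' - m)%MM) submK // addmC submK //.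
have /choice[g gP] := eL.
pose s := [seq g i | i : I]; exists s.
have gs i : g i \in s by apply/mapP; exists i; rewrite ?mem_enum.
have sP h : h \in s -> P h by move=> /mapP[i _ ->]; case: (gP i).
have spanP f : span_of (M := {mpoly A[n]}^o) s f -> P f by apply.
split=> // f Pf.
suff {f Pf} K (m : 'X_{1..n}) : forall f, P f -> (forall m', (m < m')%O -> f@_m' = 0) ->
    span_of (M := {mpoly A[n]}^o) s f.
  by apply: (K (mlead f)) => // m' mm; apply: mcoeff_gt_mlead.
elim/(well_founded_ind (@ltom_wf n)): m => m IH f Pf f0.
have sS := @span_submod _ ({mpoly A[n]}^o) s.
have [h [sh hm h0]] : exists h, [/\ span_of (M := {mpoly A[n]}^o) s h, h@_m = f@_m &
    forall m', (m < m')%O -> h@_m' = 0].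
  apply: (Le m f@_m _ (fun a => exists h, [/\ span_of (M := {mpoly A[n]}^o) s h, h@_m
    = a &
    forall m', (m < m')%O -> h@_m' = 0])).
  - by exists f.
  - split; first by exists 0; split=> [||m' _]; rewrite ?mcoeff0 //; exact: sS.1.
    move=> a x z [u [Pu <- u0]] [v [Pv <- v0]]; exists (a%:MP * u + v).
    split=> [||m' mm]; [exact: sS.2|by rewrite mcoeffD CM|].
    by rewrite mcoeffD CM u0 // v0 // mulr0 addr0.
  - move=> i im; have [_ gm g0] := gP i; exists ('X_[m - (e i).1] * g i).
    split=> [||q mq].
    + by apply: (is_submodZ sS); apply: span_gen.
    + rewrite mcoeffXM /shift_coef lem_subr -gm; congr (_@__); apply/mnmP => j.
      by rewrite !mnmBE subKn // (mnm_lepP im).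
    + rewrite mcoeffXM /shift_coef; case: ifP => // cq; apply: g0.
      by rewrite -(ltmc_add2l _ _ (m - (e i).1)%MM) submK // addmC submK.
rewrite -[f](subrK h); apply: (is_submodD sS) => //.
have Pfh : P (f - h) by apply: (is_submodB Pid) => //; apply: spanP.
case: (eqVneq (f - h) 0) => [->|nz]; first exact: sS.1.
apply: (IH (mlead (f - h))) => // [|m' mm]; last exact: mcoeff_gt_mlead.
rewrite ltNge le_eqVlt; apply/negP => mle.
have := mlead_supp nz; rewrite mcoeff_msupp mcoeffB.
by case/orP: mle => [/eqP<-|mlt]; [rewrite hm|rewrite f0 // h0 //]; rewrite subrr eqxx.
Qed.

End Dickson.

(** * Division of power series *)

Section Series.
Variables (n : nat) (A : comNzRingType).
Local Notation S := (mseries n A).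
Implicit Types (f g x q : S) (m : 'X_{1..n}).

Definition ord_ge D f := forall m, (mdeg m < D)%N -> mscoef f m = 0.

Lemma mscoefD f g m : mscoef (f + g) m = mscoef f m + mscoef g m. Proof. by []. Qed.
Lemma mscoefN f m : mscoef (- f) m = - mscoef f m. Proof. by []. Qed.
Lemma mscoef0 m : mscoef (0 : S) m = 0. Proof. by rewrite /= if_same. Qed.

Lemma mscoef_sum (I : Type) (s : seq I) (F : I -> S) m :
  mscoef (\sum_(i <- s) F i) m = \sum_(i <- s) mscoef (F i) m.
Proof. by apply: (big_morph (fun f => mscoef f m)) => //; apply: mscoef0. Qed.

Lemma mscoefCM a f m : mscoef (msconst n a * f) m = a * mscoef f m.
Proof.
have mN := ltnSn (mdeg m); have zN : (mdeg (0%MM : 'X_{1..n}) < (mdeg m).+1)%N by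
  rewrite mdeg0.
rewrite (mscoef_conv _ _ mN) /conv (bigD1 (BMultinom zN)) //= big1 ?addr0 => [|b].
  rewrite /shift_coef; have -> : (0 <= m)%MM by apply/mnm_lepP => i; rewrite mnm0E.
  by rewrite eqxx subm0.
by rewrite bmeqP /= => /negPf->; rewrite mul0r.
Qed.

Lemma ord_ge0 D : ord_ge D 0. Proof. by move=> m _; apply: mscoef0. Qed.

Lemma ord_geD D f g : ord_ge D f -> ord_ge D g -> ord_ge D (f + g).
Proof. by move=> hf hg m mD; rewrite mscoefD hf // hg // addr0. Qed.

Lemma ord_geM D f g : ord_ge D f -> ord_ge D (f * g).
Proof.
move=> hf m mD; rewrite (mscoef_conv _ _ (ltnSn _)) /conv big1 // => b _.
rewrite /shift_coef; case: ifP => [bm|_]; last by rewrite mulr0.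
rewrite hf ?mul0r // (leq_ltn_trans _ mD) //; exact/lemc_mdeg/lem_leo.
Qed.

Lemma ord_geMr D f g : ord_ge D g -> ord_ge D (f * g).
Proof. by rewrite mulrC; apply: ord_geM. Qed.

Lemma ord_ge_sum D (I : Type) (s : seq I) (F : I -> S) :
  (forall i, ord_ge D (F i)) -> ord_ge D (\sum_(i <- s) F i).
Proof. by move=> hF; apply: big_ind => //; [apply: ord_ge0|apply: ord_geD]. Qed.

Definition zero_below m f := forall m', (m' < m)%O -> mscoef f m' = 0.

Lemma zero_below_monoM m c f : zero_below m f -> zero_below (c + m)%MM (msmono A c * f).
Proof.
move=> fm q qm; rewrite mscoefXM /shift_coef; case: ifP => // cq; apply: fm.
by rewrite -(ltmc_add2r c) addmC submK.
Qed.

Lemma mscoef_monoM m c f : mscoef (msmono A c * f) (c + m)%MM = mscoef f m.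
Proof. by rewrite mscoefXM /shift_coef lem_addr addmC addmK. Qed.

(** The hypothesis lead says that the lowest coefficients of elements of P are
combinations of those of the g i at monomials dividing the given one, that
is, that the g i are a standard basis of P. *)
Section Division.
Variables (I : finType) (g : I -> S) (mg : I -> 'X_{1..n}) (P : S -> Prop).
Local Notation ideal P := (@is_submod A (A^o : lmodType A) P).
Hypothesis Pid : @is_submod S (S^o : lmodType S) P.
Hypothesis Pg : forall i, P (g i).
Hypothesis gm : forall i, zero_below (mg i) (g i).
Hypothesis lead : forall x m, P x -> zero_below m x -> forall T : A -> Prop, ideal T ->
  (forall i, (mg i <= m)%MM -> T (mscoef (g i) (mg i))) -> T (mscoef x m).

Lemma division_lead D x m : P x -> zero_below m x -> mdeg m = D ->
  exists q : I -> S, [/\ forall i, ord_ge (D - mdeg (mg i)) (q i),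
    mscoef (\sum_i q i * g i) m = mscoef x m & zero_below m (\sum_i q i * g i)].
Proof.
move=> Px xm mD; apply: (lead Px xm (T := fun a =>
  exists q : I -> S, [/\ forall i, ord_ge (D - mdeg (mg i)) (q i),
    mscoef (\sum_i q i * g i) m = a & zero_below m (\sum_i q i * g i)])).
  have E0 : \sum_i 0 * g i = 0 by rewrite big1 // => i _; rewrite mul0r.
  split.
    by exists (fun=> 0); split=> [i||m' _]; rewrite ?E0 ?mscoef0 //; apply: ord_ge0.
  move=> a _ _ [q [qo <- qb]] [q' [qo' <- qb']].
  have E : \sum_i (msconst n a * q i + q' i) * g i =
      msconst n a * (\sum_i q i * g i) + \sum_i q' i * g i.
    by rewrite mulr_sumr -big_split; apply: eq_bigr => i _; rewrite mulrDl mulrA.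
  exists (fun i => msconst n a * q i + q' i); split=> [i||m' mm].
  - by apply: ord_geD => //; apply: ord_geMr.
  - by rewrite E mscoefD mscoefCM.
  - by rewrite E mscoefD mscoefCM qb // qb' // mulr0 addr0.
move=> i im; pose c := (m - mg i)%MM.
have cm : (c + mg i)%MM = m by rewrite submK.
have E : \sum_l (if l == i then msmono A c else 0) * g l = msmono A c * g i.
  by rewrite (bigD1 i) //= eqxx big1 ?addr0 // => l /negPf->; rewrite mul0r.
exists (fun l => if l == i then msmono A c else 0); split=> [l||].
- case: eqP => [->|_]; last exact: ord_ge0.
  move=> q qc /=; case: eqP => // e; move: qc.
  by rewrite e -mD -cm mdegD addnK ltnn.
- by rewrite E -[in LHS]cm mscoef_monoM.
- by rewrite E -cm; apply: zero_below_monoM.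
Qed.

(** All monomials of degree D are removed in increasing order; the number of
monomials of degree at most D that are above some monomial of x decreases. *)
Lemma division_step D x : P x -> ord_ge D x ->
  exists q : I -> S, (forall i, ord_ge (D - mdeg (mg i)) (q i)) /\
    ord_ge D.+1 (x - \sum_i q i * g i).
Proof.
pose supp x : {set 'X_{1..n < D.+1}} :=
  [set b : 'X_{1..n < D.+1} |
    [exists b' : 'X_{1..n < D.+1}, ((b' : 'X_{1..n}) <= b)%O && (mscoef x b' != 0)]].
move: {2}#|supp x| (leqnn #|supp x|) => k; elim: k x => [|k IHk] x xk Px xD.
  exists (fun=> 0); split=> [i|]; first exact: ord_ge0.
  rewrite big1 ?subr0 => [|i _]; last by rewrite mul0r.
  move=> m mD; apply/eqP; apply: contraTT xk => xm0; rewrite -ltnNge card_gt0.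
  apply/set0Pn; exists (BMultinom mD); rewrite inE; apply/existsP.
  by exists (BMultinom mD); rewrite lexx.
case: (pickP (fun b : 'X_{1..n < D.+1} => mscoef x b != 0)) => [b0 b0P|x0]; last first.
  exists (fun=> 0); split=> [i|]; first exact: ord_ge0.
  rewrite big1 ?subr0 => [|i _]; last by rewrite mul0r.
  by move=> m mD; apply/eqP; have := x0 (BMultinom mD) => /= /negbFE.
pose b := [arg min_(b < b0 | mscoef x b != 0) (b : 'X_{1..n})]%O.
have [bP bmin] : mscoef x b != 0 /\
    forall c : 'X_{1..n < D.+1}, mscoef x c != 0 -> ((b : 'X_{1..n}) <= c)%O.
  by rewrite /b; case: Order.TotalTheory.arg_minP => // c cP cmin; split.
have bD : mdeg b = D.
  apply/eqP; rewrite eqn_leq -ltnS bmdeg /= leqNgt; apply/negP => lt.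
  by rewrite (xD _ lt) eqxx in bP.
have xb : zero_below b x.
  move=> m mb; have mD : (mdeg m < D.+1)%N.
    by rewrite ltnS -bD; apply/lemc_mdeg/ltW.
  apply/eqP/negPn/negP => nz; have := bmin (BMultinom mD) nz.
  by rewrite leNgt mb.
have [q [qo qm qb]] := division_lead Px xb bD.
set h := \sum_i q i * g i in qm qb.
have Ph : P h by apply: (is_submod_sum Pid) => i; apply: (is_submodZ Pid).
have xhb : zero_below b (x - h) by move=> m mb; rewrite mscoefD mscoefN xb // qb //
  subrr.
have xhb0 : mscoef (x - h) b = 0 by rewrite mscoefD mscoefN qm subrr.
have [|||q' [qo' xD']] := IHk (x - h).
- rewrite -ltnS (leq_trans _ xk) //; apply: proper_card; apply/properP; split.
    apply/subsetP => c; rewrite !inE => /existsP[c' /andP[cc c'0]].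
    apply/existsP; exists b; rewrite bP andbT; apply: le_trans cc.
    by rewrite leNgt; apply/negP => lt; rewrite xhb // eqxx in c'0.
  exists b; rewrite inE; first by apply/existsP; exists b; rewrite lexx.
  apply/existsP => -[c /andP[cb c0]]; move: c0.
  by move: cb; rewrite le_eqVlt => /orP[/eqP->|/xhb->]; rewrite ?xhb0 eqxx.
- exact: (is_submodB Pid).
- by move=> m mD; apply: xhb; apply: lt_mdeg_ltmc; rewrite bD.
exists (fun i => q i + q' i); split=> [i|]; first exact: ord_geD.
rewrite (_ : x - _ = x - h - \sum_i q' i * g i) //.
rewrite -addrA -opprD; congr (_ - _); rewrite -big_split.
by apply: eq_bigr => i _; rewrite mulrDl.
Qed.

(** The quotients found for degree D have order at least D - mdeg (mg i), so
their sum over all D makes sense: its coefficient at m stops at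
D = mdeg m + mdeg (mg i). *)
Lemma division x : P x -> exists q : I -> S, x = \sum_i q i * g i.
Proof.
move=> Px.
have /choice[st stP] : forall Dx : nat * S, exists q : I -> S,
    P Dx.2 -> ord_ge Dx.1 Dx.2 ->
    (forall i, ord_ge (Dx.1 - mdeg (mg i)) (q i)) /\
    ord_ge Dx.1.+1 (Dx.2 - \sum_i q i * g i).
  move=> [D z]; case: (pselect (P z /\ ord_ge D z)) => [[Pz zD]|nP].
    by have [q qP] := division_step Pz zD; exists q.
  by exists (fun=> 0) => Pz zD; case: nP.
pose fix xs D : S := if D is D'.+1 then
  xs D' - \sum_i st (D', xs D') i * g i else x.
have xsP D : P (xs D) /\ ord_ge D (xs D).
  elim: D => [|D [PD oD]]; first by split.
  have [_ o'] := stP (D, xs D) PD oD; split=> //=.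
  by apply: (is_submodB Pid) => //; apply: (is_submod_sum Pid) => i; apply:
    (is_submodZ Pid).
pose qs D i := st (D, xs D) i.
have qsO D i : ord_ge (D - mdeg (mg i)) (qs D i).
  by have [PD oD] := xsP D; have [] := stP (D, xs D) PD oD.
pose q i : S := MSeries (fun m => \sum_(D < (mdeg m + mdeg (mg i)).+1) mscoef (qs D
  i) m).
exists q; apply: mseriesP => m0; apply/eqP; rewrite -subr_eq0 -mscoefN -mscoefD.
(* the steps D >= K change neither x nor the products below degree E *)
pose E := (mdeg m0).+1; pose K := (E + \max_i mdeg (mg i))%N.
have xK k : xs k = x - \sum_i (\sum_(D < k) qs D i) * g i.
  elim: k => [|k IHk] /=.
    by rewrite big1 ?subr0 // => i _; rewrite big_ord0 mul0r.
  rewrite [X in X - _ = _]IHk -addrA -opprD; congr (_ - _); rewrite -big_split.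
  by apply: eq_bigr => i _; rewrite big_ord_recr mulrDl.
suff oE : ord_ge E (x - \sum_i q i * g i) by rewrite oE.
have -> : x - \sum_i q i * g i = xs K + \sum_i (\sum_(D < K) qs D i - q i) * g i.
  rewrite xK -addrA; congr (_ + _).
  under [X in _ = _ + X]eq_bigr => i _ do rewrite mulrBl.
  by rewrite sumrB addrA addNr sub0r.
apply: ord_geD.
  by move=> m mE; apply: (xsP K).2; rewrite (leq_trans mE) // leq_addr.
apply: ord_ge_sum => i; apply: ord_geM => m mE.
rewrite mscoefD mscoefN mscoef_sum /=; apply/eqP; rewrite subr_eq0; apply/eqP.
have le : ((mdeg m + mdeg (mg i)).+1 <= K)%N.
  rewrite -addSn leq_add //; exact: (leq_bigmax i).
rewrite (big_ord_widen_cond K xpredT (fun D => mscoef (qs D i) m) le).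
rewrite [RHS]big_mkcond; apply: eq_bigr => D _ /=; case: ifP => // /negbT.
rewrite -leqNgt => lt; apply: qsO; rewrite ltn_subRL addnC; exact: lt.
Qed.

End Division.

Lemma noetherian_mseries :
  noetherian_mod (A^o : lmodType A) -> noetherian_mod (S^o : lmodType S).
Proof.
move=> nA P Pid.
pose L m a := exists f : S, [/\ P f, mscoef f m = a & zero_below m f].
have [||I [e [eL Le]]] := dickson_multinom nA (L := L).
- move=> m; split.
    by exists 0; split=> [||m' _]; rewrite ?mscoef0 //; exact: Pid.1.
  move=> a x z [f [Pf <- f0]] [g [Pg <- g0]]; exists (msconst n a * f + g).
  split=> [||m' mm]; [exact: Pid.2|by rewrite mscoefD mscoefCM|].
  by rewrite mscoefD mscoefCM f0 // g0 // mulr0 addr0.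
- move=> m m' a mm [f [Pf <- f0]].
  have [c ->] : exists c, m' = (c + m)%MM by exists (m' - m)%MM; rewrite submK.
  exists (msmono A c * f); split; last exact: zero_below_monoM.
    exact: (is_submodZ Pid).
  exact: mscoef_monoM.
have /choice[g gP] := eL.
have Pg i : P (g i) by case: (gP i).
pose s := [seq g i | i : I]; exists s; split=> [f /mapP[i _ ->] //|f Pf].
have [|x m Px xm T Tid Ti|q ->] := @division I g (fun i => (e i).1) P Pid Pg _ _ f Pf.
- by move=> i; case: (gP i).
- apply: (Le m _ _ T Tid); first by exists x.
  by move=> i /Ti; have [_ -> _] := gP i.
apply: (is_submod_sum (@span_submod _ (S^o) s)) => i.
apply: (is_submodZ (@span_submod _ (S^o) s)); apply: span_gen.
by apply/mapP; exists i; rewrite ?mem_enum.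
Qed.

End Series.

(** * Cartier maps of fields and of power series rings *)

Section FieldCase.
Variables (k : fieldType) (p : nat).
Hypothesis pk : p \in [pchar k].
Let p_gt0 : (0 < p)%N := pchar_gt0 pk.

Lemma pchar_exprB (a b : k) : (a - b) ^+ p = a ^+ p - b ^+ p.
Proof. by rewrite -!(pFrobenius_autE pk) rmorphB. Qed.

Lemma pchar_exprD (a b : k) : (a + b) ^+ p = a ^+ p + b ^+ p.
Proof. by rewrite -!(pFrobenius_autE pk) rmorphD. Qed.

(** By Zorn's lemma there is a maximal subgroup V of k that is stable under
multiplication by p-th powers and does not contain c. Every u is then
a^p c + v with v in V, for a unique a, and u |-> a is the required map. *)
Lemma exists_cartier_eq1 (c : k) : c != 0 -> exists C : cartier p k, C c = 1.
Proof.
move=> c0.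
(* the union of the empty chain is empty, so V may lack 0, which W adds *)
pose P (V : classical_sets.set k) := [/\ forall x z, V x -> V z -> V (x + z),
  forall a x, V x -> V (a ^+ p * x) & ~ V c].
have [F FP Ftot|V [[VD VM Vc] Vmax]] := @classical_sets.Zorn_bigcup k P.
  split.
  - move=> x z [X FX Xx] [Z FZ Zz]; case: (Ftot X Z FX FZ) => [XZ|ZX].
      by exists Z => //; have [+ _ _] := FP Z FZ; apply=> //; apply: XZ.
    by exists X => //; have [+ _ _] := FP X FX; apply=> //; apply: ZX.
  - by move=> a x [X FX Xx]; exists X => //; have [_ + _] := FP X FX; apply.
  - by move=> [X FX Xc]; have [_ _] := FP X FX; apply.
pose W x := V x \/ x = 0.
have WD x z : W x -> W z -> W (x + z).
  case=> [Vx|->]; last by rewrite add0r.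
  by case=> [Vz|->]; [left; apply: VD|rewrite addr0; left].
have WM a x : W x -> W (a ^+ p * x).
  by case=> [Vx|->]; [left; apply: VM|rewrite mulr0; right].
have WN x : W x -> W (- x).
  move=> /(WM (-1)); rewrite -[-1]sub0r pchar_exprB expr0n gtn_eqF // expr1n sub0r.
  by rewrite mulN1r.
have Wc : ~ W c by case=> // e; rewrite e eqxx in c0.
have ex u : exists a, W (u - a ^+ p * c).
  case: (pselect (V u)) => [Vu|nVu].
    by exists 0; rewrite expr0n gtn_eqF // mul0r subr0; left.
  pose V' x := exists a v, W v /\ x = a ^+ p * u + v.
  have [a [v [Wv cE]]] : V' c.
    apply: contrapT => nV'c; apply: (Vmax V').
      split=> [x Vx|/(_ u) h].
        exists 0, x; split; first by left.
        by rewrite expr0n gtn_eqF // mul0r add0r.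
      apply/nVu/h; exists 1, 0; split; first by right.
      by rewrite expr1n mul1r addr0.
    split=> //.
      move=> _ _ [a [v [Wv ->]]] [b [w [Ww ->]]]; exists (a + b), (v + w).
      by split; [apply: WD|rewrite pchar_exprD mulrDl addrACA].
    move=> b _ [a [v [Wv ->]]]; exists (b * a), (b ^+ p * v).
    by split; [apply: WM|rewrite exprMn mulrDr mulrA].
  have a0 : a != 0.
    apply: contra_notN Wc => /eqP a0.
    by rewrite cE a0 expr0n gtn_eqF // mul0r add0r.
  exists a^-1; rewrite cE mulrDr mulrA -exprMn mulVf // expr1n mul1r opprD addNKr.
  exact/WN/WM.
have uniq u a b : W (u - a ^+ p * c) -> W (u - b ^+ p * c) -> a = b.
  move=> Wa /WN Wb; apply/eqP; rewrite -subr_eq0; apply: contra_notT Wc => ab.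
  have := WD _ _ Wa Wb.
  have -> : u - a ^+ p * c - (u - b ^+ p * c) = (b - a) ^+ p * c.
    by rewrite pchar_exprB; ring.
  move=> /(WM (b - a)^-1).
  by rewrite mulrA -exprMn mulVf ?expr1n ?mul1r // subr_eq0 eq_sym -subr_eq0.
have /choice[f fP] := ex.
have [||C CE] := @cartier_of p k f.
- move=> x z; apply: (uniq (x - z)); first exact: fP.
  have := WD _ _ (fP x) (WN _ (fP z)).
  have -> // : x - f x ^+ p * c - (z - f z ^+ p * c) = x - z - (f x - f z) ^+ p * c.
  by rewrite pchar_exprB; ring.
- move=> a x; apply: (uniq (a ^+ p * x)); first exact: fP.
  by rewrite exprMn -mulrA -mulrBr; apply/WM/fP.
exists C; rewrite CE; apply: (uniq c); first exact: fP.
by rewrite expr1n mul1r subrr; right.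
Qed.

Lemma cartier_trace_field : cartier_trace p k.
Proof.
move=> x; case: (eqVneq x 0) => [->|/exists_cartier_eq1[C Cx]].
  by exists [::]; rewrite /cartier_trace_sum big_nil.
by exists [:: (x, C)]; rewrite /cartier_trace_sum big_seq1 /= Cx expr1n mulr1.
Qed.

Lemma noetherian_field : noetherian_mod (k^o : lmodType k).
Proof.
move=> P Pid; case: (pselect (P 1)) => [P1|nP1].
  exists [:: 1]; split=> [g|x _ Q Qid Qg]; first by rewrite inE => /eqP->.
  rewrite -[x]mulr1; apply: (is_submodZ Qid); apply: Qg; exact: mem_head.
exists [::]; split=> // x Px; case: (eqVneq x 0) => [->|x0].
  by move=> Q Qid _; apply: Qid.1.
case: nP1; rewrite -(mulVf x0); exact: (is_submodZ Pid).
Qed.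

Section SeriesCase.
Variable n : nat.
Local Notation S := (mseries n k).

Lemma mulm_lt (b m : 'X_{1..n}) : (b < m)%O -> ((b *+ p)%MM < (m *+ p)%MM)%O.
Proof.
move=> bm; rewrite -(prednK p_gt0); elim: p.-1 => [|q IHq]; first by rewrite !mulm1n.
by rewrite !(mulmS _ q.+1) ltm_add.
Qed.

Lemma mulm_le (b m : 'X_{1..n}) : (b <= m)%MM = (b *+ p <= m *+ p)%MM.
Proof.
by apply/mnm_lepP/mnm_lepP => h i; move: (h i); rewrite !mulmnE leq_pmul2r.
Qed.

Lemma mulm_inj (b m : 'X_{1..n}) : (b *+ p)%MM = (m *+ p)%MM -> b = m.
Proof.
move=> /mnmP h; apply/mnmP => i; have := h i; rewrite !mulmnE => /eqP.
by rewrite eqn_pmul2r // => /eqP.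
Qed.

Lemma mscoef_expp (f : S) (m : 'X_{1..n}) : mscoef (f ^+ p) (m *+ p)%MM = mscoef f m
  ^+ p.
Proof.
rewrite -[f ^+ p]mulr1 (mscoef_frob_conv _ _ pk (ltnSn _)) /frob_conv /shift_coef.
have mN : (mdeg m < (mdeg (m *+ p)).+1)%N by rewrite ltnS mdegMn leq_pmulr.
rewrite (bigD1 (BMultinom mN)) //= lepm_refl big1 ?addr0 => [|b].
  have -> : (m *+ p - m *+ p)%MM = 0%MM by apply/mnmP => i; rewrite mnmBE subnn mnm0E.
  by rewrite eqxx mulr1.
rewrite bmeqP /= => bm; case: ifP => [le|_]; last by rewrite mulr0.
case: eqP => [e|_]; last by rewrite mulr0.
by case/eqP: bm; apply: mulm_inj; rewrite -[RHS](submK le) e add0m.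
Qed.

Lemma zero_below_expp (f : S) m : zero_below m f -> zero_below (m *+ p)%MM (f ^+ p).
Proof.
move=> fm q qm; rewrite -[f ^+ p]mulr1 (mscoef_frob_conv _ _ pk (ltnSn _)) /frob_conv
  big1 // => b _.
rewrite /shift_coef; case: ifP => [le|_]; last by rewrite mulr0.
rewrite fm ?expr0n ?gtn_eqF // ?mul0r // ltNge le_eqVlt; apply/negP.
have bq : ((b *+ p)%MM <= q)%O by apply: lem_leo.
have := le_lt_trans bq qm => bm; case/orP => [/eqP mb|/mulm_lt].
  by rewrite mb ltxx in bm.
by rewrite ltNge ltW.
Qed.

Lemma cartier_residue (C : cartier p k) (e : 'X_{1..n}) : (forall i, e i < p)%N ->
  exists D : cartier p S, forall f m, mscoef (D f) m = C (mscoef f (m *+ p + e)%MM).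
Proof.
move=> ep.
pose G (g : 'X_{1..n} -> k) m := C (g (m *+ p + e)%MM).
have GB g h m : G (fun m' => g m' - h m') m = G g m - G h m by apply: raddfB.
have [F FE] := mseries_additive GB.
have FP (a f : S) : F (a ^+ p * f) = a * F f.
  apply: mseriesP => m; pose N := (mdeg (m *+ p + e)%MM).+1.
  have mN : (mdeg m < N)%N.
    by rewrite ltnS mdegD mdegMn (leq_trans _ (leq_addr _ _)) // leq_pmulr.
  rewrite FE /G (mscoef_frob_conv _ _ pk (ltnSn _)) (mscoef_conv _ _ mN).
  by rewrite residue_frob_conv //; congr (conv _ _ _ m); apply: funext.
by exists (Cartier FP).
Qed.

(** Let I0 be the set of the C(x), an ideal as Cartier maps can be added and
multiplied by scalars, and P the ideal of the z such that C(z) is in I0 for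
all C. It contains x and the p-th powers of elements of I0. If c is the
lowest coefficient of z in P, at the monomial p m' + r, and la is a Cartier map
of k with la(c) = 1, then the coefficients at residue r of z, mapped by la,
form an element of I0 with lowest coefficient 1 at m'. So the p-th powers of
elements f i that generate the lowest coefficients of I0 are a standard basis
of P; division writes x as a sum of q_i (f i)^p, where f i = C_i(x). *)
Lemma cartier_trace_mseries : cartier_trace p S.
Proof.
move=> x.
pose I0 (z : S) := exists C : cartier p S, z = C x.
have I0id : @is_submod S (S^o : lmodType S) I0.
  split.
    have [||C CE] := @cartier_of p S (fun=> 0).
    - by move=> a b; rewrite subrr.
    - by move=> a b; rewrite mulr0.
    by exists C; rewrite CE.
  move=> a _ _ [C ->] [D ->].
  have [||E EE] := @cartier_of p S (fun z => a * C z + D z).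
  - by move=> u v; rewrite !raddfB /= mulrBr opprD addrACA.
  - by move=> u v; rewrite !cartierP mulrDr mulrCA.
  by exists E; rewrite EE.
pose L m a := exists f : S, [/\ I0 f, mscoef f m = a & zero_below m f].
have [||I [e [eL Le]]] := dickson_multinom noetherian_field (L := L).
- move=> m; split.
    by exists 0; split=> [||m' _]; rewrite ?mscoef0 //; exact: I0id.1.
  move=> a u z [f [Pf <- f0]] [g [Pg <- g0]]; exists (msconst n a * f + g).
  split=> [||m' mm]; [exact: I0id.2|by rewrite mscoefD mscoefCM|].
  by rewrite mscoefD mscoefCM f0 // g0 // mulr0 addr0.
- move=> m m' a mm [f [Pf <- f0]].
  have [c ->] : exists c, m' = (c + m)%MM by exists (m' - m)%MM; rewrite submK.
  exists (msmono k c * f); split; last exact: zero_below_monoM.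
    exact: (is_submodZ I0id).
  exact: mscoef_monoM.
have /choice[f fP] := eL.
have /choice[C CP] : forall i, I0 (f i) by move=> i; case: (fP i).
pose P (z : S) := forall D : cartier p S, I0 (D z).
have Pid : @is_submod S (S^o : lmodType S) P.
  split=> [D|a u v hu hv D]; first by rewrite raddf0; apply: I0id.1.
  rewrite raddfD; apply: (is_submodD I0id) => //.
  have [||E EE] := @cartier_of p S (fun z => D (a * z)).
  - by move=> s t; rewrite mulrBr raddfB.
  - by move=> s t; rewrite mulrCA cartierP.
  by have := hu E; rewrite EE.
have Pf i : P (f i ^+ p).
  move=> D; rewrite -[_ ^+ p]mulr1 cartierP mulrC; apply: (is_submodZ I0id).
  by case: (fP i).
have Px : P x by move=> D; exists D.
have [||q xE] := @division n k I (fun i => f i ^+ p) (fun i => (e i).1 *+ p)%MM P Pid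
  Pf _ _ x Px.
- by move=> i; apply: zero_below_expp; case: (fP i).
- move=> z m Pz zm T Tid Ti.
  case: (eqVneq (mscoef z m) 0) => [->|c0]; first exact: Tid.1.
  have [la lac] := exists_cartier_eq1 c0.
  pose m' : 'X_{1..n} := [multinom (m i %/ p)%N | i < n].
  pose r : 'X_{1..n} := [multinom (m i %% p)%N | i < n].
  have mE : (m' *+ p + r)%MM = m.
    by apply/mnmP => i; rewrite mnmDE mulmnE !mnmE -divn_eq.
  have [|D DE] := @cartier_residue la r; first by move=> i; rewrite mnmE ltn_mod.
  have L1 : L m' 1.
    exists (D z); split; [exact: Pz|by rewrite DE mE|move=> b bm].
    by rewrite DE zm ?raddf0 // -mE ltmc_add2l mulm_lt.
  rewrite -[mscoef z m]mulr1 -(expr1n _ p).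
  apply: (Le m' 1 L1 (fun a => T (mscoef z m * a ^+ p))).
    split=> [|a u v hu hv]; first by rewrite expr0n gtn_eqF // mulr0; apply: Tid.1.
    rewrite pchar_exprD exprMn mulrDr mulrCA; exact: Tid.2.
  move=> i im; apply: (is_submodZ Tid).
  have := Ti i; rewrite mscoef_expp; have [_ -> _] := fP i; apply.
  rewrite -mE; apply: lepm_trans (lem_addr _ _); by rewrite -mulm_le.
exists [seq (q i, C i) | i : I]; rewrite {1}xE /cartier_trace_sum big_image /=.
by apply: eq_bigr => i _; rewrite -CP.
Qed.

End SeriesCase.
End FieldCase.

(** * The base rings *)

Section BaseRings.
Variables (k : fieldType) (p : nat).
Hypothesis pk : p \in [pchar k].

Lemma pchar_mseries d : p \in [pchar (mseries d k)].
Proof.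
move: pk; rewrite !inE => /andP[-> /eqP p0]; apply/eqP/mseriesP => m.
have E q (f : mseries d k) : mscoef (f *+ q) m = mscoef f m *+ q.
  by elim: q => [|q IHq]; rewrite ?mscoef0 // !mulrS mscoefD IHq.
by rewrite E mscoef0 -mulr_natl p0 mul0r.
Qed.

Lemma base_ring_properties d b : [/\ frobenius_coordinates p (@base_var k d b),
  cartier_trace p (base_ring k d b) &
  noetherian_mod ((base_ring k d b)^o : lmodType (base_ring k d b))].
Proof.
have trk := cartier_trace_field pk; have nk := @noetherian_field k.
have trS := cartier_trace_mseries pk (n := d).
have nS := noetherian_mseries (n := d) nk; have pS := pchar_mseries d.
case: b => [||m] /=; split.
- exact: frobenius_coordinates_mpoly.
- exact: cartier_trace_mpoly.
- exact: noetherian_mpoly.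
- exact: frobenius_coordinates_mseries.
- exact: trS.
- exact: nS.
- exact/frobenius_coordinates_mpolyC/frobenius_coordinates_mseries.
- exact: cartier_trace_mpoly.
- exact: noetherian_mpoly.
Qed.
End BaseRings.

Theorem theorem1p1 (k : fieldType) (p : nat) (hp : p \in [pchar k]%R)
  (hk : infinite_set [set: k]%classic)
  (b : base_kind) (d r : nat) (hr : (1 <= r)%N) (hrd : (r <= d)%N)
  (M : lmodType (base_ring k d b)) (hM : frob_finite p M)
  (i : nat) (hi : (i <= r)%N) :
  frob_finite p (koszul_homology (base_seq_proper k b hrd) M i).
Proof.
have [spl trR nR] := base_ring_properties hp d b.
have wi : injective (widen_ord hrd).
  by move=> j l e; apply: val_inj; exact: (congr1 val e).
have [kap [kapC kapP kapE]] := frobenius_coordinates_widen wi spl.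
exact: (koszul_frob_finite (base_seq_proper k b hrd) (pchar_gt0 hp) kapC kapP kapE
  trR nR i hM).
Qed.
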